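(* Let $A$ be a finite dimensional algebra over a field $\mathbf{k}$, let $\mathbf{P}$ be a 2-term silting complex in $K^b(\operatorname{proj}A)$ and let $B=\operatorname{End}_{D^b(A)}(\mathbf{P})$. Let $P_i$ be an indecomposable projective $A$-module with $P_i\notin\operatorname{add}\mathbf{P}$ and $P_i[1]\notin\operatorname{add}\mathbf{P}$, and let $E$ be the middle term of the almost split sequence in $\operatorname{mod}B$ starting at $\operatorname{Hom}_{D^b(A)}(\mathbf{P},\nu P_i)$. Then the canonical sequence of $E$ in the torsion pair $(\mathcal{X}(\mathbf{P}),\mathcal{Y}(\mathbf{P}))$ is $$0\to\operatorname{Hom}_{D^b(A)}(\mathbf{P},(\operatorname{rad}P_i)[1])\to E\to\operatorname{Hom}_{D^b(A)}(\mathbf{P},\nu P_i/S_i)\to0,$$ where $\operatorname{rad}P_i$ denotes the radical of $P_i$ and $S_i$ is the simple module $P_i/\operatorname{rad}P_i$.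
   Context: $\operatorname{mod}A$ is the category of finitely generated right $A$-modules, $D^b(A)$ its bounded derived category with shift $[1]$, and $K^b(\operatorname{proj}A)$ the bounded homotopy category of finitely generated projective modules, viewed inside $D^b(A)$. $\operatorname{add}\mathbf{P}$ is the full subcategory (closed under isomorphism) of direct summands of finite direct sums of copies of $\mathbf{P}$. $\nu=D\operatorname{Hom}_A(-,A)$ is the Nakayama functor ($D$ the $\mathbf{k}$-dual); $S_i$ is identified with the socle of the indecomposable injective module $\nu P_i$. A 2-term silting complex is a complex $\mathbf{P}=\{P^i\}$ in $K^b(\operatorname{proj}A)$ with $P^i=0$ for $i\ne-1,0$, $\operatorname{Hom}_{K^b(\operatorname{proj}A)}(\mathbf{P},\mathbf{P}[1])=0$, and such that the smallest triangulated subcategory closed under direct summands containing $\mathbf{P}$ is $K^b(\operatorname{proj}A)$. For it, $\mathcal{T}(\mathbf{P})=\{X\in\operatorname{mod}A\mid\operatorname{Hom}_{D^b(A)}(\mathbf{P},X[1])=0\}$ and $\mathcal{F}(\mathbf{P})=\{Y\in\operatorname{mod}A\mid\operatorname{Hom}_{D^b(A)}(\mathbf{P},Y)=0\}$. $\operatorname{Hom}_{D^b(A)}(\mathbf{P},X)$ is a right $B$-module by precomposition, and $\mathcal{X}(\mathbf{P})=\operatorname{Hom}_{D^b(A)}(\mathbf{P},\mathcal{F}(\mathbf{P})[1])$, $\mathcal{Y}(\mathbf{P})=\operatorname{Hom}_{D^b(A)}(\mathbf{P},\mathcal{T}(\mathbf{P}))$; these form a torsion pair $(\mathcal{X}(\mathbf{P}),\mathcal{Y}(\mathbf{P}))$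 in $\operatorname{mod}B$. The canonical sequence of $E$ is the (unique up to isomorphism) short exact sequence with middle term $E$, left term in $\mathcal{X}(\mathbf{P})$ and right term in $\mathcal{Y}(\mathbf{P})$. *)

(* Defs.v *)
From HB Require Import structures.
From mathcomp Require Import all_boot all_order all_algebra all_field.

Set Implicit Arguments.
Unset Strict Implicit.
Unset Printing Implicit Defensive.

Import GRing.Theory Num.Theory.
Local Open Scope ring_scope.

(* Over a finite dimensional algebra, finitely generated means finite
   dimensional over the ground field.  [ract a v] is v.a, so that [ract] is
   an anti-homomorphism from A to the endomorphisms of the vector space. *)
Record rmod (k : fieldType) (A : falgType k) := RMod {
  rcarrier :> vectType k;
  ract : A -> 'End(rcarrier);
  ract_linear : forall (c : k) (a b : A),
    ract (c *: a + b) = c *: ract a + ract b;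
  ract1 : ract 1 = \1%VF;
  ractM : forall a b : A, ract (a * b) = (ract b \o ract a)%VF }.

Arguments ract {k A} M a : rename.

Section Modules.
Variables (k : fieldType) (A : falgType k).
Implicit Types L M N : rmod A.

Definition rlinear M N (f : 'Hom(M, N)) : Prop :=
  forall (a : A) (v : M), f (ract M a v) = ract N a (f v).

Definition is_zero M : Prop := forall v : M, v = 0.

Definition rmono M N (f : 'Hom(M, N)) : Prop := rlinear f /\ lker f = 0%VS.
Definition repi M N (f : 'Hom(M, N)) : Prop := rlinear f /\ limg f = fullv.
Definition riso M N (f : 'Hom(M, N)) : Prop := rmono f /\ repi f.

Definition short_exact L M N (f : 'Hom(L, M)) (g : 'Hom(M, N)) : Prop :=
  [/\ rmono f, repi g & limg f = lker g].

Definition split_mono M N (f : 'Hom(M, N)) : Prop :=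
  exists2 r : 'Hom(N, M), rlinear r & (r \o f)%VF = \1%VF.
Definition split_epi M N (f : 'Hom(M, N)) : Prop :=
  exists2 s : 'Hom(N, M), rlinear s & (f \o s)%VF = \1%VF.

Definition left_almost_split L M (f : 'Hom(L, M)) : Prop :=
  [/\ rlinear f, ~ split_mono f &
      forall (N : rmod A) (h : 'Hom(L, N)), rlinear h -> ~ split_mono h ->
        exists2 h' : 'Hom(M, N), rlinear h' & h = (h' \o f)%VF].

Definition right_almost_split M N (g : 'Hom(M, N)) : Prop :=
  [/\ rlinear g, ~ split_epi g &
      forall (L : rmod A) (h : 'Hom(L, N)), rlinear h -> ~ split_epi h ->
        exists2 h' : 'Hom(L, M), rlinear h' & h = (g \o h')%VF].

Definition almost_split_sequence L M N (f : 'Hom(L, M)) (g : 'Hom(M, N)) :=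
  [/\ short_exact f g, left_almost_split f & right_almost_split g].

Definition projective M : Prop :=
  forall (X Y : rmod A) (g : 'Hom(X, Y)) (f : 'Hom(M, Y)),
    repi g -> rlinear f ->
    exists2 f' : 'Hom(M, X), rlinear f' & f = (g \o f')%VF.

Definition submodule M (U : {vspace M}) : Prop :=
  forall (a : A) (v : M), v \in U -> ract M a v \in U.

Definition simple_submodule M (U : {vspace M}) : Prop :=
  [/\ submodule U, U <> 0%VS &
      forall V, submodule V -> (V <= U)%VS -> V = 0%VS \/ V = U].

Definition maximal_submodule M (U : {vspace M}) : Prop :=
  [/\ submodule U, U <> fullv &
      forall V, submodule V -> (U <= V)%VS -> V = U \/ V = fullv].

Definition is_radical M (U : {vspace M}) : Prop :=
  forall v : M, v \in U <-> (forall V, maximal_submodule V -> v \in V).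

(* the sum of all simple submodules, i.e. the least submodule containing
   them *)
Definition is_socle M (U : {vspace M}) : Prop :=
  [/\ submodule U, forall V, simple_submodule V -> (V <= U)%VS &
      forall W, submodule W ->
        (forall V, simple_submodule V -> (V <= W)%VS) -> (U <= W)%VS].

Fact rzero_linear (c : k) (a b : A) :
  (0 : 'End('rV[k]_0)) = c *: 0 + 0.
Proof. by rewrite scaler0 addr0. Qed.
Fact rzero_act1 : (0 : 'End('rV[k]_0)) = \1%VF.
Proof. by apply/lfunP=> v; rewrite [LHS]thinmx0 [RHS]thinmx0. Qed.
Fact rzero_actM (a b : A) :
  (0 : 'End('rV[k]_0)) = ((0 : 'End('rV[k]_0)) \o (0 : 'End('rV[k]_0)))%VF.
Proof. by rewrite comp_lfun0l. Qed.

Definition rzero : rmod A := RMod rzero_linear rzero_act1 rzero_actM.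

End Modules.

Section DiagonalMap.
Variables (k : fieldType) (V V' W W' : vectType k).
Variables (f : 'Hom(V, V')) (g : 'Hom(W, W')).

Definition diag_fun (p : V * W) : V' * W' := (f p.1, g p.2).
Fact diag_fun_is_linear : linear diag_fun.
Proof. by move=> c p q; rewrite /diag_fun /= !linearP. Qed.
HB.instance Definition _ :=
  GRing.isLinear.Build k (V * W)%type (V' * W')%type _ diag_fun
    diag_fun_is_linear.

Definition diag_lfun : 'Hom((V * W)%type, (V' * W')%type) := linfun diag_fun.

Lemma diag_lfunE p : diag_lfun p = (f p.1, g p.2).
Proof. by rewrite lfunE. Qed.
End DiagonalMap.

Section DirectSum.
Variables (k : fieldType) (A : falgType k) (M N : rmod A).

Definition rsum_act (a : A) : 'End((M * N)%type) :=
  diag_lfun (ract M a) (ract N a).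

Fact rsum_act_linear (c : k) (a b : A) :
  rsum_act (c *: a + b) = c *: rsum_act a + rsum_act b.
Proof.
apply/lfunP=> p; rewrite add_lfunE scale_lfunE !diag_lfunE !ract_linear.
by rewrite !add_lfunE !scale_lfunE.
Qed.
Fact rsum_act1 : rsum_act 1 = \1%VF.
Proof. by apply/lfunP=> -[x y]; rewrite diag_lfunE !ract1 !id_lfunE. Qed.
Fact rsum_actM (a b : A) : rsum_act (a * b) = (rsum_act b \o rsum_act a)%VF.
Proof.
by apply/lfunP=> p; rewrite comp_lfunE !diag_lfunE !ractM !comp_lfunE.
Qed.

Definition rsum : rmod A := RMod rsum_act_linear rsum_act1 rsum_actM.

Lemma rsum_actE (a : A) (p : rsum) :
  ract rsum a p = (ract M a p.1, ract N a p.2).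
Proof. exact: diag_lfunE. Qed.
End DirectSum.

Definition indecomposable (k : fieldType) (A : falgType k) (M : rmod A) :=
  ~ is_zero M /\
  forall (M1 M2 : rmod A) (f : 'Hom(M, rsum M1 M2)),
    riso f -> is_zero M1 \/ is_zero M2.

Section Regular.
Variables (k : fieldType) (A : falgType k).

Fact regular_linear (c : k) (a b : A) :
  amulr (c *: a + b) = c *: amulr a + amulr b.
Proof. exact: linearP. Qed.
Fact regular_act1 : amulr (1 : A) = \1%VF.
Proof. by apply/lfunP=> v; rewrite lfunE /= mulr1 id_lfunE. Qed.
Fact regular_actM (a b : A) : amulr (a * b) = (amulr b \o amulr a)%VF.
Proof. by apply/lfunP=> v; rewrite comp_lfunE !lfunE /= mulrA. Qed.

Definition regular : rmod A := RMod regular_linear regular_act1 regular_actM.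
End Regular.

Section HomSpace.
Variables (k : fieldType) (A : falgType k) (M N : rmod A).

Definition equiv_defect (a : A) (f : 'Hom(M, N)) : 'Hom(M, N) :=
  ((f \o ract M a) - (ract N a \o f))%VF.
Fact equiv_defect_is_linear a : linear (equiv_defect a).
Proof.
move=> c f g; apply/lfunP=> v; rewrite /equiv_defect.
rewrite !(add_lfunE, opp_lfunE, scale_lfunE, comp_lfunE) linearP /=.
by rewrite scalerBr opprD addrACA.
Qed.
HB.instance Definition _ a :=
  GRing.isLinear.Build k 'Hom(M, N) 'Hom(M, N) _ (equiv_defect a)
    (equiv_defect_is_linear a).

(* Hom_A(M, N), cut out by the equivariance conditions on a basis of A *)
Definition homA : {vspace 'Hom(M, N)} :=
  (\bigcap_(i < \dim {:A}) lker (linfun (equiv_defect (vbasis {:A})`_i)))%VS.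

Lemma homAP (f : 'Hom(M, N)) : f \in homA <-> rlinear f.
Proof.
pose lact (P : rmod A) : {linear A -> 'End(P)} :=
  HB.pack (ract P) (GRing.isLinear.Build _ _ _ _ _ (@ract_linear _ _ P)).
have lactE P : ract P =1 lact P by [].
split=> [Hf a v|Hf]; last first.
  rewrite memvE; apply/subv_bigcapP=> i _; rewrite -memvE memv_ker lfunE /=.
  apply/eqP/lfunP=> v; rewrite !(add_lfunE, opp_lfunE, comp_lfunE) Hf.
  by rewrite subrr zero_lfunE.
rewrite (coord_vbasis (memvf a)) !lactE !linear_sum !sum_lfunE linear_sum.
apply: eq_bigr => i _; rewrite !linearZ !scale_lfunE !linearZ; congr (_ *: _).
move: Hf; rewrite memvE => /subv_bigcapP/(_ i isT).
rewrite -memvE memv_ker lfunE /= => /eqP/lfunP/(_ v).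
rewrite !(add_lfunE, opp_lfunE, comp_lfunE) zero_lfunE => /eqP.
by rewrite subr_eq0 => /eqP.
Qed.
End HomSpace.

(* The Nakayama functor D Hom_A(-, A), on objects. *)
Section Nakayama.
Variables (k : fieldType) (A : falgType k) (P : rmod A).

(* Hom_A(P, A), with its left A-action (a.f)(p) = a * f p *)
Definition hom_dual : vectType k := subvs_of (homA P (regular A)).

Fact left_mult_homA (a : A) (f : 'Hom(P, regular A)) :
  f \in homA P (regular A) -> (amull a \o f)%VF \in homA P (regular A).
Proof.
move=> /homAP Hf; apply/homAP=> b v.
by rewrite !comp_lfunE Hf /= !lfunE /= mulrA.
Qed.

Definition hom_dual_fun (a : A) (f : hom_dual) : hom_dual :=
  vsproj (homA P (regular A)) (amull a \o vsval f)%VF.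
Fact hom_dual_fun_is_linear a : linear (hom_dual_fun a).
Proof.
move=> c f g; rewrite /hom_dual_fun linearP /= comp_lfunDr -comp_lfunZr.
by rewrite linearP.
Qed.
HB.instance Definition _ a :=
  GRing.isLinear.Build k hom_dual hom_dual _ (hom_dual_fun a)
    (hom_dual_fun_is_linear a).

Lemma hom_dual_funE a f : vsval (hom_dual_fun a f) = (amull a \o vsval f)%VF.
Proof. by rewrite vsprojK // left_mult_homA // subvsP. Qed.

Definition nu_fun (a : A) (phi : 'Hom(hom_dual, k^o)) : 'Hom(hom_dual, k^o) :=
  (phi \o linfun (hom_dual_fun a))%VF.
Fact nu_fun_is_linear a : linear (nu_fun a).
Proof. by move=> c f g; rewrite /nu_fun comp_lfunDl comp_lfunZl. Qed.
HB.instance Definition _ a :=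
  GRing.isLinear.Build k 'Hom(hom_dual, k^o) 'Hom(hom_dual, k^o) _ (nu_fun a)
    (nu_fun_is_linear a).

Definition nu_act (a : A) : 'End('Hom(hom_dual, k^o)) := linfun (nu_fun a).

Lemma nu_actE a phi f : nu_act a phi f = phi (hom_dual_fun a f).
Proof. by rewrite lfunE /= comp_lfunE lfunE. Qed.

Fact nu_linear (c : k) (a b : A) :
  nu_act (c *: a + b) = c *: nu_act a + nu_act b.
Proof.
apply/lfunP=> phi; apply/lfunP=> f.
rewrite !(add_lfunE, scale_lfunE, nu_actE) -linearP; congr (phi _).
apply/val_inj; rewrite [LHS]hom_dual_funE [RHS]linearP /= !hom_dual_funE.
apply/lfunP=> v; rewrite !(add_lfunE, scale_lfunE, comp_lfunE) !lfunE /=.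
by rewrite mulrDl scalerAl.
Qed.
Fact nu_act1 : nu_act 1 = \1%VF.
Proof.
apply/lfunP=> phi; apply/lfunP=> f; rewrite nu_actE id_lfunE; congr (phi _).
apply/val_inj; rewrite /= hom_dual_funE; apply/lfunP=> v.
by rewrite comp_lfunE lfunE /= mul1r.
Qed.
Fact nu_actM (a b : A) : nu_act (a * b) = (nu_act b \o nu_act a)%VF.
Proof.
apply/lfunP=> phi; apply/lfunP=> f; rewrite comp_lfunE !nu_actE; congr (phi _).
apply/val_inj; rewrite /= !hom_dual_funE; apply/lfunP=> v.
by rewrite !comp_lfunE !lfunE /= mulrA.
Qed.

Definition nu : rmod A := RMod nu_linear nu_act1 nu_actM.
End Nakayama.

(* A constant rather than a bare [i + 1], so that the types X^(i+1) always
   mention the degree in the same form. *)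
Definition nxt (i : int) : int := i + 1.

Section Complexes.
Variables (k : fieldType) (A : falgType k).

Record cplx := Cplx {
  cob :> int -> rmod A;
  cd : forall i : int, 'Hom(cob i, cob (nxt i));
  cd_rlinear : forall i, rlinear (cd i);
  cd_sq : forall i, (cd (nxt i) \o cd i)%VF = 0 }.

Record cmap (X Y : cplx) := CMap {
  cfun :> forall i : int, 'Hom(X i, Y i);
  cfun_rlinear : forall i, rlinear (cfun i);
  cfun_comm : forall i, (cd Y i \o cfun i)%VF = (cfun (nxt i) \o cd X i)%VF }.

Section Maps.
Implicit Types X Y Z : cplx.

Fact cid_rlinear X i : rlinear (\1%VF : 'End(X i)).
Proof. by move=> a v; rewrite !id_lfunE. Qed.
Fact cid_comm X i : (cd X i \o \1)%VF = (\1 \o cd X i)%VF.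
Proof. by rewrite comp_lfun1l comp_lfun1r. Qed.
Definition cid X : cmap X X := CMap (@cid_rlinear X) (@cid_comm X).

Fact czero_rlinear X Y i : rlinear (0 : 'Hom(X i, Y i)).
Proof. by move=> a v; rewrite !zero_lfunE linear0. Qed.
Fact czero_comm X Y i :
  (cd Y i \o (0 : 'Hom(X i, Y i)))%VF =
  ((0 : 'Hom(X (nxt i), Y (nxt i))) \o cd X i)%VF.
Proof. by rewrite comp_lfun0l comp_lfun0r. Qed.
Definition czero X Y : cmap X Y :=
  CMap (@czero_rlinear X Y) (@czero_comm X Y).

Section Comp.
Variables (X Y Z : cplx) (g : cmap Y Z) (f : cmap X Y).
Fact ccomp_rlinear i : rlinear (g i \o f i)%VF.
Proof. by move=> a v; rewrite !comp_lfunE !cfun_rlinear. Qed.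
Fact ccomp_comm i :
  (cd Z i \o (g i \o f i))%VF = ((g (nxt i) \o f (nxt i)) \o cd X i)%VF.
Proof. by rewrite comp_lfunA cfun_comm -comp_lfunA cfun_comm comp_lfunA. Qed.
Definition ccomp : cmap X Z := CMap ccomp_rlinear ccomp_comm.
End Comp.

Section Lin.
Variables (X Y : cplx) (c : k) (f g : cmap X Y).
Fact clin_rlinear i : rlinear (c *: f i + g i).
Proof.
move=> a v; rewrite !(add_lfunE, scale_lfunE) !cfun_rlinear.
by rewrite linearP.
Qed.
Fact clin_comm i :
  (cd Y i \o (c *: f i + g i))%VF = ((c *: f (nxt i) + g (nxt i)) \o cd X i)%VF.
Proof.
by rewrite comp_lfunDl comp_lfunDr -comp_lfunZl -comp_lfunZr !cfun_comm.
Qed.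
Definition clin : cmap X Y := CMap clin_rlinear clin_comm.
End Lin.

(* The homotopy h is indexed so that h i has degree -1: X^(i+1) -> Y^i. *)
Definition homotopic X Y (f g : cmap X Y) : Prop :=
  exists2 h : forall i : int, 'Hom(X (nxt i), Y i),
    forall i, rlinear (h i) &
    forall i, f (nxt i) - g (nxt i) =
      ((cd Y i \o h i) + (h (nxt i) \o cd X (nxt i)))%VF.

(* bijectivity of H^(i+1)(f) for all i *)
Definition quasi_iso X Y (f : cmap X Y) : Prop :=
  forall i : int,
    (forall x : X (nxt i), cd X (nxt i) x = 0 ->
       (exists y : Y i, f (nxt i) x = cd Y i y) ->
       exists x' : X i, x = cd X i x') /\
    (forall y : Y (nxt i), cd Y (nxt i) y = 0 ->
       exists2 x : X (nxt i), cd X (nxt i) x = 0 &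
         exists y' : Y i, y - f (nxt i) x = cd Y i y').

(* isomorphism in the homotopy category *)
Definition htp_iso X Y : Prop :=
  exists (f : cmap X Y) (g : cmap Y X),
    homotopic (ccomp g f) (cid X) /\ homotopic (ccomp f g) (cid Y).

Definition bounded X : Prop :=
  exists n : nat, forall i : int, (n < `|i|)%N -> is_zero (X i).

(* the objects of K^b(proj A) *)
Definition perfect X : Prop := bounded X /\ forall i, projective (X i).
End Maps.

Section Shift.
Variable X : cplx.
Fact shift_rlinear (i : int) : rlinear (- cd X (nxt i)).
Proof. by move=> a v; rewrite !opp_lfunE cd_rlinear linearN. Qed.
Fact shift_sq (i : int) : ((- cd X (nxt (nxt i))) \o (- cd X (nxt i)))%VF = 0.
Proof. by rewrite comp_lfunNl comp_lfunNr cd_sq !oppr0. Qed.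
(* X[1] *)
Definition shift : cplx :=
  @Cplx (fun i : int => X (nxt i)) (fun i : int => - cd X (nxt i))
    shift_rlinear shift_sq.
End Shift.

Section Stalk.
Variable M : rmod A.
Definition stalk_ob (i : int) : rmod A := if i == 0 then M else rzero A.
Fact stalk_rlinear (i : int) : rlinear (0 : 'Hom(stalk_ob i, stalk_ob (nxt i))).
Proof. by move=> a v; rewrite !zero_lfunE linear0. Qed.
Fact stalk_sq (i : int) :
  ((0 : 'Hom(stalk_ob (nxt i), stalk_ob (nxt (nxt i)))) \o
   (0 : 'Hom(stalk_ob i, stalk_ob (nxt i))))%VF = 0.
Proof. by rewrite comp_lfun0l. Qed.
Definition stalk : cplx := Cplx stalk_rlinear stalk_sq.
End Stalk.

Section Sum.
Variables X Y : cplx.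
Definition csum_d (i : int) :
  'Hom(rsum (X i) (Y i), rsum (X (nxt i)) (Y (nxt i))) :=
  diag_lfun (cd X i) (cd Y i).
Fact csum_rlinear (i : int) : rlinear (csum_d i).
Proof. by move=> a p; rewrite !diag_lfunE /= !cd_rlinear. Qed.
Fact csum_sq (i : int) : (csum_d (nxt i) \o csum_d i)%VF = 0.
Proof.
apply/lfunP=> p; rewrite comp_lfunE !diag_lfunE /= -!comp_lfunE !cd_sq.
by rewrite !zero_lfunE.
Qed.
Definition csum : cplx :=
  @Cplx (fun i : int => rsum (X i) (Y i)) csum_d csum_rlinear csum_sq.
End Sum.

Section Cone.
Variables (X Y : cplx) (f : cmap X Y).
Definition cone_fun (i : int) (p : rsum (X (nxt i)) (Y i)) :
  rsum (X (nxt (nxt i))) (Y (nxt i)) :=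
  (- cd X (nxt i) p.1, f (nxt i) p.1 + cd Y i p.2).
Fact cone_fun_is_linear (i : int) : linear (@cone_fun i).
Proof.
move=> c p q; rewrite /cone_fun /= !linearP; congr (_, _) => /=.
by rewrite scalerDr addrACA.
Qed.
HB.instance Definition _ (i : int) :=
  GRing.isLinear.Build k (rsum (X (nxt i)) (Y i))
    (rsum (X (nxt (nxt i))) (Y (nxt i))) _ (@cone_fun i) (@cone_fun_is_linear i).
Definition cone_d (i : int) :
  'Hom(rsum (X (nxt i)) (Y i), rsum (X (nxt (nxt i))) (Y (nxt i))) :=
  linfun (@cone_fun i).
Lemma cone_dE (i : int) p : cone_d i p = cone_fun p.
Proof. by rewrite lfunE. Qed.
Fact cone_rlinear (i : int) : rlinear (cone_d i).
Proof.
move=> a p; rewrite [RHS]rsum_actE !cone_dE [X in cone_fun X]rsum_actE /cone_fun /=.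
by rewrite !cd_rlinear cfun_rlinear linearD linearN.
Qed.
Fact cone_sq (i : int) : (cone_d (nxt i) \o cone_d i)%VF = 0.
Proof.
apply/lfunP=> p; rewrite comp_lfunE !cone_dE [RHS]zero_lfunE /cone_fun /=.
have sq (Z : cplx) j (z : Z j) : cd Z (nxt j) (cd Z j z) = 0.
  by rewrite -comp_lfunE cd_sq zero_lfunE.
have fd : cd Y (nxt i) (f (nxt i) p.1) = f (nxt (nxt i)) (cd X (nxt i) p.1).
  by rewrite -!comp_lfunE cfun_comm.
congr (_, _) => /=; first by rewrite linearN /= sq !oppr0.
by rewrite linearN linearD /= fd sq addr0 addNr.
Qed.
Definition cone : cplx :=
  @Cplx (fun i : int => rsum (X (nxt i)) (Y i)) cone_d cone_rlinear cone_sq.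
End Cone.

Fact quasi_iso_cid (X : cplx) : quasi_iso (cid X).
Proof.
split=> [x _ [y]|y dy]; first by rewrite id_lfunE; exists y.
by exists y => //; exists 0; rewrite id_lfunE subrr linear0.
Qed.
End Complexes.

Section Silting.
Variables (k : fieldType) (A : falgType k).
Implicit Types X Y P : cplx A.

Fixpoint cpow (n : nat) P : cplx A :=
  if n is n'.+1 then csum P (cpow n' P) else stalk (rzero A).

(* membership in add P, inside K^b(proj A) *)
Definition in_add P X : Prop :=
  perfect X /\
  exists (n : nat) (Y : cplx A), perfect Y /\ htp_iso (csum X Y) (cpow n P).

(* Triangulated subcategories of K^b(proj A) closed under direct summands.
   Every distinguished triangle is isomorphic to one given by a cone, and
   closure under [-1] is the right-to-left part of [thick_shift]. *)
Record thick_subcat (C : cplx A -> Prop) : Prop := {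
  thick_perfect : forall X, C X -> perfect X;
  thick_iso : forall X Y, perfect Y -> htp_iso X Y -> C X -> C Y;
  thick_shift : forall X, perfect X -> C X <-> C (shift X);
  thick_cone : forall X Y (f : cmap X Y), C X -> C Y -> C (cone f);
  thick_summand : forall X Y, perfect X -> perfect Y -> C (csum X Y) -> C X }.

Record two_term_silting P : Prop := {
  silting_perfect : perfect P;
  silting_two_term : forall i : int, i <> -1 -> i <> 0 -> is_zero (P i);
  silting_rigid : forall f : cmap P (shift P), homotopic f (czero P (shift P));
  silting_generates : forall C : cplx A -> Prop, thick_subcat C -> C P ->
    forall X, perfect X -> C X }.
End Silting.

Section Derived.
Variables (k : fieldType) (A : falgType k).
Implicit Types X Y Z : cplx A.

(* D^b(A) is the localization of K^b(mod A) at the quasi-isomorphisms: a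
   morphism X -> Y is represented by a roof X <- apex -> Y. *)
Record roof X Y := Roof {
  apex : cplx A;
  apex_bounded : bounded apex;
  den : cmap apex X;
  den_qiso : quasi_iso den;
  num : cmap apex Y }.

(* (s1, f1) and (s2, f2) represent the same morphism X -> Y *)
Definition frac_equiv X Y Z1 Z2 (s1 : cmap Z1 X) (f1 : cmap Z1 Y)
    (s2 : cmap Z2 X) (f2 : cmap Z2 Y) : Prop :=
  exists (Z : cplx A) (u1 : cmap Z Z1) (u2 : cmap Z Z2),
    [/\ bounded Z, quasi_iso (ccomp s1 u1),
        homotopic (ccomp s1 u1) (ccomp s2 u2) &
        homotopic (ccomp f1 u1) (ccomp f2 u2)].

Definition roof_equiv X Y (r r' : roof X Y) : Prop :=
  frac_equiv (den r) (num r) (den r') (num r').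

(* h represents the composite of g after f *)
Definition roof_comp X Y W (g : roof Y W) (f : roof X Y) (h : roof X W) :=
  exists (Z : cplx A) (t : cmap Z (apex f)) (u : cmap Z (apex g)),
    [/\ bounded Z, quasi_iso t,
        homotopic (ccomp (num f) t) (ccomp (den g) u) &
        frac_equiv (den h) (num h)
          (ccomp (den f) t) (ccomp (num g) u)].

(* Hom_{D^b(A)}(X, Y) = 0 *)
Definition Dhom_zero X Y : Prop :=
  forall r : roof X Y, frac_equiv (den r) (num r) (den r) (czero (apex r) Y).

(* cl induces a k-linear isomorphism from Hom_{D^b(A)}(X, Y) onto V *)
Record is_Dhom X Y (V : vectType k) (cl : roof X Y -> V) : Prop := {
  Dhom_surj : forall v : V, exists r, cl r = v;
  Dhom_eq : forall r r', cl r = cl r' <-> roof_equiv r r';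
  Dhom_lin : forall Z (bZ : bounded Z) (s : cmap Z X) (qs : quasi_iso s)
      (c : k) (f g : cmap Z Y),
    cl (Roof bZ qs (clin c f g)) = c *: cl (Roof bZ qs f) + cl (Roof bZ qs g) }.

(* cl identifies the algebra End_{D^b(A)}(P) with B; the product of B is
   composition: b * b' is b after b'. *)
Record is_Dend (P : cplx A) (B : falgType k) (cl : roof P P -> B) : Prop := {
  Dend_hom : is_Dhom cl;
  Dend_1 : forall bP : bounded P,
    cl (Roof bP (quasi_iso_cid P) (cid P)) = 1;
  Dend_M : forall g f h : roof P P, roof_comp g f h -> cl h = cl g * cl f }.

(* clX identifies the right B-module Hom_{D^b(A)}(P, X), where B acts by
   precomposition, with M. *)
Record is_Dhom_mod (P : cplx A) (B : falgType k) (cl : roof P P -> B)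
    (X : cplx A) (M : rmod B) (clX : roof P X -> M) : Prop := {
  Dhom_mod_hom : is_Dhom clX;
  Dhom_mod_act : forall (g : roof P X) (b : roof P P) (h : roof P X),
    roof_comp g b h -> clX h = ract M (cl b) (clX g) }.

Definition Dhom_mod (P : cplx A) (B : falgType k) (cl : roof P P -> B)
    (X : cplx A) (M : rmod B) : Prop :=
  exists clX : roof P X -> M, is_Dhom_mod cl clX.
End Derived.

Section TorsionPairs.
Variables (k : fieldType) (A : falgType k) (P : cplx A).

Definition torT (X : rmod A) : Prop := Dhom_zero P (shift (stalk X)).
Definition torF (Y : rmod A) : Prop := Dhom_zero P (stalk Y).

Variables (B : falgType k) (cl : roof P P -> B).

Definition torX (M : rmod B) : Prop :=
  exists2 Y : rmod A, torF Y & Dhom_mod cl (shift (stalk Y)) M.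
Definition torY (M : rmod B) : Prop :=
  exists2 X : rmod A, torT X & Dhom_mod cl (stalk X) M.

Definition canonical_sequence (L E N : rmod B)
    (u : 'Hom(L, E)) (v : 'Hom(E, N)) : Prop :=
  [/\ short_exact u v, torX L & torY N].
End TorsionPairs.

(* Main.v *)
Require Import Defs.
From HB Require Import structures.
From mathcomp Require Import all_boot all_order all_algebra all_field.
From mathcomp Require Import zify.
From Stdlib Require Import Classical ClassicalEpsilon.

(** Why the theorem holds.

    Let w : P_i -> nu P_i be the composite of the top map P_i -> S_i with the
    socle inclusion S_i -> nu P_i, and let Z be w seen as a complex in degrees
    -1 and 0.  The proof identifies E with Hom(P, Z) and reads off the two
    short exact sequences that pass through this module.

    A two-term complex of projectives is homotopically projective
    ([quasi_iso_section], [quasi_iso_cancel]).  Hence maps from P in the derived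
    category are homotopy classes of chain maps, and when the target also lives
    in degrees -1 and 0 such a class is a pair of module maps up to a single
    homotopy ([Dhom_mod_deg0], [Dhom_mod_deg1]).  After this reduction P is just
    an arrow P^-1 -> P^0 between projectives.

    The cohomology of Z is rad P_i in degree -1 and nu P_i / S_i in degree 0, so
    that Hom(P, Z) is an extension of Hom(P, nu P_i / S_i) by
    Hom(P, (rad P_i)[1]) ([cohomology_sequence]).  The ends lie in Y(P) and X(P)
    although nu P_i / S_i need not be in T(P) nor rad P_i in F(P): Hom(P, -)
    sees only the torsion part of a module and Hom(P, -[1]) only its
    torsion-free quotient ([torY_deg0], [torX_deg1]).

    On the other hand Z is an extension of P_i[1] by nu P_i, and
      0 -> Hom(P, nu P_i) -> Hom(P, Z) -> Hom(P, P_i[1]) -> 0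
    is exact: a map from P to P_i or P_i[1] that w does not annihilate is split,
    because P_i is local and w vanishes exactly on its radical, and it would put
    P_i or P_i[1] in add P ([connecting_sequence]).

    Every B-module map h from X to Hom(P, P_i[1]) that is not a split
    epimorphism lifts along this sequence ([lift_nonsplit]).  Indeed X is the
    cokernel of a map Hom(P, P^m) -> Hom(P, P^n), so h comes from a map to
    P_i[1] from the cone K of some P^m -> P^n.  Its composite with w ends in a
    shift of the injective module nu P_i, and is null-homotopic unless K -> P_i[1]
    splits, in which case h splits too; if it is null-homotopic, K -> P_i[1]
    lifts to Z.

    The sequence does not split ([connecting_not_split]).  This is where P has
    to generate, in the guise that every module in T(P) is a quotient of a sum
    of copies of H^0(P) ([tors_generated]); a retraction of
    Hom(P, nu P_i) -> Hom(P, Z) would then force w = 0.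

    The last two properties characterize the middle term of an almost split
    sequence starting at Hom(P, nu P_i) ([ass_unique]), whence E = Hom(P, Z). *)

Set Implicit Arguments.
Unset Strict Implicit.
Unset Printing Implicit Defensive.

Import GRing.Theory Num.Theory.
Local Open Scope ring_scope.

(** * Linear algebra and choice *)

Lemma choice_fun (T U : Type) (R : T -> U -> Prop) :
  (forall x, exists y, R x y) -> exists f : T -> U, forall x, R x (f x).
Proof.
move=> ex; exists (fun x => sval (constructive_indefinite_description _ (ex x))) => x.
exact: svalP.
Qed.

Lemma choice_fun2 (T : Type) (U : T -> Type) (R S : forall x, U x -> Prop) :
  (forall x, exists2 y, R x y & S x y) ->
  exists2 f : forall x, U x, forall x, R x (f x) & forall x, S x (f x).
Proof.
move=> ex; have ex' x : exists y, R x y /\ S x y by have [y] := ex x; exists y.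
pose f x := sval (constructive_indefinite_description _ (ex' x)).
have fP x : R x (f x) /\ S x (f x).
  exact: (svalP (constructive_indefinite_description _ (ex' x))).
by exists f => x; case: (fP x).
Qed.

Lemma pair_ext (S T : Type) (u v : S * T) : u.1 = v.1 -> u.2 = v.2 -> u = v.
Proof. by case: u v => [a b] [c d] /= -> ->. Qed.

Section LinearAlgebra.
Variable k : fieldType.
Implicit Types V W : vectType k.

(** Lets subspaces be given by arbitrary propositions: a subspace of maximal
    dimension among those inside S is all of S. *)
Lemma vspace_of_pred V (S : V -> Prop) :
  S 0 -> (forall c u v, S u -> S v -> S (c *: u + v)) ->
  exists U : {vspace V}, forall v, v \in U <-> S v.
Proof.
move=> S0 Slin.
suff grow n (U : {vspace V}) : (forall v, v \in U -> S v) ->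
    (\dim {:V} - \dim U < n)%N -> exists U' : {vspace V}, forall v, v \in U' <-> S v.
  apply: (grow _ 0%VS _ (ltnSn _)) => v.
  by rewrite memv0 => /eqP->.
elim: n U => // n IHn U US ltUn.
have [[v [Sv vU]]|full] := classic (exists v, S v /\ v \notin U); last first.
  exists U => v; split=> [/US //|Sv].
  by apply/negPn/negP => vU; apply: full; exists v.
apply: (IHn (U + <[v]>)%VS) => [x|].
  case/memv_addP=> u uU [y /vlineP[c ->] ->].
  by rewrite addrC; apply: Slin => //; apply: US.
have ltU : (\dim U < \dim (U + <[v]>))%N.
  rewrite ltn_neqAle dimvS ?addvSl // andbT.
  apply/negP=> /eqP eqd; move/negP: vU; apply.
  have /eqP -> : U == (U + <[v]>)%VS by rewrite eqEdim addvSl eqd leqnn.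
  by rewrite (subvP (addvSr U _)) ?memv_line.
rewrite ltnS in ltUn; apply: leq_trans ltUn; apply: ltn_sub2l => //.
by apply: (leq_trans ltU); rewrite dimvS ?subvf.
Qed.

Lemma lfun_of_linear V W (f : V -> W) :
  linear f -> exists F : 'Hom(V, W), forall v, F v = f v.
Proof.
move=> flin.
pose fl : {linear V -> W} := HB.pack f (GRing.isLinear.Build _ _ _ _ f flin).
by exists (linfun fl) => v; rewrite lfunE.
Qed.

(** The way most maps below are built: on representatives t in a parameter
    set T, the value q t being compatible with linear combinations and
    determined by the point p t.  The map is defined on the span of the p t and
    extended arbitrarily. *)
Lemma lfun_of_graph (T : Type) V W (p : T -> V) (q : T -> W) (t0 : T) :
  (forall c s t, exists u, p u = c *: p s + p t /\ q u = c *: q s + q t) ->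
  (forall s, p s = 0 -> q s = 0) ->
  exists F : 'Hom(V, W), forall t, F (p t) = q t.
Proof.
move=> lin func.
have [||G inG] := @vspace_of_pred (V * W)%type (fun x => exists t, x = (p t, q t)).
- have [u [pu qu]] := lin (-1) t0 t0; exists u.
  by rewrite pu qu !scaleN1r !addNr.
- move=> c _ _ [s ->] [t ->]; have [u [pu qu]] := lin c s t; exists u.
  by rewrite pu qu.
have [|F FE] := @lfun_of_linear (subvs_of G) V (fun g => (vsval g).1).
  by move=> c x y; rewrite !linearP.
have [|S SE] := @lfun_of_linear (subvs_of G) W (fun g => (vsval g).2).
  by move=> c x y; rewrite !linearP.
have F0 : lker F == 0%VS.
  rewrite -subv0; apply/subvP=> x; rewrite memv_ker memv0 FE => /eqP x0.
  have [t xt] : exists t, vsval x = (p t, q t) by apply/inG/subvsP.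
  apply/eqP/val_inj; rewrite /= xt; move: x0; rewrite xt /= => pt0.
  by rewrite pt0 (func _ pt0).
exists (S \o F^-1)%VF => t.
have tG : (p t, q t) \in G by apply/inG; exists t.
have -> : p t = F (vsproj G (p t, q t)) by rewrite FE vsprojK.
by rewrite comp_lfunE lker0_lfunK // SE vsprojK.
Qed.

Lemma quotient_lfun V (U : {vspace V}) :
  exists (Q : vectType k) (q : 'Hom(V, Q)), limg q = fullv /\ lker q = U.
Proof.
pose pr := daddv_pi (U^C)%VS U.
have dir : (U^C :&: U = 0)%VS by rewrite capvC capv_compl.
exists (subvs_of (U^C)%VS : vectType k).
have [|q qE] := @lfun_of_linear V (subvs_of (U^C)%VS) (fun v => vsproj (U^C)%VS (pr v)).
  by move=> c x y; rewrite !linearP.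
exists q; split.
  apply/vspaceP=> u; rewrite memvf; apply/memv_imgP; exists (vsval u); rewrite ?memvf //.
  by rewrite qE /pr daddv_pi_id ?subvsP // vsvalK.
have sum v : pr v + daddv_pi U (U^C)%VS v = v.
  by apply: daddv_pi_add => //; rewrite addvC addv_complf memvf.
have pr0 v : q v = 0 -> pr v = 0.
  by rewrite qE => v0; rewrite -[pr v](@vsprojK _ _ (U^C)%VS) ?v0 ?memv_pi.
apply/vspaceP=> v; rewrite memv_ker; apply/eqP/idP=> [/pr0 v0|vU].
  by rewrite -(sum v) v0 add0r memv_pi.
have := sum v; rewrite [daddv_pi U _ v]daddv_pi_id ?capv_compl //.
by rewrite -[in RHS](add0r v) qE => /addIr ->; rewrite linear0.
Qed.

End LinearAlgebra.

(** * Submodules, quotients, sums and powers of modules *)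

Section ModuleMaps.
Variables (k : fieldType) (A : falgType k).
Implicit Types L M N P X Y : rmod A.

Lemma rlinear_id M : rlinear (\1%VF : 'End(M)).
Proof. by move=> a v; rewrite !id_lfunE. Qed.
Lemma rlinear_comp L M N (g : 'Hom(M, N)) (f : 'Hom(L, M)) :
  rlinear g -> rlinear f -> rlinear (g \o f)%VF.
Proof. by move=> gl fl a v; rewrite !comp_lfunE fl gl. Qed.
Lemma rlinear0 M N : rlinear (0 : 'Hom(M, N)).
Proof. by move=> a v; rewrite !zero_lfunE linear0. Qed.
Lemma rlinearD M N (f g : 'Hom(M, N)) : rlinear f -> rlinear g -> rlinear (f + g).
Proof. by move=> fl gl a v; rewrite !add_lfunE fl gl linearD. Qed.
Lemma rlinearN M N (f : 'Hom(M, N)) : rlinear f -> rlinear (- f).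
Proof. by move=> fl a v; rewrite !opp_lfunE fl linearN. Qed.
Lemma rlinearB M N (f g : 'Hom(M, N)) : rlinear f -> rlinear g -> rlinear (f - g).
Proof. by move=> fl gl; apply: rlinearD => //; apply: rlinearN. Qed.
Lemma rlinearZ M N c (f : 'Hom(M, N)) : rlinear f -> rlinear (c *: f).
Proof. by move=> fl a v; rewrite !scale_lfunE fl linearZ. Qed.
Lemma rlinear_sum M N (I : Type) (r : seq I) (P : pred I) (f : I -> 'Hom(M, N)) :
  (forall i, P i -> rlinear (f i)) -> rlinear (\sum_(i <- r | P i) f i).
Proof.
by move=> fl; apply: big_ind => //; [apply: rlinear0|apply: rlinearD].
Qed.

Lemma submodule_lker M N (f : 'Hom(M, N)) : rlinear f -> submodule (lker f).
Proof.
by move=> fl a v; rewrite !memv_ker fl => /eqP ->; rewrite linear0.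
Qed.
Lemma submodule_limg M N (f : 'Hom(M, N)) : rlinear f -> submodule (limg f).
Proof.
by move=> fl a _ /memv_imgP[x _ ->]; rewrite -fl memv_img ?memvf.
Qed.

Lemma ract_lin_comb M : forall (c : k) (a b : A) (v : M),
  ract M (c *: a + b) v = c *: ract M a v + ract M b v.
Proof. by move=> c a b v; rewrite ract_linear add_lfunE scale_lfunE. Qed.

(** Submodules are predicates on subspaces; this turns one into a module in
    its own right. *)
Lemma submodule_rmod M (U : {vspace M}) : submodule U ->
  exists (S : rmod A) (i : 'Hom(S, M)), rmono i /\ limg i = U.
Proof.
move=> sU; pose i : 'Hom(subvs_of U, M) := linfun vsval.
have iE x : i x = vsval x by rewrite lfunE.
pose act a : 'End(subvs_of U) := (linfun (vsproj U) \o (ract M a \o i))%VF.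
have actE a x : vsval (act a x) = ract M a (vsval x).
  by rewrite !comp_lfunE lfunE /= iE vsprojK // sU // subvsP.
have act_lin c a b : act (c *: a + b) = c *: act a + act b.
  apply/lfunP=> x; apply/val_inj; rewrite /= actE add_lfunE scale_lfunE.
  by rewrite linearP /= !actE ract_lin_comb.
have act_1 : act 1 = \1%VF.
  by apply/lfunP=> x; apply/val_inj; rewrite /= actE ract1 !id_lfunE.
have act_M a b : act (a * b) = (act b \o act a)%VF.
  apply/lfunP=> x; apply/val_inj.
  by rewrite /= comp_lfunE !actE ractM comp_lfunE.
exists (RMod act_lin act_1 act_M), i; split; first split.
- by move=> a v; rewrite !iE actE.
- apply/eqP; rewrite -subv0; apply/subvP=> x.
  by rewrite memv_ker memv0 iE => /eqP x0; apply/eqP/val_inj.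
apply/vspaceP=> v; apply/memv_imgP/idP => [[x _ ->]|vU]; first by rewrite iE subvsP.
by exists (vsproj U v); rewrite ?memvf // iE vsprojK.
Qed.

Lemma quotient_rmod M (U : {vspace M}) : submodule U ->
  exists (Q : rmod A) (q : 'Hom(M, Q)), repi q /\ lker q = U.
Proof.
move=> sU; have [Q [q [qf qU]]] := quotient_lfun U.
have qK x : q (q^-1%VF x) = x by rewrite limg_lfunVK // qf memvf.
pose act a : 'End(Q) := (q \o (ract M a \o q^-1))%VF.
have actE a x : act a (q x) = q (ract M a x).
  rewrite !comp_lfunE; apply/eqP; rewrite -subr_eq0 -!linearB /=.
  by rewrite -memv_ker qU sU // -qU memv_ker linearB /= qK subrr.
have act_lin c a b : act (c *: a + b) = c *: act a + act b.
  apply/lfunP=> x; rewrite -(qK x) actE add_lfunE scale_lfunE !actE.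
  by rewrite ract_lin_comb linearP.
have act_1 : act 1 = \1%VF.
  by apply/lfunP=> x; rewrite -(qK x) actE ract1 !id_lfunE.
have act_M a b : act (a * b) = (act b \o act a)%VF.
  by apply/lfunP=> x; rewrite -(qK x) comp_lfunE !actE ractM comp_lfunE.
by exists (RMod act_lin act_1 act_M), q; split=> //; split=> // a v; rewrite actE.
Qed.

Lemma epiE M N (f : 'Hom(M, N)) : limg f = fullv <-> forall y, exists x, f x = y.
Proof.
split=> [ff y|ff].
  have : y \in limg f by rewrite ff memvf.
  by case/memv_imgP=> x _ ->; exists x.
apply/vspaceP=> y; rewrite memvf; apply/memv_imgP.
by have [x <-] := ff y; exists x; rewrite ?memvf.
Qed.

Lemma monoE M N (f : 'Hom(M, N)) : lker f = 0%VS <-> forall x, f x = 0 -> x = 0.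
Proof.
split=> [f0 x fx|f0].
  by apply/eqP; rewrite -memv0 -f0 memv_ker fx.
apply/eqP; rewrite -subv0; apply/subvP=> x.
by rewrite memv_ker memv0 => /eqP/f0 ->.
Qed.

Lemma lker_eq0 M N (f : 'Hom(M, N)) : lker f = 0%VS -> injective f.
Proof.
move=> /monoE f0 x y xy; apply/eqP; rewrite -subr_eq0; apply/eqP/f0.
by rewrite linearB /= xy subrr.
Qed.

Lemma mono_lift X M N (i : 'Hom(M, N)) (f : 'Hom(X, N)) :
  rmono i -> rlinear f -> (forall x, f x \in limg i) ->
  exists2 f' : 'Hom(X, M), rlinear f' & forall x, f x = i (f' x).
Proof.
move=> [il i0] fl fi; exists (i^-1 \o f)%VF => [a x|x]; last first.
  by rewrite comp_lfunE limg_lfunVK.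
have := i0; move/monoE => inj; rewrite !comp_lfunE.
apply/eqP; rewrite -subr_eq0; apply/eqP/inj.
by rewrite linearB /= il !limg_lfunVK // fl subrr.
Qed.

Lemma epi_desc X M N (q : 'Hom(M, N)) (f : 'Hom(M, X)) :
  repi q -> rlinear f -> (forall x, q x = 0 -> f x = 0) ->
  exists2 f' : 'Hom(N, X), rlinear f' & forall x, f x = f' (q x).
Proof.
move=> [ql qf] fl fq.
have qK x : q (q^-1%VF x) = x by rewrite limg_lfunVK // qf memvf.
have f'E x : f x = (f \o q^-1)%VF (q x).
  rewrite comp_lfunE; apply/eqP; rewrite -subr_eq0 -linearB /=.
  by rewrite fq // linearB /= qK subrr.
exists (f \o q^-1)%VF => // a x.
by rewrite -(qK x) -ql -!f'E fl.
Qed.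

(** Projectivity relative to a map g that need not be onto: only the values of
    f have to be in its image. *)
Lemma projective_lift X Y P (g : 'Hom(X, Y)) (f : 'Hom(P, Y)) :
  projective P -> rlinear g -> rlinear f -> (forall p, exists x, g x = f p) ->
  exists2 f' : 'Hom(P, X), rlinear f' & forall p, g (f' p) = f p.
Proof.
move=> proj gl fl fg.
have [S [i [im iS]]] := submodule_rmod (submodule_limg gl).
have [g' gl' gE] : exists2 g' : 'Hom(X, S), rlinear g' & forall x, g x = i (g' x).
  by apply: mono_lift => // x; rewrite iS memv_img ?memvf.
have [f' fl' fE] : exists2 f' : 'Hom(P, S), rlinear f' & forall x, f x = i (f' x).
  by apply: mono_lift => // p; rewrite iS; have [x <-] := fg p; rewrite memv_img ?memvf.
have inj x y : i x = i y -> x = y.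
  move/eqP; rewrite -subr_eq0 -linearB /= => /eqP; case: im => _ /monoE im /im /eqP.
  by rewrite subr_eq0 => /eqP.
have [||h hl fh] := proj _ _ g' f' => //.
  split=> //; apply/epiE => y; have : i y \in limg g by rewrite -iS memv_img ?memvf.
  by case/memv_imgP=> x _; rewrite gE => /inj ->; exists x.
by exists h => // p; rewrite gE fE fh comp_lfunE.
Qed.

Section Sums.
Variables M N : rmod A.

Definition rfst : 'Hom(rsum M N, M) := linfun (fst : M * N -> M).
Definition rsnd : 'Hom(rsum M N, N) := linfun (snd : M * N -> N).

Lemma rfstE (x : rsum M N) : rfst x = x.1. Proof. by rewrite lfunE. Qed.
Lemma rsndE (x : rsum M N) : rsnd x = x.2. Proof. by rewrite lfunE. Qed.
Lemma rlinear_fst : rlinear rfst.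
Proof. by move=> a x; rewrite !rfstE rsum_actE. Qed.
Lemma rlinear_snd : rlinear rsnd.
Proof. by move=> a x; rewrite !rsndE rsum_actE. Qed.

Lemma pairing X (f : 'Hom(X, M)) (g : 'Hom(X, N)) : rlinear f -> rlinear g ->
  exists2 h : 'Hom(X, rsum M N), rlinear h & forall x, h x = (f x, g x).
Proof.
move=> fl gl.
have [|h hE] := @lfun_of_linear k X (rsum M N) (fun x => (f x, g x)).
  by move=> c x y; rewrite !linearP.
by exists h => // a x; rewrite !hE fl gl rsum_actE.
Qed.

Lemma copairing X (f : 'Hom(M, X)) (g : 'Hom(N, X)) : rlinear f -> rlinear g ->
  exists2 h : 'Hom(rsum M N, X), rlinear h & forall x, h x = f x.1 + g x.2.
Proof.
move=> fl gl; exists ((f \o rfst) + (g \o rsnd))%VF => [|x].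
  by apply: rlinearD; apply: rlinear_comp => //; [apply: rlinear_fst|apply: rlinear_snd].
by rewrite add_lfunE !comp_lfunE rfstE rsndE.
Qed.

Lemma rinl_exists : exists2 i : 'Hom(M, rsum M N), rlinear i & forall x, i x = (x, 0).
Proof.
have [h hl hE] := pairing (@rlinear_id M) (@rlinear0 M N).
by exists h => // x; rewrite hE id_lfunE zero_lfunE.
Qed.
Lemma rinr_exists : exists2 i : 'Hom(N, rsum M N), rlinear i & forall x, i x = (0, x).
Proof.
have [h hl hE] := pairing (@rlinear0 N M) (@rlinear_id N).
by exists h => // x; rewrite hE id_lfunE zero_lfunE.
Qed.

Lemma projective_rsum : projective M -> projective N -> projective (rsum M N).
Proof.
move=> pM pN X Y g f ge fl.
have [i il iE] := rinl_exists; have [j jl jE] := rinr_exists.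
have [|f1 f1l E1] := pM X Y g (f \o i)%VF ge; first exact: rlinear_comp.
have [|f2 f2l E2] := pN X Y g (f \o j)%VF ge; first exact: rlinear_comp.
have [h hl hE] := copairing f1l f2l.
exists h => //; apply/lfunP=> -[x y]; rewrite comp_lfunE hE linearD /=.
move/lfunP: E1 => /(_ x); rewrite !comp_lfunE => <-.
move/lfunP: E2 => /(_ y); rewrite !comp_lfunE => <-.
by rewrite -linearD iE jE /=; congr (f (_, _)); rewrite ?addr0 ?add0r.
Qed.
End Sums.

Lemma riso_inverse M N (f : 'Hom(M, N)) : riso f ->
  exists2 g : 'Hom(N, M), riso g & (forall x, g (f x) = x) /\ (forall y, f (g y) = y).
Proof.
move=> [[fl f0] [_ ff]].
have gK x : f^-1%VF (f x) = x by rewrite lker0_lfunK // f0.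
have Kg y : f (f^-1%VF y) = y by rewrite limg_lfunVK // ff memvf.
have gl : rlinear (f^-1%VF) by move=> a v; rewrite -{1}(Kg v) -fl gK.
exists f^-1%VF => //; split; split=> //.
  by apply/monoE=> y y0; rewrite -(Kg y) y0 linear0.
by apply/epiE=> x; exists (f x).
Qed.

Section Power.
Variables (n : nat) (M : rmod A).

Fact rpow_fun_linear (a : A) :
  linear (fun v : {ffun 'I_n -> M} => [ffun j => ract M a (v j)]).
Proof. by move=> c u v; apply/ffunP=> j; rewrite !ffunE linearP. Qed.
Definition rpow_fun (a : A) (v : {ffun 'I_n -> M}) : {ffun 'I_n -> M} :=
  [ffun j => ract M a (v j)].
HB.instance Definition _ a :=
  GRing.isLinear.Build k {ffun 'I_n -> M} {ffun 'I_n -> M} _ (rpow_fun a)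
    (rpow_fun_linear a).
Definition rpow_act (a : A) : 'End({ffun 'I_n -> M}) := linfun (rpow_fun a).
Lemma rpow_actE a v j : rpow_act a v j = ract M a (v j).
Proof. by rewrite lfunE /= ffunE. Qed.
Fact rpow_linear (c : k) (a b : A) : rpow_act (c *: a + b) = c *: rpow_act a + rpow_act b.
Proof.
apply/lfunP=> v; apply/ffunP=> j.
by rewrite add_lfunE scale_lfunE !ffunE !rpow_actE ract_lin_comb.
Qed.
Fact rpow_1 : rpow_act 1 = \1%VF.
Proof. by apply/lfunP=> v; apply/ffunP=> j; rewrite rpow_actE ract1 !id_lfunE. Qed.
Fact rpow_M (a b : A) : rpow_act (a * b) = (rpow_act b \o rpow_act a)%VF.
Proof.
by apply/lfunP=> v; apply/ffunP=> j; rewrite comp_lfunE !rpow_actE ractM comp_lfunE.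
Qed.
Definition rpow : rmod A := RMod rpow_linear rpow_1 rpow_M.

Fact rproj_linear j : linear (fun v : {ffun 'I_n -> M} => v j).
Proof. by move=> c u v; rewrite !ffunE. Qed.
Fact rinj_linear j : linear (fun x : M => [ffun i => if i == j then x else 0] : {ffun 'I_n -> M}).
Proof.
by move=> c x y; apply/ffunP=> i; rewrite !ffunE; case: ifP => // _; rewrite scaler0 addr0.
Qed.
Definition rproj_fun j (v : {ffun 'I_n -> M}) : M := v j.
Definition rinj_fun j (x : M) : {ffun 'I_n -> M} := [ffun i => if i == j then x else 0].
HB.instance Definition _ j :=
  GRing.isLinear.Build k {ffun 'I_n -> M} M _ (rproj_fun j) (rproj_linear j).
HB.instance Definition _ j :=
  GRing.isLinear.Build k M {ffun 'I_n -> M} _ (rinj_fun j) (rinj_linear j).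
Definition rproj j : 'Hom(rpow, M) := linfun (rproj_fun j).
Definition rinj j : 'Hom(M, rpow) := linfun (rinj_fun j).

Lemma rprojE j (v : rpow) : rproj j v = (v : {ffun 'I_n -> M}) j.
Proof. by rewrite lfunE. Qed.
Lemma rinjE j x i : (rinj j x : {ffun 'I_n -> M}) i = if i == j then x else 0.
Proof. by rewrite lfunE /= ffunE. Qed.
Lemma rlinear_proj j : rlinear (rproj j).
Proof. by move=> a v; rewrite !rprojE rpow_actE. Qed.
Lemma rlinear_inj j : rlinear (rinj j).
Proof.
move=> a v; apply/ffunP=> i; rewrite rpow_actE !rinjE.
by case: ifP => // _; rewrite linear0.
Qed.
Lemma rproj_rinj i j x : rproj i (rinj j x) = if i == j then x else 0.
Proof. by rewrite rprojE rinjE. Qed.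
Lemma rpow_decomp (v : rpow) : v = \sum_j rinj j (rproj j v).
Proof.
apply/ffunP=> i; rewrite sum_ffunE (bigD1 i) //= rinjE eqxx rprojE big1 ?addr0 // => j ji.
by rewrite rinjE eq_sym (negPf ji).
Qed.

Lemma copair_pow X (f : 'I_n -> 'Hom(M, X)) : (forall j, rlinear (f j)) ->
  exists2 h : 'Hom(rpow, X), rlinear h &
    (forall v, h v = \sum_j f j (rproj j v)) /\ forall j x, h (rinj j x) = f j x.
Proof.
move=> fl; exists (\sum_j (f j \o rproj j))%VF.
  by apply: rlinear_sum => j _; apply: rlinear_comp => //; apply: rlinear_proj.
have hE v : (\sum_j (f j \o rproj j))%VF v = \sum_j f j (rproj j v).
  by rewrite sum_lfunE; apply: eq_bigr => j _; rewrite comp_lfunE.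
split=> // j x; rewrite hE (bigD1 j) //= rproj_rinj eqxx big1 ?addr0 // => i ij.
by rewrite rproj_rinj (negPf ij) linear0.
Qed.

Lemma pair_pow X (f : 'I_n -> 'Hom(X, M)) : (forall j, rlinear (f j)) ->
  exists2 h : 'Hom(X, rpow), rlinear h & forall j x, rproj j (h x) = f j x.
Proof.
move=> fl; exists (\sum_j (rinj j \o f j))%VF => [|j x].
  by apply: rlinear_sum => j _; apply: rlinear_comp => //; apply: rlinear_inj.
rewrite sum_lfunE linear_sum (bigD1 j) //= comp_lfunE rproj_rinj eqxx big1 ?addr0 // => i ij.
by rewrite comp_lfunE rproj_rinj eq_sym (negPf ij).
Qed.

Lemma projective_rpow : projective M -> projective rpow.
Proof.
move=> pM X Y g f ge fl.
have [h hl hE] : exists2 h : 'I_n -> 'Hom(M, X), forall j, rlinear (h j) &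
    forall j x, f (rinj j x) = g (h j x).
  suff /(_ _)/constructive_indefinite_description H : forall j, exists h : 'Hom(M, X),
      rlinear h /\ forall x, f (rinj j x) = g (h x).
    by exists (fun j => sval (H j)) => j; case: (svalP (H j)).
  move=> j; have [|h hl /lfunP hE] := pM X Y g (f \o rinj j)%VF ge.
    by apply: rlinear_comp => //; apply: rlinear_inj.
  by exists h; split=> // x; have := hE x; rewrite !comp_lfunE.
have [h' h'l [h'E _]] := copair_pow hl.
exists h' => //; apply/lfunP=> v; rewrite comp_lfunE h'E {1}[v]rpow_decomp !linear_sum.
by apply: eq_bigr => j _; rewrite /= hE.
Qed.

End Power.
End ModuleMaps.

(** * Projective modules, radicals and the Nakayama functor *)

Section Local.
Variables (k : fieldType) (A : falgType k).
Implicit Types L M N P X Y : rmod A.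

(** For j the inclusion of a submodule this is the usual notion; factoring an
    arbitrary j through its image gives this form, which saves the image. *)
Definition injective_rmod (I : rmod A) : Prop :=
  forall (X Y : rmod A) (j : 'Hom(X, Y)) (t : 'Hom(X, I)),
  rlinear j -> rlinear t -> (forall x, j x = 0 -> t x = 0) ->
  exists2 s : 'Hom(Y, I), rlinear s & forall x, s (j x) = t x.

Definition detects_split_epis P (I : rmod A) (w : 'Hom(P, I)) : Prop :=
  forall (X : rmod A) (f : 'Hom(X, P)) x, rlinear f -> w (f x) <> 0 ->
  exists2 s : 'Hom(P, X), rlinear s & forall v, f (s v) = v.

Lemma bounded_max (f : nat -> nat) b :
  (forall n, (f n <= b)%N) -> exists n, forall m, (f m <= f n)%N.
Proof.
move=> fb; suff H c n : (b - f n < c)%N -> exists n, forall m, (f m <= f n)%N.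
  exact: (H _ 0%N (ltnSn _)).
elim: c n => // c IHc n; have [[m lt_nm]|no] := classic (exists m, (f n < f m)%N).
  move=> ltc; apply: (IHc m); rewrite ltnS in ltc; apply: leq_trans ltc.
  by apply: ltn_sub2l => //; apply: leq_trans (fb m).
by move=> _; exists n => m; rewrite leqNgt; apply/negP=> ?; apply: no; exists m.
Qed.

(** Fitting's lemma.  For n with the kernel of e^n as large as possible, M is the
    direct sum of the kernel and the image of e^n, so one of the two is zero.
    In the first case e is injective, in the second it is nilpotent and then
    1 - e is injective. *)
Lemma fitting M (e : 'End(M)) : indecomposable M -> rlinear e ->
  (forall y, exists x, e x = y) \/ (forall y, exists x, x - e x = y).
Proof.
move=> [_ indec] el.
pose pw n : 'End(M) := iter n (fun h => e \o h)%VF \1%VF.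
have pwE n x : pw n x = iter n e x.
  by elim: n => [|n IHn] /=; rewrite ?id_lfunE // comp_lfunE IHn.
have pwl n : rlinear (pw n).
  by elim: n => [|n IHn]; [apply: rlinear_id|apply: rlinear_comp].
have [n nmax] := @bounded_max (fun n => \dim (lker (pw n))) (\dim {:M})
  (fun n => dimvS (subvf _)).
have ker2 x : pw n (pw n x) = 0 -> pw n x = 0.
  have sub : (lker (pw n) <= lker (pw (n + n)%N))%VS.
    apply/subvP=> z; rewrite !memv_ker !pwE iterD => /eqP ->.
    by rewrite -pwE linear0.
  have /eqP eqk : lker (pw n) == lker (pw (n + n)%N) by rewrite eqEdim sub nmax.
  move=> x0; apply/eqP; rewrite -memv_ker eqk memv_ker pwE iterD -!pwE.
  exact/eqP.
have inj_surj (h : 'End(M)) : (forall x, h x = 0 -> x = 0) -> forall y, exists x, h x = y.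
  move=> /monoE h0; apply/epiE; apply/eqP; rewrite eqEdim subvf /=.
  by rewrite -{1}(limg_ker_dim h fullv) h0 capv0 dimv0.
have [K [i [im iK]]] := submodule_rmod (submodule_lker (pwl n)).
have [I [j [jm jI]]] := submodule_rmod (submodule_limg (pwl n)).
have [h hl hE] := copairing im.1 jm.1.
have iK0 x : pw n (i x) = 0.
  by apply/eqP; rewrite -memv_ker -iK memv_img ?memvf.
have jIx x : exists y, j x = pw n y.
  have : j x \in limg (pw n) by rewrite -jI memv_img ?memvf.
  by case/memv_imgP=> y _ ->; exists y.
have hm : rmono h.
  split=> //; apply/monoE=> -[x y]; rewrite hE /= => xy0.
  have [z jz] := jIx y.
  have z0 : pw n (pw n z) = 0.
    by rewrite -jz -[pw n (j y)]add0r -(iK0 x) -linearD xy0 linear0.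
  have y0 : y = 0 by move/monoE: jm.2; apply; rewrite jz ker2.
  have x0 : x = 0.
    by move/monoE: im.2; apply; move: xy0; rewrite y0 linear0 addr0.
  by rewrite x0 y0.
have he : repi h.
  split=> //; apply/eqP; rewrite eqEdim subvf /=.
  have := limg_ker_dim (pw n) fullv; rewrite capfv -iK -jI => <-.
  have := limg_ker_dim h fullv; rewrite hm.2 capv0 dimv0 add0n => ->.
  have dK := limg_ker_dim i fullv; have dI := limg_ker_dim j fullv.
  move: dK dI; rewrite im.2 jm.2 !capv0 !dimv0 !add0n => -> ->.
  by rewrite !dimvf.
have [h' h'iso [h'h hh']] := riso_inverse (conj hm he).
have [K0|I0] := indec _ _ h' h'iso.
- left; apply: inj_surj => x ex; have : x \in lker (pw n.+1).
    by rewrite memv_ker pwE iterSr ex -pwE linear0.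
  have sub : (lker (pw n) <= lker (pw n.+1))%VS.
    by apply/subvP=> z; rewrite !memv_ker !pwE iterS => /eqP ->; rewrite linear0.
  have /eqP <- : lker (pw n) == lker (pw n.+1) by rewrite eqEdim sub nmax.
  by rewrite -iK => /memv_imgP[z _ ->]; rewrite (K0 z) linear0.
- right => y; have [|x] := inj_surj (\1 - e)%VF _ y; last first.
    by rewrite add_lfunE opp_lfunE id_lfunE => <-; exists x.
  move=> x; rewrite add_lfunE opp_lfunE id_lfunE => /eqP; rewrite subr_eq0 => /eqP xe.
  have -> : x = pw n x.
    by rewrite pwE; elim: n {nmax ker2 iK jI iK0 jIx} => //= n <-.
  have : pw n x \in limg j by rewrite jI memv_img ?memvf.
  by case/memv_imgP=> z _ ->; rewrite (I0 z) linear0.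
Qed.

(** An indecomposable projective is local.  If f(x) avoids some maximal
    submodule V, then V + im f = P and projectivity splits V (+) X -> P, so that
    the identity is a sum of an endomorphism with image in V and one that factors
    through f.  By Fitting's lemma one of them is onto, and it is not the first. *)
Lemma indec_projective_local P (U : {vspace P}) X (f : 'Hom(X, P)) x :
  projective P -> indecomposable P -> is_radical U ->
  rlinear f -> f x \notin U ->
  exists2 s : 'Hom(P, X), rlinear s & forall p, f (s p) = p.
Proof.
move=> proj indec radU fl fxU.
have [V [Vmax fxV]] : exists V, maximal_submodule V /\ f x \notin V.
  apply: NNPP => no; move/negP: fxU; apply; apply/radU => V Vmax.
  by apply/negPn/negP=> fxV; apply: no; exists V.
have [sV Vfull maxV] := Vmax.
have sW : submodule (V + limg f)%VS.
  move=> a _ /memv_addP[v vV [y yf ->]]; rewrite linearD memv_add ?sV //.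
  exact: submodule_limg.
have Wfull : (V + limg f)%VS = fullv.
  case: (maxV _ sW (addvSl _ _)) => // eqV; move/negP: fxV; case.
  by rewrite -eqV (subvP (addvSr _ _)) ?memv_img ?memvf.
have [S [i [im iV]]] := submodule_rmod sV.
have [h hl hE] := copairing im.1 fl.
have [|s sl sE] := projective_lift (f := \1%VF) proj hl (@rlinear_id _ _ P).
  move=> p; rewrite id_lfunE; have : p \in (V + limg f)%VS by rewrite Wfull memvf.
  rewrite -iV => /memv_addP[_ /memv_imgP[v _ ->] [_ /memv_imgP[y _ ->] ->]].
  by exists (v, y); rewrite hE.
have sum p : i (s p).1 + f (s p).2 = p by rewrite -hE sE id_lfunE.
pose s2 : 'Hom(P, X) := (rsnd _ _ \o s)%VF.
have s2E p : s2 p = (s p).2 by rewrite comp_lfunE rsndE.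
have s2l : rlinear s2 by apply: rlinear_comp => //; apply: rlinear_snd.
have [onto|onto] := @fitting P (f \o s2)%VF indec (rlinear_comp fl s2l).
  have [||s' s'l s'E] := @projective_lift _ _ X P P f \1%VF proj fl => //.
  - exact: rlinear_id.
  - by move=> p; have [y <-] := onto p; exists (s2 y); rewrite id_lfunE comp_lfunE.
  by exists s' => // p; rewrite s'E id_lfunE.
case: Vfull; apply/vspaceP=> p; rewrite memvf -iV.
have [y <-] := onto p; rewrite comp_lfunE s2E -{1}(sum y) addrK.
by rewrite memv_img ?memvf.
Qed.

Lemma dual_basis P : projective P ->
  exists n (e : 'I_n -> P) (f : 'I_n -> 'Hom(P, regular A)),
    (forall l, rlinear (f l)) /\
    forall p, p = \sum_l ract P (f l p : A) (e l).
Proof.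
move=> proj; pose n : nat := \dim {:P}; pose e (l : 'I_n) := (vbasis {:P})`_l.
have gen l : exists2 g : 'Hom(regular A, P), rlinear g & forall a : A, g a = ract P a (e l).
  have [|g gE] := @lfun_of_linear k (regular A) P (fun a : A => ract P a (e l)).
    by move=> c a b; rewrite ract_lin_comb.
  by exists g => // a x; rewrite !gE lfunE /= ractM comp_lfunE.
have [g gl gE] := choice_fun2 gen.
have [G Gl [GE Ginj]] := copair_pow gl.
have [|h hl hE] := projective_lift (f := \1%VF) proj Gl (@rlinear_id _ _ P).
  move=> p; rewrite id_lfunE; rewrite (coord_vbasis (memvf p)).
  exists (\sum_l rinj (regular A) l ((coord (vbasis {:P}) l p)%:A : A)).
  rewrite linear_sum; apply: eq_bigr => l _ /=.
  rewrite Ginj gE -[_%:A]addr0 ract_lin_comb ract1 id_lfunE.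
  suff -> : ract P 0 = 0 by rewrite zero_lfunE addr0.
  by have := ract_linear P (-1) 0 0; rewrite scaler0 addr0 scaleN1r addNr.
exists n, e, (fun l => rproj _ l \o h)%VF; split=> [l|p].
  by apply: rlinear_comp => //; apply: rlinear_proj.
rewrite -{1}[p](id_lfunE p) -(hE p) GE; apply: eq_bigr => l _.
by rewrite gE comp_lfunE.
Qed.

(** The dual basis generates Hom_A(P, A) as a left module. *)
Lemma hom_dual_gen P n (e : 'I_n -> P) (f : 'I_n -> 'Hom(P, regular A)) :
  (forall l, rlinear (f l)) ->
  (forall p, p = \sum_l ract P (f l p : A) (e l)) ->
  forall h : hom_dual P,
    h = \sum_l hom_dual_fun (vsval h (e l)) (vsproj (homA P (regular A)) (f l)).
Proof.
move=> fl fe h; apply/val_inj; rewrite /= linear_sum /=.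
apply/lfunP=> p; rewrite sum_lfunE {1}[p]fe linear_sum.
have hl : rlinear (vsval h) by apply/homAP/subvsP.
apply: eq_bigr => l _ /=; rewrite hl hom_dual_funE vsprojK; last exact/homAP.
by rewrite comp_lfunE !lfunE.
Qed.

(** A module map s : Y -> nu P is determined by the functionals
    y |-> s(y)(f_l) on the dual basis, and these can be prescribed at will since
    P is projective.  So extending t along j amounts to extending functionals. *)
Lemma nu_injective P : projective P -> injective_rmod (nu P).
Proof.
move=> /dual_basis[n [e [f [fl fe]]]] X Y j t jl tl jt.
pose F l : hom_dual P := vsproj (homA P (regular A)) (f l).
have ex l : exists lam : 'Hom(Y, k^o), forall x, lam (j x) = (t x : 'Hom(hom_dual P, k^o)) (F l).
  apply: (@lfun_of_graph k X Y k^o j (fun x => (t x : 'Hom(hom_dual P, k^o)) (F l)) 0).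
    by move=> c x y; exists (c *: x + y); split; rewrite /= linearP // add_lfunE scale_lfunE.
  by move=> x /jt ->; rewrite zero_lfunE.
have [lam lamE] := choice_fun ex.
have sy y : exists s : 'Hom(hom_dual P, k^o),
    forall h : hom_dual P, s h = \sum_l lam l (ract Y (vsval h (e l)) y).
  apply: (@lfun_of_linear k (hom_dual P) k^o) => c g h.
  rewrite scaler_sumr -big_split; apply: eq_bigr => l _ /=.
  by rewrite add_lfunE scale_lfunE ract_lin_comb linearP.
have [s0 s0E] := choice_fun sy.
have [|s sE] := @lfun_of_linear k Y (nu P) s0.
  move=> c y z; apply/lfunP=> h; rewrite add_lfunE scale_lfunE !s0E.
  rewrite scaler_sumr -big_split; apply: eq_bigr => l _ /=.
  by rewrite !linearP.
exists s => [a y|x]; apply/lfunP=> h; rewrite !sE.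
  rewrite nu_actE !s0E; apply: eq_bigr => l _.
  by rewrite hom_dual_funE !comp_lfunE !lfunE /= ractM comp_lfunE.
rewrite s0E {2}(hom_dual_gen fl fe h) linear_sum; apply: eq_bigr => l _.
by rewrite -jl lamE tl nu_actE.
Qed.
Lemma projective_regular : projective (regular A).
Proof.
move=> X Y g f [gl gf] fl.
have [x xE] : exists x, g x = f (1 : A) by move: (f 1); apply/epiE.
have [|h hE] := @lfun_of_linear k (regular A) X (fun a : A => ract X a x).
  by move=> c a b; rewrite ract_lin_comb.
exists h => [a v|]; first by rewrite !hE lfunE /= ractM comp_lfunE.
apply/lfunP=> a; rewrite comp_lfunE hE gl xE -fl.
by rewrite lfunE /= mul1r.
Qed.

(** A proper submodule of largest dimension is maximal. *)
Lemma maximal_exists M (U : {vspace M}) : submodule U -> U <> fullv ->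
  exists V : {vspace M}, maximal_submodule V.
Proof.
suff H c (W : {vspace M}) : (\dim {:M} - \dim W < c)%N -> submodule W -> W <> fullv ->
    exists V : {vspace M}, maximal_submodule V by move=> sU nU; apply: (H _ U (ltnSn _)).
elim: c W => // c IHc W ltc sW nW.
have [maxW|] := classic (maximal_submodule W); first by exists W.
move=> nmax; have [V [sV WV nWV nV]] : exists V, [/\ submodule V, (W <= V)%VS, V <> W & V <> fullv].
  apply: NNPP => no; apply: nmax; split=> // V sV WV.
  by apply: NNPP => /not_or_and[n1 n2]; apply: no; exists V.
apply: (IHc V) => //.
have ltWV : (\dim W < \dim V)%N.
  rewrite ltn_neqAle dimvS // andbT; apply/eqP=> eqd; apply: nWV.
  by apply/eqP; rewrite eq_sym eqEdim WV eqd leqnn.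
have := dimvS (subvf V); lia.
Qed.

Lemma radical_proper M (U : {vspace M}) : ~ is_zero M -> is_radical U ->
  exists v, v \notin U.
Proof.
move=> nM radU; apply: NNPP => no.
have [||V Vmax] := @maximal_exists M 0%VS.
- by move=> a v; rewrite memv0 => /eqP ->; rewrite linear0 mem0v.
- move=> f0; apply: nM => v; apply/eqP; rewrite -memv0 f0; exact: memvf.
have [_ Vf _] := Vmax; apply: Vf; apply/vspaceP=> v; rewrite memvf.
have /radU : v \in U by apply/negPn/negP=> vU; apply: no; exists v.
exact.
Qed.

(** If a(v) is nonzero on h in Hom_A(P, A), then x |-> v.h(x) is such a map:
    otherwise a(v) would vanish on the left ideal of Hom_A(P, A) generated by the
    values of h, which contains h by the dual basis. *)
Lemma nu_cogenerated (P M : rmod A) (a : 'Hom(M, nu P)) v :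
  projective P -> rlinear a -> a v <> 0 ->
  exists2 f : 'Hom(P, M), rlinear f & exists x, a (f x) <> 0.
Proof.
move=> pP al av; pose phi : 'Hom(hom_dual P, k^o) := a v.
have [h phih] : exists h, phi h <> 0.
  apply: NNPP => no; apply: av; apply/lfunP=> h; rewrite zero_lfunE.
  by apply: NNPP => ph; apply: no; exists h.
have hl : rlinear (vsval h) by apply/homAP/subvsP.
have [|f fE] := @lfun_of_linear k P M (fun x => ract M (vsval h x : A) v).
  by move=> c x y; rewrite linearP ract_lin_comb.
exists f => [b x|]; first by rewrite !fE hl lfunE /= ractM comp_lfunE.
apply: NNPP => no; apply: phih.
have [n [e [g [gl ge]]]] := dual_basis pP.
rewrite (hom_dual_gen gl ge h) linear_sum big1 // => l _ /=.
have : a (f (e l)) = 0 by apply: NNPP => ne; apply: no; exists (e l).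
rewrite fE al => /lfunP/(_ (vsproj (homA P (regular A)) (g l))).
by rewrite [LHS]nu_actE zero_lfunE.
Qed.
End Local.

(** * Arrows of modules and homotopy classes of their maps *)

(** An arrow stands for a complex concentrated in degrees -1 and 0. *)
Record arrow (k : fieldType) (A : falgType k) := Arrow {
  asrc : rmod A;
  atgt : rmod A;
  amap : 'Hom(asrc, atgt);
  amap_rlinear : rlinear amap }.

(** The components, in degrees -1 and 0, of a map of graded modules.  Pairs
    that commute with the differentials are singled out by [chain]; keeping all
    pairs makes this a vector space on the nose. *)
Notation hpair x y := ('Hom(asrc x, asrc y) * 'Hom(atgt x, atgt y))%type.

Section Arrows.
Variables (k : fieldType) (A : falgType k).
Implicit Types x y z : arrow A.

Definition chain x y (a : hpair x y) : Prop :=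
  [/\ rlinear a.1, rlinear a.2 & forall v, amap y (a.1 v) = a.2 (amap x v)].

(** Null-homotopic: between complexes in degrees -1 and 0 a homotopy has a
    single component. *)
Definition null x y (a : hpair x y) : Prop :=
  exists2 h : 'Hom(atgt x, asrc y), rlinear h &
    (forall v, a.1 v = h (amap x v)) /\ (forall v, a.2 v = amap y (h v)).

Definition hcomp x y z (a : hpair y z) (b : hpair x y) : hpair x z :=
  ((a.1 \o b.1)%VF, (a.2 \o b.2)%VF).

Lemma chain_comp x y z (a : hpair y z) (b : hpair x y) :
  chain a -> chain b -> chain (hcomp a b).
Proof.
move=> [a1 a0 ac] [b1 b0 bc]; split=> [||v]; try exact: rlinear_comp.
by rewrite !comp_lfunE ac bc.
Qed.
Lemma chain0 x y : chain (0 : hpair x y).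
Proof.
by split=> [||v]; try exact: rlinear0; rewrite !zero_lfunE linear0.
Qed.
Lemma chain_lin x y c (a b : hpair x y) : chain a -> chain b -> chain (c *: a + b).
Proof.
move=> [a1 a0 ac] [b1 b0 bc]; split=> [||v].
- by apply: rlinearD => //; apply: rlinearZ.
- by apply: rlinearD => //; apply: rlinearZ.
by rewrite /= !(add_lfunE, scale_lfunE) linearP /= ac bc.
Qed.
Lemma chainB x y (a b : hpair x y) : chain a -> chain b -> chain (a - b).
Proof. by move=> ac bc; rewrite addrC -scaleN1r; apply: chain_lin. Qed.
Lemma chain_sum x y n (a : 'I_n -> hpair x y) :
  (forall j, chain (a j)) -> chain (\sum_j a j).
Proof.
move=> ac; apply: (big_ind (@chain x y)) => // [|u v cu cv]; first exact: chain0.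
by rewrite -[u]scale1r; apply: chain_lin.
Qed.

Lemma null0 x y : null (0 : hpair x y).
Proof.
by exists 0; [apply: rlinear0|split=> v; rewrite !zero_lfunE ?linear0].
Qed.
Lemma null_lin x y c (a b : hpair x y) : null a -> null b -> null (c *: a + b).
Proof.
move=> [g gl [g1 g0]] [h hl [h1 h0]]; exists (c *: g + h).
  by apply: rlinearD => //; apply: rlinearZ.
split=> v; rewrite /= !(add_lfunE, scale_lfunE) ?g1 ?h1 ?g0 ?h0 //.
by rewrite linearP.
Qed.
Lemma null_compr x y z (a : hpair y z) (b : hpair x y) :
  chain b -> null a -> null (hcomp a b).
Proof.
move=> [b1 b0 bc] [h hl [h1 h0]]; exists (h \o b.2)%VF; first exact: rlinear_comp.
by split=> v; rewrite /= !comp_lfunE ?h1 ?h0 ?bc.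
Qed.
Lemma null_compl x y z (a : hpair y z) (b : hpair x y) :
  chain a -> null b -> null (hcomp a b).
Proof.
move=> [a1 a0 ac] [h hl [h1 h0]]; exists (a.1 \o h)%VF; first exact: rlinear_comp.
by split=> v; rewrite /= !comp_lfunE ?h1 ?h0 ?ac.
Qed.

Lemma hcompDl x y z c (a a' : hpair y z) (b : hpair x y) :
  hcomp (c *: a + a') b = c *: hcomp a b + hcomp a' b.
Proof. by congr (_, _); rewrite /= comp_lfunDl comp_lfunZl. Qed.
Lemma hcompDr x y z c (a : hpair y z) (b b' : hpair x y) :
  hcomp a (c *: b + b') = c *: hcomp a b + hcomp a b'.
Proof. by congr (_, _); rewrite /= comp_lfunDr comp_lfunZr. Qed.
Lemma hcompA x y z t (a : hpair z t) (b : hpair y z) (c : hpair x y) :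
  hcomp a (hcomp b c) = hcomp (hcomp a b) c.
Proof. by congr (_, _); rewrite /= comp_lfunA. Qed.
Lemma hcompBr x y z (a : hpair y z) (b b' : hpair x y) :
  hcomp a (b - b') = hcomp a b - hcomp a b'.
Proof. by rewrite addrC -scaleN1r hcompDr scaleN1r addrC. Qed.
Lemma hcomp0r x y z (a : hpair y z) : hcomp a (0 : hpair x y) = 0.
Proof. by congr (_, _); rewrite /= comp_lfun0r. Qed.
Lemma hcomp_suml x y z n (a : 'I_n -> hpair y z) (b : hpair x y) :
  hcomp (\sum_j a j) b = \sum_j hcomp (a j) b.
Proof.
have [|F FE] := @lfun_of_linear k (hpair y z) (hpair x z) (fun a => hcomp a b).
  by move=> c u v; rewrite hcompDl.
by rewrite -FE linear_sum; apply: eq_bigr => j _; rewrite /= FE.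
Qed.
Lemma hcomp_sumr x y z n (a : hpair y z) (b : 'I_n -> hpair x y) :
  hcomp a (\sum_j b j) = \sum_j hcomp a (b j).
Proof.
have [|F FE] := @lfun_of_linear k (hpair x y) (hpair x z) (fun b => hcomp a b).
  by move=> c u v; rewrite hcompDr.
by rewrite -FE linear_sum; apply: eq_bigr => j _; rewrite /= FE.
Qed.

Lemma hpairP x y (a b : hpair x y) :
  (forall v, a.1 v = b.1 v) -> (forall v, a.2 v = b.2 v) -> a = b.
Proof.
by case: a b => [a1 a2] [b1 b2] /= /lfunP -> /lfunP ->.
Qed.

Lemma finite_family (V : vectType k) (S : V -> Prop) :
  S 0 -> (forall c u v, S u -> S v -> S (c *: u + v)) ->
  exists n (b : 'I_n -> V), (forall j, S (b j)) /\
    forall v, S v -> exists c : 'I_n -> k, v = \sum_j c j *: b j.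
Proof.
move=> S0 Sl; have [U US] := vspace_of_pred S0 Sl.
exists (\dim U), (fun j => (vbasis U)`_j); split=> [j|v /US vU].
  by apply/US/vbasis_mem/mem_nth; rewrite size_tuple.
by exists (fun j => coord (vbasis U) j v); apply: coord_vbasis.
Qed.

Section PowerArrow.
Variable p : arrow A.

Definition parr_map n : 'Hom(rpow n (asrc p), rpow n (atgt p)) :=
  (\sum_j (rinj (atgt p) j \o (amap p \o rproj (asrc p) j)))%VF.
Fact parr_rlinear n : rlinear (parr_map n).
Proof.
apply: rlinear_sum => j _; apply: rlinear_comp; first exact: rlinear_inj.
by apply: rlinear_comp; [apply: amap_rlinear|apply: rlinear_proj].
Qed.
(** The direct sum of n copies of p. *)
Definition parr n : arrow A := Arrow (@parr_rlinear n).

Lemma parr_proj n j v : rproj (atgt p) j (amap (parr n) v) = amap p (rproj (asrc p) j v).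
Proof.
rewrite sum_lfunE linear_sum (bigD1 j) //= !comp_lfunE rproj_rinj eqxx big1 ?addr0 // => i ij.
by rewrite !comp_lfunE rproj_rinj eq_sym (negPf ij).
Qed.
Lemma parr_inj n j v : amap (parr n) (rinj (asrc p) j v) = rinj (atgt p) j (amap p v).
Proof.
rewrite sum_lfunE (bigD1 j) //= !comp_lfunE rproj_rinj eqxx big1 ?addr0 // => i ij.
by rewrite !comp_lfunE rproj_rinj (negPf ij) !linear0.
Qed.

Definition pproj n j : hpair (parr n) p := (rproj (asrc p) j, rproj (atgt p) j).
Definition pinj n j : hpair p (parr n) := (rinj (asrc p) j, rinj (atgt p) j).

Lemma chain_pproj n (j : 'I_n) : chain (pproj j).
Proof.
by split=> [||v]; [exact: rlinear_proj|exact: rlinear_proj|rewrite /= parr_proj].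
Qed.
Lemma chain_pinj n (j : 'I_n) : chain (pinj j).
Proof.
by split=> [||v]; [exact: rlinear_inj|exact: rlinear_inj|rewrite /= parr_inj].
Qed.

Lemma copair_parr n y (b : 'I_n -> hpair p y) : (forall j, chain (b j)) ->
  exists2 f : hpair (parr n) y, chain f &
    (forall x (c : hpair x (parr n)), hcomp f c = \sum_j hcomp (b j) (hcomp (pproj j) c)) /\
    forall j, hcomp f (pinj j) = b j.
Proof.
move=> bc; pose f := \sum_j hcomp (b j) (pproj j).
have fE x (c : hpair x (parr n)) : hcomp f c = \sum_j hcomp (b j) (hcomp (pproj j) c).
  by rewrite hcomp_suml; apply: eq_bigr => j _; rewrite hcompA.
exists f; first by apply: chain_sum => j; apply: chain_comp => //; apply: chain_pproj.
split=> // j; rewrite fE (bigD1 j) //= big1 ?addr0 => [|i ij].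
  by apply: hpairP => v; rewrite /= !comp_lfunE rproj_rinj eqxx.
by apply: hpairP => v; rewrite /= !comp_lfunE rproj_rinj (negPf ij) linear0 zero_lfunE.
Qed.

(** Choosing a basis b_1, ..., b_m of the family S, the map f has components
    b_1, ..., b_m. *)
Lemma approximation y (S : hpair p y -> Prop) :
  S 0 -> (forall c u v, S u -> S v -> S (c *: u + v)) ->
  (forall u, S u -> chain u) ->
  (forall u (e : hpair p p), S u -> chain e -> S (hcomp u e)) ->
  exists m, exists2 f : hpair (parr m) y, chain f &
    (forall u, S u -> exists2 c : hpair p (parr m), chain c & u = hcomp f c) /\
    (forall c : hpair p (parr m), chain c -> S (hcomp f c)).
Proof.
move=> S0 Sl Sc Se; have [m [b [bS bgen]]] := finite_family S0 Sl.
have [f fc [fE finj]] := copair_parr (fun j => Sc _ (bS j)).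
exists m, f => //; split=> [u uS|c cc].
  have [d ->] := bgen _ uS; exists (\sum_j d j *: pinj j).
    apply: chain_sum => j; rewrite -[_ *: _]addr0.
    by apply: chain_lin; [apply: chain_pinj|apply: chain0].
  rewrite hcomp_sumr; apply: eq_bigr => j _.
  by rewrite -[_ *: pinj j]addr0 hcompDr hcomp0r addr0 finj.
rewrite fE; apply: (big_ind S) => // [u v uS vS|j _].
  by rewrite -[u]scale1r; apply: Sl.
by apply: Se => //; apply: chain_comp => //; apply: chain_pproj.
Qed.

(** The absence of maps p -> p[1] up to homotopy. *)
Definition rigid : Prop := forall e : 'Hom(asrc p, atgt p), rlinear e ->
  exists2 u : 'Hom(asrc p, asrc p), rlinear u &
  exists2 v : 'Hom(atgt p, atgt p), rlinear v &
    forall t, e t = amap p (u t) + v (amap p t).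

Lemma rigid_parr n (e : 'Hom(asrc p, rpow n (atgt p))) : rigid -> rlinear e ->
  exists2 u : 'Hom(asrc p, rpow n (asrc p)), rlinear u &
  exists2 v : 'Hom(atgt p, rpow n (atgt p)), rlinear v &
    forall t, e t = amap (parr n) (u t) + v (amap p t).
Proof.
move=> rig el.
have ex j : exists uv : 'Hom(asrc p, asrc p) * 'Hom(atgt p, atgt p),
    [/\ rlinear uv.1, rlinear uv.2 &
        forall t, rproj _ j (e t) = amap p (uv.1 t) + uv.2 (amap p t)].
  have [|u ul [v vl uvE]] := rig (rproj _ j \o e)%VF.
    by apply: rlinear_comp => //; apply: rlinear_proj.
  by exists (u, v); split=> // t; rewrite -uvE comp_lfunE.
have [uv uvP] := choice_fun ex.
have [u ul uE] := @pair_pow k A n (asrc p) (asrc p) (fun j => (uv j).1)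
  (fun j => let: And3 h _ _ := uvP j in h).
have [v vl vE] := @pair_pow k A n (atgt p) (atgt p) (fun j => (uv j).2)
  (fun j => let: And3 _ h _ := uvP j in h).
exists u => //; exists v => // t; rewrite [LHS]rpow_decomp [RHS]rpow_decomp.
apply: eq_bigr => j _; congr (rinj _ _ _).
by rewrite linearD /= parr_proj uE vE; case: (uvP j).
Qed.

End PowerArrow.
End Arrows.

Section Degrees.
Variables (k : fieldType) (A : falgType k) (M : rmod A).

Lemma to_rzero (V : vectType k) (f : 'Hom(V, rzero A)) : f = 0.
Proof. by apply/lfunP=> v; rewrite [LHS]thinmx0 [RHS]thinmx0. Qed.
Lemma from_rzero (V : vectType k) (f : 'Hom(rzero A, V)) : f = 0.
Proof.
by apply/lfunP=> v; rewrite (_ : v = 0) ?linear0 //; apply: thinmx0.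
Qed.

(** M as a complex in degree 0. *)
Definition deg0 : arrow A := Arrow (@rlinear0 _ _ (rzero A) M).
(** M as a complex in degree -1, that is, M[1]. *)
Definition deg1 : arrow A := Arrow (@rlinear0 _ _ M (rzero A)).

Variable x : arrow A.

Lemma chain_deg0 (a : hpair x deg0) :
  rlinear a.2 -> (forall v, a.2 (amap x v) = 0) -> chain a.
Proof.
move=> al ad; split=> // [|v]; first by rewrite [a.1]to_rzero; apply: rlinear0.
by rewrite /= zero_lfunE ad.
Qed.
Lemma chain_deg0_eq0 (a : hpair x deg0) v : chain a -> a.2 (amap x v) = 0.
Proof. by move=> [_ _ /(_ v)] /=; rewrite zero_lfunE. Qed.
Lemma null_deg0 (a : hpair x deg0) : null a <-> forall v, a.2 v = 0.
Proof.
split=> [[h _ [_ h0]] v|a0]; first by rewrite h0 /= zero_lfunE.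
exists 0; first exact: rlinear0.
by split=> v; rewrite ?[a.1]to_rzero ?a0 !zero_lfunE.
Qed.
Lemma chain_deg1 (a : hpair x deg1) : rlinear a.1 -> chain a.
Proof.
move=> al; split=> // [|v]; first by rewrite [a.2]to_rzero; apply: rlinear0.
by rewrite [a.2]to_rzero /= !zero_lfunE.
Qed.
Lemma null_deg1 (a : hpair x deg1) : null a <->
  exists2 h : 'Hom(atgt x, M), rlinear h & forall v, a.1 v = h (amap x v).
Proof.
split=> [[h hl [h1 _]]|[h hl h1]]; exists h => //; split=> // v.
by rewrite [a.2]to_rzero /= !zero_lfunE.
Qed.
End Degrees.

(** * Homotopy classes of maps as modules over the endomorphism algebra *)

Section Representations.
Variables (k : fieldType) (A B : falgType k) (p : arrow A).
Variable beta : 'Hom(hpair p p, B).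

(** [beta] identifies homotopy classes of endomorphisms of p with B. *)
Record endomorphisms : Prop := {
  endo_surj : forall b, exists2 c : hpair p p, chain c & beta c = b;
  endo_null : forall c : hpair p p, chain c -> (beta c = 0 <-> null c);
  endo_1 : beta (\1%VF, \1%VF) = 1;
  endo_M : forall a c : hpair p p, chain a -> chain c ->
    beta (hcomp a c) = beta a * beta c }.

(** [kap] identifies homotopy classes of maps p -> x with the B-module L.  It is
    defined, linearly, on all pairs, but matters only on chain maps. *)
Record represents (x : arrow A) (L : rmod B) (kap : 'Hom(hpair p x, L)) : Prop := {
  rep_surj : forall l, exists2 a, chain a & kap a = l;
  rep_null : forall a, chain a -> (kap a = 0 <-> null a);
  rep_act : forall a c, chain a -> chain c ->
    kap (hcomp a c) = ract L (beta c) (kap a) }.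

Hypothesis end_p : endomorphisms.
Implicit Types (x y z : arrow A) (L M : rmod B).

Lemma chain_id : chain ((\1%VF, \1%VF) : hpair p p).
Proof. by split=> [||v]; try exact: rlinear_id; rewrite !id_lfunE. Qed.

Lemma rep_eq x L (kap : 'Hom(hpair p x, L)) a b :
  represents kap -> chain a -> chain b -> kap a = kap b <-> null (a - b).
Proof.
move=> rep ac bc; rewrite -(rep_null rep (chainB ac bc)) linearB /=.
by split=> [->|/eqP]; rewrite ?subrr // subr_eq0 => /eqP.
Qed.

(** L is the quotient of the chain maps by the null-homotopic ones.  An element
    b of B acts by composition with any representative of b, the choice of which
    does not matter up to homotopy. *)
Lemma representation_exists x :
  exists (L : rmod B) (kap : 'Hom(hpair p x, L)), represents kap.
Proof.
have [||U inU] := @vspace_of_pred k (hpair p x) (@chain _ _ p x).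
- exact: chain0.
- by move=> c a b; apply: chain_lin.
have [||W inW] := @vspace_of_pred k (hpair p x) (fun a => chain a /\ null a).
- by split; [apply: chain0|apply: null0].
- by move=> c a b [? ?] [? ?]; split; [apply: chain_lin|apply: null_lin].
have [Q [q [_ qW]]] := quotient_lfun W.
pose V : vectType k := subvs_of (q @: U)%VS.
have [|kap kapE] := @lfun_of_linear k (hpair p x) V (fun a => vsproj _ (q a)).
  by move=> c a b; rewrite !linearP.
have vkap a : chain a -> vsval (kap a) = q a.
  by move=> /inU aU; rewrite kapE vsprojK // memv_img.
have ksurj l : exists2 a, chain a & kap a = l.
  have /memv_imgP[a /inU ac la] := subvsP l.
  by exists a => //; apply/val_inj; rewrite /= vkap.
have knull a : chain a -> kap a = 0 <-> null a.
  move=> ac; have -> : kap a = 0 <-> a \in W.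
    rewrite -qW memv_ker -(vkap a ac); split=> [->|/eqP a0]; first by rewrite linear0.
    by apply/val_inj; rewrite /= a0.
  by rewrite inW; split=> [[]|].
have actP b : exists phi : 'End(V), forall c, chain c -> beta c = b ->
    forall a, chain a -> phi (kap a) = kap (hcomp a c).
  have [c0 c0c bE] := endo_surj end_p b.
  have t0 : {a : hpair p x | chain a} by exists 0; apply: chain0.
  have [||phi phiE] := @lfun_of_graph k {a : hpair p x | chain a} V V
    (fun a => kap (sval a)) (fun a => kap (hcomp (sval a) c0)) t0.
  - move=> z [a ac] [a' a'c]; exists (exist _ (z *: a + a') (chain_lin z ac a'c)).
    by rewrite /= hcompDl !linearP.
  - move=> [a ac] /= /(knull _ ac) a0; apply/knull; first exact: chain_comp.
    exact: null_compr.
  exists phi => c cc cb a ac; have /= -> := phiE (exist _ a ac).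
  apply/eqP; rewrite -subr_eq0 -linearB /= -hcompBr; apply/eqP/knull.
    by apply: chain_comp => //; apply: chainB.
  apply: null_compl => //; apply/(endo_null end_p); first exact: chainB.
  by rewrite linearB /= bE cb subrr.
have [act actE] := choice_fun actP.
have act_lin c a b : act (c *: a + b) = c *: act a + act b.
  apply/lfunP=> l; have [d dc <-] := ksurj l; rewrite add_lfunE scale_lfunE.
  have [a' a'c aE] := endo_surj end_p a; have [b' b'c bE] := endo_surj end_p b.
  rewrite (actE _ _ a'c aE _ dc) (actE _ _ b'c bE _ dc).
  rewrite (actE _ (c *: a' + b') _ _ _ dc); last 1 first.
  - by rewrite linearP /= aE bE.
  - by rewrite hcompDr linearP.
  exact: chain_lin.
have act_1 : act 1 = \1%VF.
  apply/lfunP=> l; have [d dc <-] := ksurj l; rewrite id_lfunE.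
  rewrite (actE _ _ chain_id (endo_1 end_p) _ dc); congr (kap _).
  by apply: hpairP => v; rewrite /= comp_lfunE id_lfunE.
have act_M a b : act (a * b) = (act b \o act a)%VF.
  apply/lfunP=> l; have [d dc <-] := ksurj l; rewrite comp_lfunE.
  have [a' a'c aE] := endo_surj end_p a; have [b' b'c bE] := endo_surj end_p b.
  rewrite (actE _ _ a'c aE _ dc) (actE _ _ b'c bE); last exact: chain_comp.
  rewrite (actE _ (hcomp a' b') _ _ _ dc) ?hcompA //; first exact: chain_comp.
  by rewrite endo_M // aE bE.
exists (RMod act_lin act_1 act_M), kap; split=> // a c ac cc.
by rewrite /= (actE _ _ cc erefl _ ac).
Qed.

Lemma rep_desc x L (kap : 'Hom(hpair p x, L)) M (q : 'Hom(hpair p x, M)) :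
  represents kap ->
  (forall a, chain a -> null a -> q a = 0) ->
  (forall a c, chain a -> chain c -> q (hcomp a c) = ract M (beta c) (q a)) ->
  exists2 F : 'Hom(L, M), rlinear F & forall a, chain a -> F (kap a) = q a.
Proof.
move=> rep q0 qact.
have t0 : {a : hpair p x | chain a} by exists 0; apply: chain0.
have [||F FE] := @lfun_of_graph k {a : hpair p x | chain a} L M
    (fun a => kap (sval a)) (fun a => q (sval a)) t0.
- move=> z [a ac] [a' a'c]; exists (exist _ (z *: a + a') (chain_lin z ac a'c)).
  by rewrite /= !linearP.
- by move=> [a ac] /= /(rep_null rep ac); apply: q0.
have FE' a : chain a -> F (kap a) = q a by move=> ac; apply: (FE (exist _ a ac)).
exists F => // b l; have [c cc <-] := endo_surj end_p b; have [a ac <-] := rep_surj rep l.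
by rewrite -(rep_act rep) // !FE' ?qact //; apply: chain_comp.
Qed.

Lemma rep_map x y L L' (kx : 'Hom(hpair p x, L)) (ky : 'Hom(hpair p y, L'))
    (f : hpair x y) :
  represents kx -> represents ky -> chain f ->
  exists2 F : 'Hom(L, L'), rlinear F &
    forall a, chain a -> F (kx a) = ky (hcomp f a).
Proof.
move=> rx ry fc.
have [|q qE] := @lfun_of_linear k (hpair p x) L' (fun a => ky (hcomp f a)).
  by move=> c a b; rewrite hcompDr linearP.
have [||F Fl FE] := @rep_desc x L kx L' q rx.
- move=> a ac a0; rewrite qE; apply/(rep_null ry); first exact: chain_comp.
  exact: null_compl.
- by move=> a c ac cc; rewrite !qE hcompA (rep_act ry) //; apply: chain_comp.
by exists F => // a ac; rewrite FE // qE.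
Qed.

Lemma rep_transport x y L (kx : 'Hom(hpair p x, L)) (f : hpair x y) :
  represents kx -> chain f ->
  (forall b : hpair p y, chain b -> exists2 a, chain a & null (b - hcomp f a)) ->
  (forall a : hpair p x, chain a -> null (hcomp f a) -> null a) ->
  exists ky : 'Hom(hpair p y, L), represents ky.
Proof.
move=> rep fc surj inj.
pose T := {t : hpair p y * hpair p x |
  [/\ chain t.1, chain t.2 & null (t.1 - hcomp f t.2)]}.
have Tlin c (s t : T) : exists u : T, sval u = (c *: (sval s).1 + (sval t).1,
    c *: (sval s).2 + (sval t).2).
  case: s t => [[b a] /= [bc ac n]] [[b' a'] /= [b'c a'c n']].
  have uP : [/\ chain (c *: b + b'), chain (c *: a + a') &
      null ((c *: b + b') - hcomp f (c *: a + a'))].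
    split; [exact: chain_lin|exact: chain_lin|].
    rewrite hcompDr opprD addrACA -scalerBr; exact: null_lin.
  by exists (exist _ (_, _) uP).
have Tmk b a : chain b -> chain a -> null (b - hcomp f a) -> exists t : T, sval t = (b, a).
  by move=> bc ac n; exists (exist _ (b, a) (And3 bc ac n)).
have [t0 _] : exists t : T, sval t = (0, 0).
  apply: Tmk; rewrite ?hcomp0r ?subrr; first [exact: chain0|exact: null0].
have [||ky kyE] := @lfun_of_graph k T (hpair p y) L
    (fun t => (sval t).1) (fun t => kx (sval t).2) t0.
- move=> c s t; have [u uE] := Tlin c s t; exists u.
  by rewrite uE /= linearP.
- move=> [[b a] /= [bc ac n]] b0; apply/(rep_null rep) => //; apply: inj => //.
  move: n; rewrite b0 sub0r => n; rewrite -[hcomp f a]opprK -scaleN1r -[_ *: _]addr0.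
  by apply: null_lin => //; apply: null0.
have kyE' b a : chain b -> chain a -> null (b - hcomp f a) -> ky b = kx a.
  by move=> bc ac n; have [t tE] := Tmk _ _ bc ac n; have := kyE t; rewrite tE.
exists ky; split.
- move=> l; have [a ac <-] := rep_surj rep l; exists (hcomp f a); first exact: chain_comp.
  by apply: kyE'; rewrite ?subrr //; [apply: chain_comp|apply: null0].
- move=> b bc; have [a ac n] := surj b bc; rewrite (kyE' _ _ bc ac n) (rep_null rep) //.
  split=> [a0|b0].
    have -> : b = 1 *: (b - hcomp f a) + hcomp f a by rewrite scale1r subrK.
    by apply: null_lin => //; apply: null_compl.
  apply: inj => //; have -> : hcomp f a = -1 *: (b - hcomp f a) + b.
    by rewrite scaleN1r opprB subrK.
  exact: null_lin.
move=> b c bc cc; have [a ac n] := surj b bc.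
rewrite (kyE' _ _ bc ac n) -(rep_act rep) //; apply: kyE'; try exact: chain_comp.
have -> : hcomp b c - hcomp f (hcomp a c) = hcomp (b - hcomp f a) c.
  by rewrite hcompA addrC -scaleN1r -hcompDl scaleN1r addrC.
exact: null_compr.
Qed.

(** For generators e_1, ..., e_n of X, the map xi sends (b_1, ..., b_n) to the
    sum of the e_j.b_j.  A module map from X to homotopy classes of maps p -> y
    is then composition with the map p^n -> y whose components are
    representatives of the images of the e_j. *)
Lemma presentation (X : rmod B) :
  exists n (xi : 'Hom(hpair p (parr p n), X)),
  [/\ forall v, exists2 b, chain b & xi b = v,
      forall b c, chain b -> chain c -> xi (hcomp b c) = ract X (beta c) (xi b),
      forall b, chain b -> null b -> xi b = 0 &
      forall y L (kap : 'Hom(hpair p y, L)) (h : 'Hom(X, L)),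
        represents kap -> rlinear h ->
        exists2 al : hpair (parr p n) y, chain al &
          forall b, chain b -> h (xi b) = kap (hcomp al b)].
Proof.
pose n : nat := \dim {:X}; pose e (j : 'I_n) := (vbasis {:X})`_j.
have actB c a b v : ract X (c *: a + b) v = c *: ract X a v + ract X b v.
  exact: ract_lin_comb.
have [|xi xiE] := @lfun_of_linear k (hpair p (parr p n)) X
    (fun b => \sum_j ract X (beta (hcomp (pproj p j) b)) (e j)).
  move=> c a b; rewrite scaler_sumr -big_split; apply: eq_bigr => j _ /=.
  by rewrite hcompDr linearP actB.
have pc j (b : hpair p (parr p n)) : chain b -> chain (hcomp (pproj p j) b).
  by move=> bc; apply: chain_comp => //; apply: chain_pproj.
exists n, xi; split.
- move=> v; exists (\sum_j coord (vbasis {:X}) j v *: pinj p j).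
    apply: chain_sum => j; rewrite -[_ *: _]addr0.
    by apply: chain_lin; [apply: chain_pinj|apply: chain0].
  rewrite xiE [RHS](coord_vbasis (memvf v)); apply: eq_bigr => j _.
  rewrite hcomp_sumr linear_sum (bigD1 j) //= big1 ?addr0 => [|i ij].
    have -> : hcomp (pproj p j) (coord (vbasis {:X}) j v *: pinj p j) =
        coord (vbasis {:X}) j v *: ((\1%VF, \1%VF) : hpair p p).
      rewrite -[_ *: pinj p j]addr0 hcompDr hcomp0r addr0; congr (_ *: _).
      by apply: hpairP => u; rewrite /= comp_lfunE rproj_rinj eqxx id_lfunE.
    by rewrite linearZ /= (endo_1 end_p) -[_ *: 1]addr0 actB ract1 id_lfunE
      -[X in _ + X](_ : 0 = _) ?addr0 //; have := actB (-1) 0 0 (e j);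
      rewrite scaler0 addr0 scaleN1r addNr.
  have -> : hcomp (pproj p j) (coord (vbasis {:X}) i v *: pinj p i) = 0.
    rewrite -[_ *: pinj p i]addr0 hcompDr hcomp0r addr0.
    have -> : hcomp (pproj p j) (pinj p i) = 0.
      apply: hpairP => u; rewrite /= comp_lfunE rproj_rinj eq_sym (negPf ij);
      by rewrite zero_lfunE.
    by rewrite scaler0.
  by rewrite linear0.
- move=> b c bc cc; rewrite !xiE linear_sum; apply: eq_bigr => j _ /=.
  by rewrite hcompA (endo_M end_p) ?ractM ?comp_lfunE //; apply: pc.
- move=> b bc b0; rewrite xiE big1 // => j _.
  have -> : beta (hcomp (pproj p j) b) = 0.
    by apply/(endo_null end_p); [apply: pc|apply: null_compl => //; apply: chain_pproj].
  by have := actB (-1) 0 0 (e j); rewrite scaler0 addr0 scaleN1r addNr.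
move=> y L kap h rep hl.
have [al alc alE] := choice_fun2 (fun j => rep_surj rep (h (e j))).
have [f fc [fE _]] := copair_parr alc; exists f => // b bc.
rewrite xiE linear_sum fE linear_sum; apply: eq_bigr => j _ /=.
by rewrite hl -alE (rep_act rep) //; apply: pc.
Qed.

End Representations.

(** * The torsion pair of a rigid arrow *)

Section TorsionPair.
Variables (k : fieldType) (A : falgType k) (p : arrow A).
Hypotheses (proj1 : projective (asrc p)) (proj0 : projective (atgt p)).
Hypothesis rig : rigid p.
Implicit Types M Q : rmod A.

(** Hom(p, M[1]) = 0. *)
Definition tors M : Prop := forall a : 'Hom(asrc p, M), rlinear a ->
  exists2 b : 'Hom(atgt p, M), rlinear b & forall v, a v = b (amap p v).
(** Hom(p, M) = 0. *)
Definition torsfree M : Prop := forall a : 'Hom(atgt p, M), rlinear a ->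
  (forall v, a (amap p v) = 0) -> forall v, a v = 0.

(** The image of tau is the trace in M of the cokernel H^0(p) of p. *)
Definition is_trace M m (tau : 'Hom(rpow m (atgt p), M)) : Prop :=
  [/\ rlinear tau, forall v, tau (amap (parr p m) v) = 0 &
      forall a : 'Hom(atgt p, M), rlinear a -> (forall v, a (amap p v) = 0) ->
        exists2 c : 'Hom(atgt p, rpow m (atgt p)), rlinear c & forall v, a v = tau (c v)].

Lemma trace_exists M : exists m (tau : 'Hom(rpow m (atgt p), M)), is_trace tau.
Proof.
have [||||m [f fc [fgen _]]] := @approximation k A p (deg0 M) (@chain k A p (deg0 M)).
- exact: chain0.
- by move=> c u v; apply: chain_lin.
- by [].
- by move=> u e; apply: chain_comp.
exists m, (f.2 : 'Hom(rpow m (atgt p), M)); have [f1 f0 fd] := fc; split=> // [v|a al ad].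
  exact: (chain_deg0_eq0 v fc).
have [|c [c1 c0 cd] E] := fgen ((0, a) : hpair p (deg0 M)); first exact: chain_deg0.
by exists c.2 => // v; move/(congr1 (fun b : hpair p (deg0 M) => b.2 v)): E; rewrite /= comp_lfunE.
Qed.

(** The image of tau is torsion: the composite of a lift a' : p -> p^m[1] of a
    with tau factors through the differential, because a' is null-homotopic by
    rigidity and tau kills one of the two terms of the homotopy. *)
Lemma trace_tors M m (tau : 'Hom(rpow m (atgt p), M)) (a : 'Hom(asrc p, M)) :
  is_trace tau -> rlinear a -> (forall v, exists x, tau x = a v) ->
  exists2 b : 'Hom(atgt p, rpow m (atgt p)), rlinear b & forall v, a v = tau (b (amap p v)).
Proof.
move=> [taul taud _] al aim.
have [a' a'l a'E] := projective_lift proj1 taul al aim.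
have [u ul [b bl ubE]] := rigid_parr rig a'l.
by exists b => // v; rewrite -a'E ubE linearD /= taud add0r.
Qed.

(** A map p -> Q lifts to p -> M up to a map p -> (im tau)[1], which is zero; but
    maps p -> M end in the image of tau. *)
Lemma trace_torsfree M Q m (tau : 'Hom(rpow m (atgt p), M)) (q : 'Hom(M, Q)) :
  is_trace tau -> repi q -> (forall x, q x = 0 <-> exists y, tau y = x) -> torsfree Q.
Proof.
move=> tr [ql /epiE qonto] qker a al ad v; have [taul taud tgen] := tr.
have [b bl bE] := projective_lift proj0 ql al (fun v => qonto (a v)).
have [||c cl cE] := @trace_tors _ _ tau (b \o amap p)%VF tr.
- by apply: rlinear_comp => //; apply: amap_rlinear.
- by move=> x; apply/qker; rewrite comp_lfunE bE ad.
have [||e el eE] := tgen (b - (tau \o c))%VF.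
- by apply: rlinearB => //; apply: rlinear_comp.
- by move=> x; rewrite add_lfunE opp_lfunE comp_lfunE -cE comp_lfunE subrr.
rewrite -bE; apply/qker; exists (e v + c v).
by rewrite linearD /= -eE add_lfunE opp_lfunE comp_lfunE subrK.
Qed.

(** The trace of H^0(p) in M is the torsion part of M. *)
Lemma torsion_sequence M : exists (S Q : rmod A) (i : 'Hom(S, M)) (q : 'Hom(M, Q)),
  [/\ short_exact i q, tors S & torsfree Q].
Proof.
have [m [tau tr]] := trace_exists M; have [taul taud tgen] := tr.
have [S [i [im iS]]] := submodule_rmod (submodule_limg taul).
have [Q [q [qe qK]]] := quotient_rmod (submodule_limg taul).
have iE x : exists y, tau y = i x.
  have : i x \in limg tau by rewrite -iS memv_img ?memvf.
  by case/memv_imgP=> y _ ->; exists y.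
exists S, Q, i, q; split; first by split; rewrite // iS qK.
- move=> a al; have [|x|b bl bE] := @trace_tors _ _ tau (i \o a)%VF tr.
  + by apply: rlinear_comp => //; case: im.
  + by rewrite comp_lfunE.
  have [|v|c cl cE] := @mono_lift _ _ _ _ _ i (tau \o b)%VF im.
  + exact: rlinear_comp.
  + by rewrite iS comp_lfunE memv_img ?memvf.
  exists c => // v; apply/eqP; rewrite -subr_eq0; apply/eqP.
  have /monoE := im.2; apply.
  by rewrite linearB /= -cE comp_lfunE -bE comp_lfunE subrr.
apply: (trace_torsfree tr qe) => x; split=> [/eqP|[y <-]].
  by rewrite -memv_ker qK => /memv_imgP[y _ ->]; exists y.
by apply/eqP; rewrite -memv_ker qK memv_img ?memvf.
Qed.

Hypothesis generates : forall M, torsfree M -> tors M -> is_zero M.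

(** The quotient of a torsion module by the trace of H^0(p) is torsion, as any
    quotient of a torsion module, and torsion-free. *)
Lemma tors_generated M : tors M ->
  exists m (tau : 'Hom(rpow m (atgt p), M)), is_trace tau /\ forall x, exists y, tau y = x.
Proof.
move=> tM; have [m [tau tr]] := trace_exists M; exists m, tau; split=> // x.
have [taul taud tgen] := tr.
have [Q [q [qe qK]]] := quotient_rmod (submodule_limg taul).
have qker y : q y = 0 <-> exists z, tau z = y.
  split=> [/eqP|[z <-]].
    by rewrite -memv_ker qK => /memv_imgP[z _ ->]; exists z.
  by apply/eqP; rewrite -memv_ker qK memv_img ?memvf.
apply/qker; apply: generates; first exact: trace_torsfree tr qe qker.
have [ql /epiE qonto] := qe.
move=> a al; have [a' a'l a'E] := projective_lift proj1 ql al (fun v => qonto (a v)).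
have [b bl bE] := tM a' a'l; exists (q \o b)%VF; first exact: rlinear_comp.
by move=> v; rewrite comp_lfunE -bE a'E.
Qed.

End TorsionPair.

(** * The two exact sequences through the arrow w *)

Section MiddleTerm.
Variables (k : fieldType) (A B : falgType k) (p : arrow A).
Variables (beta : 'Hom(hpair p p, B)) (end_p : endomorphisms beta).
Hypotheses (proj1 : projective (asrc p)) (proj0 : projective (atgt p)).

Variables (R Pi I Q : rmod A) (inc : 'Hom(R, Pi)) (w : 'Hom(Pi, I)) (quo : 'Hom(I, Q)).
Hypotheses (inc_mono : rmono inc) (quo_epi : repi quo).
Hypotheses (inc_w : limg inc = lker w) (w_quo : limg w = lker quo) (wl : rlinear w).

Let z : arrow A := Arrow wl.

Let w_inc x : w (inc x) = 0.
Proof. by apply/eqP; rewrite -memv_ker -inc_w memv_img ?memvf. Qed.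
Let quo_w x : quo (w x) = 0.
Proof. by apply/eqP; rewrite -memv_ker -w_quo memv_img ?memvf. Qed.
Let kerw x : w x = 0 -> exists y, inc y = x.
Proof. by move/eqP; rewrite -memv_ker -inc_w => /memv_imgP[y _ ->]; exists y. Qed.
Let kerq x : quo x = 0 -> exists y, w y = x.
Proof. by move/eqP; rewrite -memv_ker -w_quo => /memv_imgP[y _ ->]; exists y. Qed.
Let inc_inj : injective inc. Proof. by case: inc_mono => _ /lker_eq0. Qed.

Variables (L E M : rmod B) (kL : 'Hom(hpair p (deg1 R), L)) (kE : 'Hom(hpair p z, E))
  (kM : 'Hom(hpair p (deg0 Q), M)).
Hypotheses (rL : represents beta kL) (rE : represents beta kE) (rM : represents beta kM).

(** R and Q are the cohomology modules of w in degrees -1 and 0, so this is part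
    of the long exact sequence of Hom(p, -) for the triangle R[1] -> w -> Q.
    Exactness at the ends holds for degree reasons. *)
Lemma cohomology_sequence : exists (u : 'Hom(L, E)) (v : 'Hom(E, M)), short_exact u v.
Proof.
have [incl inc0] := inc_mono; have [quol quof] := quo_epi.
have quo_onto : forall y, exists x, quo x = y by apply/epiE.
pose i1 : hpair (deg1 R) z := (inc, 0).
pose q0 : hpair z (deg0 Q) := (0, quo).
have i1c : chain i1 by split=> // [|x]; [exact: rlinear0|rewrite w_inc zero_lfunE].
have q0c : chain q0 by split=> // [|x]; [exact: rlinear0|rewrite !zero_lfunE /= quo_w].
have [u ul uE] := rep_map end_p rL rE i1c; have [v vl vE] := rep_map end_p rE rM q0c.
exists u, v; split.
- split=> //; apply/monoE => l; have [a ac <-] := rep_surj rL l.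
  have [al _ _] := ac; rewrite uE // => /(rep_null rE (chain_comp i1c ac))[h hl [h1 h0]].
  have [|h' h'l h'E] := @mono_lift _ _ _ R Pi inc h inc_mono hl.
    move=> x; rewrite inc_w memv_ker; apply/eqP.
    by have := h0 x; rewrite /= comp_lfunE zero_lfunE.
  apply/(rep_null rL) => //; apply/null_deg1; exists h' => // x.
  by apply: inc_inj; rewrite -h'E -h1 /= comp_lfunE.
- split=> //; apply/epiE => m; have [a ac <-] := rep_surj rM m.
  have [_ al ad] := ac.
  have [b bl bE] := projective_lift proj0 quol al (fun x => quo_onto _).
  have [||b1 b1l b1E] := projective_lift (f := (b \o amap p)%VF) proj1 wl.
  + by apply: rlinear_comp => //; apply: amap_rlinear.
  + by move=> x; apply: kerq; rewrite comp_lfunE bE (chain_deg0_eq0 _ ac).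
  have bc : chain ((b1, b) : hpair p z) by split=> // x; rewrite /= b1E comp_lfunE.
  exists (kE (b1, b)); rewrite vE //; apply/(rep_eq rM) => //; first exact: chain_comp.
  by apply/null_deg0 => x; rewrite /= add_lfunE opp_lfunE comp_lfunE bE subrr.
apply/vspaceP=> e; rewrite memv_ker; apply/memv_imgP/eqP=> [[l _ ->]|].
  have [a ac <-] := rep_surj rL l; rewrite uE // vE; last exact: chain_comp.
  apply/(rep_null rM); first by do 2![apply: chain_comp => //].
  by apply/null_deg0 => x; rewrite /= !comp_lfunE zero_lfunE linear0.
have [a ac <-] := rep_surj rE e; rewrite vE //.
move=> /(rep_null rM (chain_comp q0c ac))/null_deg0 qa.
have [al1 al0 ad] := ac.
have [|h hl hE] := projective_lift proj0 wl al0.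
  by move=> x; apply: kerq; have := qa x; rewrite /= comp_lfunE.
have [||b bl bE] := @mono_lift _ _ _ R Pi inc (a.1 - (h \o amap p))%VF inc_mono.
- by apply: rlinearB => //; apply: rlinear_comp => //; apply: amap_rlinear.
- move=> x; rewrite inc_w memv_ker add_lfunE opp_lfunE comp_lfunE linearB /= hE.
  by rewrite -ad subrr.
have bc : chain ((b, 0) : hpair p (deg1 R)) by exact: chain_deg1.
exists (kL (b, 0)); rewrite ?memvf // uE //.
apply/(rep_eq rE) => //; first exact: chain_comp.
exists h => //; split=> x; rewrite /= add_lfunE opp_lfunE comp_lfunE.
  by rewrite -bE add_lfunE opp_lfunE comp_lfunE opprB addrC subrK.
by rewrite !zero_lfunE subr0 hE.
Qed.

Hypothesis I_inj : injective_rmod I.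
Hypothesis w_local : detects_split_epis w.
(** P_i is not a direct summand of p. *)
Hypothesis notin_add0 : forall (a : 'Hom(atgt p, Pi)) (s : 'Hom(Pi, atgt p)),
  rlinear a -> rlinear s -> (forall v, a (amap p v) = 0) -> ~ (forall v, a (s v) = v).
(** P_i[1] is not a direct summand of p. *)
Hypothesis notin_add1 : forall (a : 'Hom(asrc p, Pi)) (s : 'Hom(Pi, asrc p)),
  rlinear a -> rlinear s -> (forall v, amap p (s v) = 0) -> ~ (forall v, a (s v) = v).

Variables (N C : rmod B) (kN : 'Hom(hpair p (deg0 I), N)) (kC : 'Hom(hpair p (deg1 Pi), C)).
Hypotheses (rN : represents beta kN) (rC : represents beta kC).

(** Part of the long exact sequence of the triangle I -> w -> P_i[1].  Its
    connecting maps are composition with w from Hom(p, P_i) to Hom(p, I) and from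
    Hom(p, P_i[1]) to Hom(p, I[1]); they vanish, as a map that w does not
    annihilate would split off P_i or P_i[1]. *)
Lemma connecting_sequence : exists (F : 'Hom(N, E)) (G : 'Hom(E, C)),
  [/\ short_exact F G,
      forall a, chain a -> F (kN a) = kE (0, a.2) &
      forall a, chain a -> G (kE a) = kC (a.1, 0)].
Proof.
pose i0 : hpair (deg0 I) z := (0, \1%VF).
pose p1 : hpair z (deg1 Pi) := (\1%VF, 0).
have i0c : chain i0.
  by split=> [||x]; [exact: rlinear0|exact: rlinear_id|rewrite !zero_lfunE /= !linear0].
have p1c : chain p1.
  by split=> [||x]; [exact: rlinear_id|exact: rlinear0|rewrite /= !zero_lfunE].
have [F Fl FE] := rep_map end_p rN rE i0c; have [G Gl GE] := rep_map end_p rE rC p1c.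
have FE' a : chain a -> F (kN a) = kE (0, a.2).
  by move=> ac; rewrite FE // /hcomp /= comp_lfun0l comp_lfun1l.
have GE' a : chain a -> G (kE a) = kC (a.1, 0).
  by move=> ac; rewrite GE // /hcomp /= comp_lfun0l comp_lfun1l.
exists F, G; split=> //; split.
- split=> //; apply/monoE => n; have [a ac <-] := rep_surj rN n.
  rewrite FE // => /(rep_null rE (chain_comp i0c ac))[h hl [h1 h0]].
  apply/(rep_null rN) => //; apply/null_deg0 => x.
  have := h0 x; rewrite /= comp_lfunE id_lfunE => ->; apply: NNPP => wh.
  have [s sl sE] := w_local hl wh.
  by apply: (notin_add0 hl sl) => // v; rewrite -h1 /= comp_lfunE zero_lfunE.
- split=> //; apply/epiE => c; have [a ac <-] := rep_surj rC c; have [al _ _] := ac.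
  have [|||s sl sE] := I_inj (j := amap p) (t := (w \o a.1)%VF).
  + exact: amap_rlinear.
  + exact: rlinear_comp.
  + move=> x x0; rewrite comp_lfunE; apply: NNPP => wx.
    have [K [i [[il im] iK]]] := submodule_rmod (submodule_lker (amap_rlinear (a := p))).
    have : x \in limg i by rewrite iK memv_ker x0.
    case/memv_imgP=> y _ xy; rewrite xy in wx.
    have [||t tl tE] := @w_local K (a.1 \o i)%VF y; rewrite ?comp_lfunE //.
      exact: rlinear_comp.
    apply: (@notin_add1 a.1 (i \o t)%VF) => //; first exact: rlinear_comp.
      by move=> v; apply/eqP; rewrite comp_lfunE -memv_ker -iK memv_img ?memvf.
    by move=> v; rewrite -[RHS]tE !comp_lfunE.
  have bc : chain ((a.1, s) : hpair p z) by split=> // x; rewrite /= sE comp_lfunE.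
  exists (kE (a.1, s)); rewrite GE' //; congr (kC _).
  by apply: hpairP => // v; rewrite [a.2]to_rzero.
apply/vspaceP=> e; rewrite memv_ker; apply/memv_imgP/eqP=> [[n _ ->]|].
  have [a ac <-] := rep_surj rN n; rewrite FE // GE; last exact: chain_comp.
  apply/(rep_null rC); first by do 2![apply: chain_comp => //].
  apply/null_deg1; exists 0; first exact: rlinear0.
  by move=> x; rewrite /= !comp_lfunE !zero_lfunE linear0.
have [a ac <-] := rep_surj rE e; rewrite GE //.
move=> /(rep_null rC (chain_comp p1c ac))/null_deg1[h hl hE].
have [a1 a0 ad] := ac.
pose b : hpair p (deg0 I) := (0, (a.2 - (w \o h))%VF).
have a1E x : a.1 x = h (amap p x) by rewrite -hE /= comp_lfunE id_lfunE.
have bc : chain b.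
  apply: chain_deg0 => [|x]; first by apply: rlinearB => //; apply: rlinear_comp.
  by rewrite /= add_lfunE opp_lfunE comp_lfunE -a1E -ad subrr.
exists (kN b); rewrite ?memvf // FE //; apply/(rep_eq rE) => //; first exact: chain_comp.
exists h => //; split=> x; rewrite /= add_lfunE opp_lfunE comp_lfunE.
  by rewrite zero_lfunE subr0 a1E.
by rewrite id_lfunE add_lfunE opp_lfunE comp_lfunE opprB addrC subrK.
Qed.

End MiddleTerm.

(** * Lifting maps that are not split epimorphisms *)

Section Lifting.
Variables (k : fieldType) (A B : falgType k) (p : arrow A).
Variables (beta : 'Hom(hpair p p, B)) (end_p : endomorphisms beta).
Hypothesis rig : rigid p.

Variables (Pi I : rmod A) (w : 'Hom(Pi, I)) (wl : rlinear w).
Hypothesis I_inj : injective_rmod I.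
Hypothesis w_local : detects_split_epis w.

Let z : arrow A := Arrow wl.
Variables (E C : rmod B).
Variables (kE : 'Hom(hpair p z, E)) (kC : 'Hom(hpair p (deg1 Pi), C)).
Hypotheses (rE : represents beta kE) (rC : represents beta kC).

(** Take p^m -phi-> p^n with X the cokernel of the induced map on
    homotopy classes, and let al : p^n -> P_i[1] represent h.  A null-homotopy hR
    of al phi makes (al, hR) a map to P_i[1] from the cone of phi.  Its composite
    with w extends to the degree 0 part of the cone, which gives the lift, unless
    it is nonzero on cycles; then (al, hR) has a section on cycles, which induces
    a section of h. *)
Lemma lift_nonsplit (G : 'Hom(E, C)) (X : rmod B) (h : 'Hom(X, C)) :
  rlinear G -> (forall a, chain a -> G (kE a) = kC (a.1, 0)) ->
  rlinear h -> ~ split_epi h ->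
  exists2 h' : 'Hom(X, E), rlinear h' & forall x, h x = G (h' x).
Proof.
move=> Gl GE hl nsplit.
have [n [xi [xi_surj xi_act xi_null xi_real]]] := presentation end_p X.
have [al [al1 _ _] alE] := xi_real _ _ _ _ rC hl.
have [|||u c uS cc|m [phi phic [phi_gen phi_xi]]] := @approximation k A p (parr p n)
    (fun b => chain b /\ xi b = 0).
- by split; [apply: chain0|rewrite linear0].
- move=> c u v [uc u0] [vc v0]; split; first exact: chain_lin.
  by rewrite linearP /= u0 v0 scaler0 addr0.
- by move=> u [].
- have [uc u0] := uS; split; first exact: chain_comp.
  by rewrite xi_act // u0 linear0.
pose dn : 'Hom(rpow n (asrc p), rpow n (atgt p)) := amap (parr p n).
pose dm : 'Hom(rpow m (asrc p), rpow m (atgt p)) := amap (parr p m).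
pose f1 : 'Hom(rpow m (asrc p), rpow n (asrc p)) := phi.1.
pose f0 : 'Hom(rpow m (atgt p), rpow n (atgt p)) := phi.2.
pose a1 : 'Hom(rpow n (asrc p), Pi) := al.1.
have [f1l f0l fd] : [/\ rlinear f1, rlinear f0 & forall v, dn (f1 v) = f0 (dm v)] := phic.
have a1l : rlinear a1 := al1.
have [hR hRl hRE] : exists2 hR : 'Hom(rpow m (atgt p), Pi), rlinear hR &
    forall v, a1 (f1 v) = hR (dm v).
  have ex r : exists2 g : 'Hom(atgt p, Pi), rlinear g &
      forall v, a1 (f1 (rinj (asrc p) r v)) = g (amap p v).
    have cr : chain (hcomp phi (pinj p r)) by apply: chain_comp => //; apply: chain_pinj.
    have /null_deg1[g gl gE] : null (hcomp al (hcomp phi (pinj p r))).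
      apply/(rep_null rC); first by apply: chain_deg1; apply: rlinear_comp => //; case: cr.
      by rewrite -alE // (phi_xi _ (chain_pinj p r)).2 linear0.
    by exists g => // v; rewrite -gE /= !comp_lfunE.
  have [g gl gE] := choice_fun2 ex.
  have [hR hRl [_ hRi]] := copair_pow gl; exists hR => // v.
  rewrite {1}[v]rpow_decomp [in RHS](rpow_decomp v) !linear_sum /=.
  by apply: eq_bigr => r _; rewrite gE -/dm /dm parr_inj hRi.
(* In the cone of phi, del is the differential from degree -1 to degree 0, K
   the module of cycles in degree -1, and ev the degree -1 component of the
   map (al, hR) to P_i[1]. *)
have [del dell delE] := copairing (amap_rlinear (a := parr p n) : rlinear dn) f0l.
have [ev evl evE] := copairing a1l hRl.
have [K [i [[il im] iK]]] := submodule_rmod (submodule_lker dell).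
have Kdel y : del (i y) = 0.
  by apply/eqP; rewrite -memv_ker -iK memv_img ?memvf.
have [[y wy]|vanish] := classic (exists y, w (ev (i y)) <> 0).
  have [||s sl sE] := @w_local K (ev \o i)%VF y; rewrite ?comp_lfunE //.
    exact: rlinear_comp.
  pose bp : 'Hom(Pi, rpow n (asrc p)) := (rfst _ _ \o (i \o s))%VF.
  pose bq : 'Hom(Pi, rpow m (atgt p)) := (rsnd _ _ \o (i \o s))%VF.
  have bpl : rlinear bp by apply: rlinear_comp (@rlinear_fst _ _ _ _) (rlinear_comp il sl).
  have bql : rlinear bq by apply: rlinear_comp (@rlinear_snd _ _ _ _) (rlinear_comp il sl).
  have bd v : dn (bp v) = - f0 (bq v).
    apply/eqP; rewrite -addr_eq0 !comp_lfunE rfstE rsndE -delE Kdel //.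
  have be v : a1 (bp v) = v - hR (bq v).
    by apply/eqP; rewrite eq_sym subr_eq !comp_lfunE rfstE rsndE -evE -[ev _]comp_lfunE sE.
  clearbody bp bq; case: nsplit.
  (* The section (bp, bq), from P_i[1] to the cone, turns g : p -> P_i[1] into a
     map from p to the cone.  By rigidity its component bq g in p^m[1] has a
     null-homotopy (u, v), and r (g, u, v) is the resulting map p -> p^n. *)
  pose T := {t : 'Hom(asrc p, Pi) *
      ('Hom(asrc p, rpow m (asrc p)) * 'Hom(atgt p, rpow m (atgt p))) |
    [/\ rlinear t.1, rlinear t.2.1, rlinear t.2.2 &
      forall v, bq (t.1 v) = dm (t.2.1 v) + t.2.2 (amap p v)]}.
  have Tlin c (t1 t2 : T) : exists u : T, sval u = c *: sval t1 + sval t2.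
    case: t1 t2 => [[g [u v]] /= [gl ul vl E1]] [[g' [u' v']] /= [gl' ul' vl' E2]].
    have uP : [/\ rlinear (c *: g + g'), rlinear (c *: u + u'), rlinear (c *: v + v') &
      forall t, bq ((c *: g + g') t) =
        dm ((c *: u + u') t) + (c *: v + v') (amap p t)].
      split=> [|||t]; try by apply: rlinearD => //; apply: rlinearZ.
      rewrite !(add_lfunE, scale_lfunE) !linearP /= E1 E2 scalerDr.
      by rewrite addrACA.
    by exists (exist _ (c *: g + g', (c *: u + u', c *: v + v')) uP).
  have Tex (g : 'Hom(asrc p, Pi)) : rlinear g -> exists t : T, (sval t).1 = g.
    move=> gl; have [|u ul [v vl uvE]] := rigid_parr (e := (bq \o g)%VF) rig.
      exact: rlinear_comp.
    have tP : [/\ rlinear g, rlinear u, rlinear v &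
        forall t, bq (g t) = dm (u t) + v (amap p t)].
      by split=> // t; rewrite -uvE comp_lfunE.
    by exists (exist _ (g, (u, v)) tP).
  pose r (t : 'Hom(asrc p, Pi) *
      ('Hom(asrc p, rpow m (asrc p)) * 'Hom(atgt p, rpow m (atgt p)))) :
      hpair p (parr p n) :=
    (((bp \o t.1) + (f1 \o t.2.1))%VF, (- (f0 \o t.2.2))%VF).
  have rc (t : T) : chain (r (sval t)).
    case: t => [[g [u v]] /= [gl ul vl E1]]; split=> [||t] /=.
    - exact: (rlinearD (rlinear_comp bpl gl) (rlinear_comp f1l ul)).
    - exact: (rlinearN (rlinear_comp f0l vl)).
    change (dn (((bp \o g)%VF + (f1 \o u)%VF) t) = (- (f0 \o v)%VF) (amap p t)).
    rewrite add_lfunE opp_lfunE !comp_lfunE linearD /= bd fd E1 linearD /=.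
    by rewrite opprD addrAC addNr add0r.
  have r_lin c t1 t2 : r (c *: t1 + t2) = c *: r t1 + r t2.
    apply: hpairP => v; rewrite /= !(add_lfunE, scale_lfunE, opp_lfunE, comp_lfunE).
      by rewrite !linearP /= scalerDr addrACA.
    by rewrite linearP opprD scalerN.
  have r_act (t : T) (c : hpair p p) : chain c -> exists t' : T,
      (sval t').1 = ((sval t).1 \o c.1)%VF /\ r (sval t') = hcomp (r (sval t)) c.
    case: t => [[g [u v]] /= [gl ul vl E1]] [c1 c0 cd].
    have tP : [/\ rlinear (g \o c.1)%VF, rlinear (u \o c.1)%VF, rlinear (v \o c.2)%VF &
        forall t, bq ((g \o c.1)%VF t) = dm ((u \o c.1)%VF t) + (v \o c.2)%VF (amap p t)].
      split=> [|||t]; try exact: rlinear_comp.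
      by rewrite !comp_lfunE E1 cd.
    exists (exist _ (_, (_, _)) tP); split=> //.
    by apply: (@hpairP _ _ p (parr p n)) => t; rewrite /= !(add_lfunE, opp_lfunE, comp_lfunE).
  (* Up to homotopy the map from p to p^n is then in the image of phi.  The case
     g = 0 shows that the choice of (u, v) does not matter. *)
  have r_null (t : T) (g : 'Hom(atgt p, Pi)) : rlinear g ->
      (forall v, (sval t).1 v = g (amap p v)) -> xi (r (sval t)) = 0.
    case: t => [[g' [u v]] /= tP] gl g'E; have [gl' ul vl E1] := tP; rewrite /= in gl' ul vl E1.
    pose c : hpair p (parr p m) := (u, ((bq \o g)%VF - v)).
    have cc : chain c.
      split=> [//||t]; first exact: (rlinearB (rlinear_comp bql gl) vl).
      change (dm (u t) = ((bq \o g)%VF - v) (amap p t)).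
      by rewrite add_lfunE opp_lfunE comp_lfunE -g'E E1 addrK.
    have rtc := rc (exist _ (g', (u, v)) tP).
    have [pc pc0] := phi_xi _ cc.
    have -> : xi (r (g', (u, v))) = xi (r (g', (u, v)) - hcomp phi c).
      by rewrite linearB /= pc0 subr0.
    apply: xi_null; first exact: chainB.
    exists (bp \o g)%VF; first exact: rlinear_comp.
    split=> t /=; rewrite !(add_lfunE, opp_lfunE, comp_lfunE).
      by rewrite addrK g'E.
    change (- f0 (v t) - f0 ((bq (g t) - v t)) = dn (bp (g t))).
    by rewrite bd linearB opprB addKr.
  have [t0 _] := Tex 0 (@rlinear0 _ _ _ _).
  have [||sg sgE] := @lfun_of_graph k T C X (fun t => kC ((sval t).1, 0))
      (fun t => xi (r (sval t))) t0.
  - move=> c t t'; have [u uE] := Tlin c t t'; exists u; split; last by rewrite /= uE r_lin linearP.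
    rewrite /= uE -linearP /=; congr (kC (_, _)).
    exact: esym (to_rzero _).
  - move=> t; have [gl _ _ _] := svalP t.
    move=> /(rep_null rC (chain_deg1 (a := ((sval t).1, 0)) gl))/null_deg1[g gl' gE].
    exact: r_null gE.
  have lift_kC v : exists t : T, v = kC ((sval t).1, 0).
    have [[g g0] [gl _ _] <-] := rep_surj rC v.
    by have [t tE] := Tex g gl; exists t; rewrite tE; congr (kC (_, _)); apply: to_rzero.
  exists sg => [a v|].
    have [c cc <-] := endo_surj end_p a; have [t ->] := lift_kC v.
    have [t' [t'E rt']] := r_act t c cc; have [gl _ _ _] := svalP t.
    rewrite -(rep_act rC) //; last exact: chain_deg1.
    have -> : @hcomp _ _ p p (deg1 Pi) ((sval t).1, 0) c = ((sval t').1, 0).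
      by rewrite t'E /hcomp /= comp_lfun0l.
    by rewrite !sgE rt' xi_act.
  apply/lfunP=> v; rewrite comp_lfunE id_lfunE; have [t ->] := lift_kC v.
  rewrite sgE alE //; have := svalP t; case: (sval t) (rc t) => g [u v'] /= rtc [gl ul vl E1].
  have gc : chain ((g, 0) : hpair p (deg1 Pi)) by exact: chain_deg1.
  apply/(rep_eq rC) => //.
    by apply: chain_deg1; have [? _ _] := rtc; exact: rlinear_comp.
  apply/null_deg1; exists (- (hR \o v'))%VF; first exact: (rlinearN (rlinear_comp hRl vl)).
  move=> y'; rewrite /= !(add_lfunE, opp_lfunE, comp_lfunE).
  change (a1 (bp (g y') + f1 (u y')) - g y' = - hR (v' (amap p y'))).
  rewrite linearD /= be hRE E1 linearD /= opprD.
  by rewrite addrAC (addrC (g y')) addrK addrAC addNr add0r.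
have [||s sl sE] := @I_inj _ _ del (w \o ev)%VF dell; first exact: rlinear_comp.
  move=> x x0; have : x \in limg i by rewrite iK memv_ker x0.
  case/memv_imgP=> y _ ->; rewrite comp_lfunE; apply: NNPP => wy.
  by apply: vanish; exists y.
have s1 v : s (dn v) = w (a1 v).
  have := sE (v, 0); rewrite delE comp_lfunE evE /= !linear0 !addr0; exact.
have s0 v : s (f0 v) = w (hR v).
  have := sE (0, v); rewrite delE comp_lfunE evE /= !linear0 !add0r; exact.
pose q0 (b : hpair p (parr p n)) : hpair p z := ((a1 \o b.1)%VF, (s \o b.2)%VF).
have q0c b : chain b -> chain (q0 b).
  move=> [b1 b0 bd]; split=> [||v]; try exact: rlinear_comp.
  by rewrite /= !comp_lfunE -s1 bd.
have tb : {b : hpair p (parr p n) | chain b} by exists 0; apply: chain0.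
have [||h' h'E] := @lfun_of_graph k {b : hpair p (parr p n) | chain b} X E
    (fun b => xi (sval b)) (fun b => kE (q0 (sval b))) tb.
- move=> c [a ac] [b bc]; exists (exist _ (c *: a + b) (chain_lin c ac bc)); split.
    by rewrite linearP.
  rewrite -linearP; congr (kE _); apply: hpairP => v.
    by rewrite /= !(add_lfunE, scale_lfunE, comp_lfunE) linearP.
  by rewrite /= !(add_lfunE, scale_lfunE, comp_lfunE) linearP.
- move=> [b bc] /= b0; apply/(rep_null rE); first exact: q0c.
  have [c [c1 c0 cd] ->] := phi_gen b (conj bc b0).
  exists (hR \o c.2)%VF; first exact: rlinear_comp.
  split=> v; rewrite /= !comp_lfunE.
    by rewrite -[phi.1]/f1 hRE; congr (hR _).
  by rewrite -[phi.2]/f0 s0.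
have h'E' b : chain b -> h' (xi b) = kE (q0 b) by move=> bc; apply: (h'E (exist _ b bc)).
exists h' => [a v|v].
  have [c cc <-] := endo_surj end_p a; have [b bc <-] := xi_surj v.
  rewrite -xi_act // !h'E' //; last exact: chain_comp.
  rewrite -(rep_act rE) //; last exact: q0c.
  by congr (kE _); apply: hpairP => u; rewrite /= !comp_lfunE.
have [b bc <-] := xi_surj v; rewrite alE // h'E' // GE; last exact: q0c.
by congr (kC (_, _)); apply: to_rzero.
Qed.

End Lifting.

(** * The connecting sequence does not split *)

Section NotSplit.
Variables (k : fieldType) (A B : falgType k) (p : arrow A).
Variables (beta : 'Hom(hpair p p, B)) (end_p : endomorphisms beta).
Hypotheses (proj1 : projective (asrc p)) (proj0 : projective (atgt p)).
Hypothesis rig : rigid p.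
Hypothesis generates : forall M, torsfree p M -> tors p M -> is_zero M.

Variables (Pi I : rmod A) (w : 'Hom(Pi, I)) (wl : rlinear w) (w0 : exists v, w v <> 0).
Hypothesis projPi : projective Pi.
Hypothesis I_inj : injective_rmod I.
Hypothesis I_cogen : forall (M : rmod A) (a : 'Hom(M, I)) v, rlinear a -> a v <> 0 ->
  exists2 f : 'Hom(Pi, M), rlinear f & exists x, a (f x) <> 0.
Hypothesis w_local : detects_split_epis w.

Let z : arrow A := Arrow wl.

(** If w did not vanish on the submodule of those x in P_i for which io(x) is a
    boundary, this submodule would be all of P_i.  Then every map from P_i to the
    degree 0 part of p would consist of boundaries and be killed by a0, and such
    maps would not detect a0.  By injectivity w now factors through io. *)
Lemma w_factors (a0 : 'Hom(atgt p, I)) (v0 : atgt p) :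
  rlinear a0 -> (forall v, a0 (amap p v) = 0) -> a0 v0 <> 0 ->
  exists n (io : 'Hom(Pi, rpow n (atgt p))) (ph : 'Hom(rpow n (atgt p), I)),
    [/\ rlinear io, rlinear ph, forall v, ph (amap (parr p n) v) = 0 &
        forall x, w x = ph (io x)].
Proof.
move=> a0l a0d a0v0.
have [||n [b [bl bgen]]] := @finite_family k 'Hom(Pi, atgt p) (@rlinear _ _ Pi (atgt p)).
- exact: rlinear0.
- by move=> c u v ul vl; apply: rlinearD => //; apply: rlinearZ.
have [io iol ioE] := pair_pow bl.
pose dn : 'Hom(rpow n (asrc p), rpow n (atgt p)) := amap (parr p n).
have dnl : rlinear dn := amap_rlinear (a := parr p n).
have [j jl jE] := copairing iol dnl.
have [||ph phl phE] := I_inj (j := j) (t := (w \o rfst _ _)%VF) jl.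
- by apply: rlinear_comp => //; apply: rlinear_fst.
- move=> x jx; rewrite comp_lfunE; apply: NNPP => wx.
  have [K [i [[il im] iK]]] := submodule_rmod (submodule_lker jl).
  have : x \in limg i by rewrite iK memv_ker jx.
  case/memv_imgP=> y _ xy; rewrite xy in wx.
  have [||s sl sE] := @w_local K (rfst _ _ \o i)%VF y; rewrite ?comp_lfunE //.
    by apply: rlinear_comp => //; apply: rlinear_fst.
  have [f fl [u]] := I_cogen a0l a0v0; apply.
  have [c ->] := bgen f fl.
  rewrite sum_lfunE linear_sum big1 // => r _.
  rewrite /= scale_lfunE linearZ /= -ioE.
  have /eqP : j (i (s u)) = 0.
    by apply/eqP; rewrite -memv_ker -iK memv_img ?memvf.
  have -> : j (i (s u)) = io u + dn (i (s u)).2.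
    by rewrite jE -[X in io X]rfstE -[rfst _ _ _]comp_lfunE sE.
  rewrite addr_eq0 => /eqP ->.
  by rewrite linearN /= parr_proj linearN /= a0d oppr0 scaler0.
exists n, io, ph; split=> // [v|x].
  have := phE (0, v); rewrite jE comp_lfunE rfstE /= !linear0 add0r; exact.
by have := phE (x, 0); rewrite jE comp_lfunE rfstE /= linear0 addr0 => <-.
Qed.

Variables (N E : rmod B) (kN : 'Hom(hpair p (deg0 I), N)) (kE : 'Hom(hpair p z, E)).
Hypotheses (rN : represents beta kN) (rE : represents beta kE).

(** Suppose rho retracts F.  Let zt : p^m -> w be such that all maps p -> w factor
    through it up to homotopy, and r0 : p^m -> I the map that corresponds to rho.
    Write w = ph io with io : P_i -> p^n as in [w_factors].  In degree 0, ph is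
    z0 k0 + w h for some k0 : p^n -> p^m and a homotopy h, and applying rho shows
    that ph = r0 k0.  It remains to see that r0 k0 io = 0, which gives w = 0.

    As w (1 - h io) = z0 k0 io, the pair (1 - h io, k0 io) is a map th from P_i to
    the pullback X of w and z0.  The degree -1 part of p^m maps to X by e, and the
    cokernel Y of e is torsion, hence a quotient of copies of H^0(p).  So
    th = e c' + Tm ep, where ep maps P_i to some p^l and Tm : p^l -> X is a chain
    map up to e.  Now r0 kills the boundaries that come from e c', and it kills
    the component of Tm in p^m because rho is B-linear. *)
Lemma connecting_not_split (F : 'Hom(N, E)) (n0 : N) :
  (forall a, chain a -> F (kN a) = kE (0, a.2)) ->
  n0 <> 0 -> ~ split_mono F.
Proof.
move=> FE n00 [rho rhol /lfunP rhoF].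
have [a0 a0c a0E] := rep_surj rN n0.
have [v0 a0v0] : exists v, a0.2 v <> 0.
  apply: NNPP => no; apply: n00; rewrite -a0E; apply/(rep_null rN) => //.
  by apply/null_deg0 => v; apply: NNPP => av; apply: no; exists v.
have [n [io [ph [iol phl phd phE]]]] : exists n (io : 'Hom(Pi, rpow n (atgt p)))
    (ph : 'Hom(rpow n (atgt p), I)),
    [/\ rlinear io, rlinear ph, forall v, ph (amap (parr p n) v) = 0 &
        forall x, w x = ph (io x)].
  apply: (@w_factors a0.2 v0) => //; first by case: a0c.
  by move=> v; apply: (chain_deg0_eq0 v a0c).
have [m [xi [xi_surj xi_act xi_null xi_real]]] := presentation end_p E.
have [zt ztc ztE] := xi_real _ _ _ (\1%VF) rE (@rlinear_id _ _ _).
have [rr rrc rrE] := xi_real _ _ _ rho rN rhol.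
have {}ztE b : chain b -> xi b = kE (hcomp zt b) by move=> bc; rewrite -ztE // id_lfunE.
pose dn : 'Hom(rpow n (asrc p), rpow n (atgt p)) := amap (parr p n).
pose dm : 'Hom(rpow m (asrc p), rpow m (atgt p)) := amap (parr p m).
pose z1 : 'Hom(rpow m (asrc p), Pi) := zt.1.
pose z0 : 'Hom(rpow m (atgt p), I) := zt.2.
pose r0 : 'Hom(rpow m (atgt p), I) := rr.2.
have [z1l z0l zd] : [/\ rlinear z1, rlinear z0 & forall v, w (z1 v) = z0 (dm v)] := ztc.
have r0l : rlinear r0 by case: rrc.
have r0d v : r0 (dm v) = 0 by exact: (@chain_deg0_eq0 _ _ I (parr p m) rr v rrc).
have dml : rlinear dm := amap_rlinear (a := parr p m).
have zt_gen (a : hpair p z) : chain a -> exists2 b : hpair p (parr p m), chain b &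
    exists2 h : 'Hom(atgt p, Pi), rlinear h &
      (forall v, a.1 v = z1 (b.1 v) + h (amap p v)) /\
      (forall v, a.2 v = z0 (b.2 v) + w (h v)).
  move=> ac; have [b bc bE] := xi_surj (kE a).
  rewrite ztE // in bE; have zbc := chain_comp ztc bc.
  have /(rep_eq rE ac zbc)[h hl [h1 h0]] := esym bE.
  exists b => //; exists h => //; split=> v.
    by rewrite -h1 /= add_lfunE opp_lfunE comp_lfunE addrC subrK.
  by rewrite -[w _]/(amap z (h v)) -h0 /= add_lfunE opp_lfunE comp_lfunE addrC subrK.
have rho_zt (b : hpair p (parr p m)) : chain b -> rho (kE (hcomp zt b)) = kN (hcomp rr b).
  by move=> bc; rewrite -ztE // rrE.
have [c [h [cc hl chE]]] : exists (c : hpair (parr p n) (parr p m))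
    (h : 'Hom(rpow n (atgt p), Pi)),
    [/\ chain c, rlinear h & forall v,
       ph v = z0 (c.2 v) + w (h v) /\ ph v = r0 (c.2 v)].
  have ex j : exists bh : hpair p (parr p m) * 'Hom(atgt p, Pi),
     [/\ chain bh.1, rlinear bh.2 &
        forall v, ph (rinj _ j v) = z0 (bh.1.2 v) + w (bh.2 v) /\
                  ph (rinj _ j v) = r0 (bh.1.2 v)].
    have phjl : rlinear (ph \o rinj _ j)%VF by apply: rlinear_comp => //; apply: rlinear_inj.
    have phjd v : (ph \o rinj _ j)%VF (amap p v) = 0.
      by rewrite comp_lfunE -parr_inj phd.
    pose aN : hpair p (deg0 I) := (0, (ph \o rinj _ j)%VF).
    pose a : hpair p z := (0, (ph \o rinj _ j)%VF).
    have aNc : chain aN by exact: chain_deg0.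
    have ac : chain a.
      by split=> // [|v]; [exact: rlinear0|rewrite phjd zero_lfunE linear0].
    have [b bc [h hl [h1 h0]]] := zt_gen a ac.
    exists (b, h); split=> //= v; split; first by rewrite -h0 comp_lfunE.
    have eqE : kE a = kE (hcomp zt b).
      apply/(rep_eq rE) => //; first exact: chain_comp.
      exists h => //; split=> u; rewrite /= !(add_lfunE, opp_lfunE, comp_lfunE).
        by have := h1 u; rewrite /= => ->; rewrite addrC addKr.
      by have := h0 u; rewrite /= comp_lfunE => ->; rewrite addrC addKr.
    have : kN aN = kN (hcomp rr b).
      by rewrite -rho_zt // -eqE -(FE _ aNc) -[LHS](id_lfunE (kN aN)) -rhoF comp_lfunE.
    move/(rep_eq rN aNc (chain_comp rrc bc))/null_deg0/(_ v).
    by rewrite /= !(add_lfunE, opp_lfunE, comp_lfunE) => /eqP; rewrite subr_eq0 => /eqP.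
  have [bh bhP] := choice_fun ex.
  have bc j : chain (bh j).1 by case: (bhP j).
  have [c cc [_ ci]] := copair_parr bc.
  have hjl j : rlinear (bh j).2 by case: (bhP j).
  have [h hl [_ hi]] := copair_pow hjl.
  have c2 j v : c.2 (rinj _ j v) = (bh j).1.2 v.
    by rewrite -ci /= comp_lfunE.
  have [_ c2l _] := cc.
  exists c, h; split=> // v.
  suff H (u : 'I_n -> atgt p) (s := \sum_j rinj _ j (u j)) :
      ph s = z0 (c.2 s) + w (h s) /\ ph s = r0 (c.2 s).
    by rewrite [v]rpow_decomp; apply: H.
  rewrite /s !linear_sum -big_split; split; apply: eq_bigr => j _ /=.
    by rewrite c2 hi; case: (bhP j) => _ _ /(_ (u j))[].
  by rewrite c2; case: (bhP j) => _ _ /(_ (u j))[].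
pose k0 : 'Hom(rpow n (atgt p), rpow m (atgt p)) := c.2.
have k0l : rlinear k0 by case: cc.
have ph1 v : ph v = z0 (k0 v) + w (h v) by case: (chE v).
have ph2 v : ph v = r0 (k0 v) by case: (chE v).
clearbody k0.
have [D Dl DE] := copairing wl (rlinearN z0l).
have [X [iX [iXm iXK]]] := submodule_rmod (submodule_lker Dl).
have iXl : rlinear iX by case: iXm.
have iXinj x y : iX x = iX y -> x = y.
  move=> xy; apply/eqP; rewrite -subr_eq0; apply/eqP.
  by have /monoE := iXm.2; apply; rewrite linearB /= xy subrr.
have Xw x : w (iX x).1 = z0 (iX x).2.
  have /eqP : D (iX x) = 0 by apply/eqP; rewrite -memv_ker -iXK memv_img ?memvf.
  by rewrite DE opp_lfunE subr_eq0 => /eqP.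
have toX (M : rmod A) (f1 : 'Hom(M, Pi)) (f2 : 'Hom(M, rpow m (atgt p))) :
    rlinear f1 -> rlinear f2 -> (forall v, w (f1 v) = z0 (f2 v)) ->
    exists2 f : 'Hom(M, X), rlinear f & forall v, iX (f v) = (f1 v, f2 v).
  move=> f1l f2l fw; have [f fl fE] := pairing f1l f2l.
  have [v|f' f'l f'E] := mono_lift iXm fl; last by exists f' => // v; rewrite -f'E fE.
  by rewrite iXK memv_ker fE DE opp_lfunE /= fw subrr.
have [e el eE] := toX _ _ _ z1l dml zd.
have [Y [q [[ql qf] qK]]] := quotient_rmod (submodule_limg el).
have qonto : forall y, exists x, q x = y by apply/epiE.
have qker x : q x = 0 <-> exists y, e y = x.
  split=> [/eqP|[y <-]].
    by rewrite -memv_ker qK => /memv_imgP[y _ ->]; exists y.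
  by apply/eqP; rewrite -memv_ker qK memv_img ?memvf.
have [|||th thl thE] := toX _ (\1 - (h \o io))%VF (k0 \o io)%VF.
- by apply: rlinearB; [apply: rlinear_id|apply: rlinear_comp].
- exact: rlinear_comp.
- move=> v; rewrite add_lfunE opp_lfunE id_lfunE !comp_lfunE linearB /=.
  by rewrite phE ph1 addrK.
(* A map p -> Y[1] lifts to X[1].  By rigidity its component in p^m[1] may be
   taken of the form v' d; then it is a chain map p -> w, which factors through
   zt up to homotopy. *)
have tY : tors p Y.
  move=> y yl; have [x' x'l x'E] := projective_lift proj1 ql yl (fun v => qonto (y v)).
  pose a : 'Hom(asrc p, Pi) := (rfst _ _ \o (iX \o x'))%VF.
  pose s : 'Hom(asrc p, rpow m (atgt p)) := (rsnd _ _ \o (iX \o x'))%VF.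
  have al : rlinear a by apply: rlinear_comp (@rlinear_fst _ _ _ _) (rlinear_comp iXl x'l).
  have sl : rlinear s by apply: rlinear_comp (@rlinear_snd _ _ _ _) (rlinear_comp iXl x'l).
  have xE v : iX (x' v) = (a v, s v).
    by rewrite !comp_lfunE rfstE rsndE -surjective_pairing.
  clearbody a s.
  have [u ul [v' v'l]] := rigid_parr rig sl; rewrite -/dm => uvE.
  pose az : hpair p z := ((a - (z1 \o u))%VF, (z0 \o v')%VF).
  have azc : chain az.
    split=> [||v]; [by apply: rlinearB => //; apply: rlinear_comp|exact: rlinear_comp|].
    rewrite /= add_lfunE opp_lfunE !comp_lfunE linearB /= zd.
    have := Xw (x' v); rewrite xE /= => ->.
    by rewrite uvE linearD /= addrC addKr.
  have [b [b1l b0l bd] [h' h'l [h1 h0]]] := zt_gen az azc.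
  pose b1 : 'Hom(asrc p, rpow m (asrc p)) := b.1.
  pose b0 : 'Hom(atgt p, rpow m (atgt p)) := b.2.
  have [|||g gl gE] := toX _ h' (v' - b0)%VF => //.
  - exact: (rlinearB v'l b0l).
  - move=> v; rewrite add_lfunE opp_lfunE linearB /=.
    by have := h0 v; rewrite /= comp_lfunE => ->; rewrite addrC addKr.
  exists (q \o g)%VF => [|v]; first exact: rlinear_comp.
  rewrite comp_lfunE -x'E; apply/eqP; rewrite -subr_eq0 -linearB /=; apply/eqP/qker.
  exists (u v + b1 v); apply: iXinj; rewrite linearB /= xE gE eE !linearD /=.
  have bd' : dm (b1 v) = b0 (amap p v) := bd v.
  congr (_, _) => /=.
    have := h1 v; rewrite /= add_lfunE opp_lfunE comp_lfunE => /eqP.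
    rewrite subr_eq => /eqP ->; rewrite [in RHS]addrAC addrK [RHS]addrC.
    by [].
  rewrite uvE add_lfunE opp_lfunE bd' opprB.
  by rewrite -addrA; congr (_ + _); rewrite addrC subrK.
have [l [tau [[taul taud _] tau_onto]]] := tors_generated proj1 proj0 rig generates tY.
pose dl : 'Hom(rpow l (asrc p), rpow l (atgt p)) := amap (parr p l).
have dll : rlinear dl := amap_rlinear (a := parr p l).
have [|ep epl epE] := projective_lift (f := (q \o th)%VF) projPi taul _ (fun v => tau_onto _).
  exact: rlinear_comp.
have [Tm Tml TmE] := projective_lift (projective_rpow proj0) ql taul (fun v => qonto _).
have [||eb ebl ebE] := projective_lift (f := (Tm \o dl)%VF) (projective_rpow proj1) el.
- exact: rlinear_comp.
- by move=> v; apply/qker; rewrite comp_lfunE TmE taud.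
have [||c' c'l c'E] := projective_lift (f := (th - (Tm \o ep))%VF) projPi el.
- by apply: rlinearB => //; apply: rlinear_comp.
- move=> v; apply/qker; rewrite add_lfunE opp_lfunE comp_lfunE linearB /= TmE epE.
  by rewrite comp_lfunE subrr.
(* Up to homotopy, the components of Tm in p^m are relations between those of
   zt, and rho turns them into relations between those of r0. *)
have r0y v : r0 (iX (Tm v)).2 = 0.
  suff H j u : r0 (iX (Tm (rinj _ j u))).2 = 0.
    rewrite [v]rpow_decomp -rsndE -!comp_lfunE linear_sum big1 // => j _.
    by have := H j (rproj _ j v); rewrite -rsndE /= !comp_lfunE.
  pose b1 : 'Hom(asrc p, rpow m (asrc p)) := (eb \o rinj _ j)%VF.
  pose b0 : 'Hom(atgt p, rpow m (atgt p)) := (rsnd _ _ \o (iX \o (Tm \o rinj _ j)))%VF.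
  pose x0 : 'Hom(atgt p, Pi) := (rfst _ _ \o (iX \o (Tm \o rinj _ j)))%VF.
  have Tjl : rlinear (iX \o (Tm \o rinj _ j))%VF.
    by apply: rlinear_comp => //; apply: rlinear_comp => //; apply: rlinear_inj.
  have x0l : rlinear x0 by apply: rlinear_comp (@rlinear_fst _ _ _ _) Tjl.
  have b0l : rlinear b0 by apply: rlinear_comp (@rlinear_snd _ _ _ _) Tjl.
  have b1l : rlinear b1 by apply: rlinear_comp => //; apply: rlinear_inj.
  have bE t : (z1 (b1 t), dm (b1 t)) = (x0 (amap p t), b0 (amap p t)).
    rewrite -eE comp_lfunE ebE comp_lfunE /dl parr_inj.
    by rewrite !comp_lfunE rfstE rsndE -surjective_pairing.
  have b0E t : b0 t = (iX (Tm (rinj _ j t))).2 by rewrite !comp_lfunE rsndE.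
  have x0E t : x0 t = (iX (Tm (rinj _ j t))).1 by rewrite !comp_lfunE rfstE.
  clearbody b1 b0 x0.
  pose b : hpair p (parr p m) := (b1, b0).
  have bc : chain b by split=> // t; case: (bE t).
  have : kN (hcomp rr b) = 0.
    rewrite -rho_zt // (_ : kE _ = 0) ?linear0 //.
    apply/(rep_null rE); first exact: chain_comp.
    exists x0 => //; split=> t; rewrite /= comp_lfunE; first by case: (bE t).
    by rewrite -[zt.2]/z0 b0E x0E Xw.
  move/(rep_null rN (chain_comp rrc bc))/null_deg0/(_ u).
  by rewrite /= comp_lfunE b0E.
have [v1] := w0; apply.
rewrite phE ph2; have -> : k0 (io v1) = dm (c' v1) + (iX (Tm (ep v1))).2.
  have := eE (c' v1); rewrite c'E add_lfunE opp_lfunE comp_lfunE linearB /= thE.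
  move/(congr1 snd) => /= /eqP; rewrite comp_lfunE subr_eq => /eqP ->; by [].
by rewrite linearD /= r0d r0y addr0.
Qed.

End NotSplit.

(** * Uniqueness of the middle term of an almost split sequence *)

Section Comparison.
Variables (k : fieldType) (B : falgType k).
Implicit Types L M N E C : rmod B.

(** If neither e nor 1 - e is a split epimorphism, both factor through g, and so
    does their sum 1. *)
Lemma ass_idempotent E C (g : 'Hom(E, C)) (e : 'End(C)) :
  right_almost_split g -> rlinear e -> (forall x, e (e x) = e x) ->
  (forall x, e x = x) \/ (forall x, e x = 0).
Proof.
move=> [gl nsplit lift] el ee.
have split_surj (h : 'End(C)) : split_epi h -> forall y, exists x, h x = y.
  by move=> [s _ /lfunP hs] y; exists (s y); rewrite -comp_lfunE hs id_lfunE.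
have [/split_surj onto|n1] := classic (split_epi e).
  by left=> y; have [x <-] := onto y.
have el' : rlinear (\1 - e)%VF by apply: rlinearB => //; apply: rlinear_id.
have [/split_surj onto|n2] := classic (split_epi (\1 - e)%VF).
  right=> y; have [x <-] := onto y.
  by rewrite add_lfunE opp_lfunE id_lfunE linearB /= ee subrr.
have [a al aE] := lift C e el n1; have [b bl bE] := lift C _ el' n2.
case: nsplit; exists (a + b)%VF; first exact: rlinearD.
by rewrite comp_lfunDr -aE -bE addrC subrK.
Qed.

(** F extends along f to a : E -> E', inducing c : C -> C'.  If c is not a split
    epimorphism, it lifts to E', and correcting a by the lift yields a retraction
    of f.  So c is a split epimorphism, and as C has only trivial idempotents it
    is an isomorphism or zero; in the second case F would be an isomorphism. *)
Lemma ass_unique N E C E' C' (f : 'Hom(N, E)) (g : 'Hom(E, C))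
    (F : 'Hom(N, E')) (G : 'Hom(E', C')) :
  almost_split_sequence f g -> short_exact F G -> ~ split_mono F ->
  (forall (X : rmod B) (h : 'Hom(X, C')), rlinear h -> ~ split_epi h ->
     exists2 h' : 'Hom(X, E'), rlinear h' & forall x, h x = G (h' x)) ->
  exists t : 'Hom(E, E'), riso t.
Proof.
move=> [[[fl f0] [gl gf] fg] [_ nsf lift_f] ras] [[Fl F0] [Gl Gf] FG] nsF lift_G.
have [_ nsg _] := ras.
have finj := lker_eq0 f0; have Finj := lker_eq0 F0.
have [a al aE] := lift_f E' F Fl nsF.
have {}aE x : a (f x) = F x by rewrite aE comp_lfunE.
have GF x : G (F x) = 0 by apply/eqP; rewrite -memv_ker -FG memv_img ?memvf.
have gker x : g x = 0 -> exists y, x = f y.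
  by move/eqP; rewrite -memv_ker -fg => /memv_imgP[y _ ->]; exists y.
have gfun x : g (f x) = 0 by apply/eqP; rewrite -memv_ker -fg memv_img ?memvf.
have Gker x : G x = 0 -> exists y, x = F y.
  by move/eqP; rewrite -memv_ker -FG => /memv_imgP[y _ ->]; exists y.
have [||c cl cE] := @epi_desc _ _ C' E C g (G \o a)%VF (conj gl gf).
- exact: rlinear_comp.
- by move=> x /gker[y ->]; rewrite comp_lfunE aE GF.
have {}cE x : G (a x) = c (g x) by rewrite -cE comp_lfunE.
have [[s sl /lfunP cs]|nsc] := classic (split_epi c); last first.
  have [c' c'l c'E] := lift_G C c cl nsc.
  have [||r rl rE] := @mono_lift _ _ E N E' F (a - (c' \o g))%VF (conj Fl F0).
  - by apply: rlinearB => //; apply: rlinear_comp.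
  - move=> x; rewrite FG memv_ker add_lfunE opp_lfunE comp_lfunE linearB /=.
    by rewrite cE c'E subrr.
  case: nsf; exists r => //; apply/lfunP=> x; rewrite comp_lfunE id_lfunE.
  apply: Finj; rewrite -rE add_lfunE opp_lfunE comp_lfunE gfun linear0 subr0.
  exact: aE.
have {}cs y : c (s y) = y by have := cs y; rewrite comp_lfunE id_lfunE.
have [|x|sc|sc] := @ass_idempotent _ _ g (s \o c)%VF ras.
- exact: rlinear_comp.
- by rewrite !comp_lfunE cs.
- have {}sc x : s (c x) = x by rewrite -comp_lfunE sc.
  have gonto : forall y, exists x, g x = y by apply/epiE.
  exists a; split; split=> //.
    apply/monoE => x ax; have [y xy] : exists y, x = f y.
      by apply: gker; rewrite -[g x]sc -cE ax !linear0.
    move: ax; rewrite xy aE -[0](linear0 F) => /Finj ->; by rewrite linear0.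
  apply/epiE => y; have [x gx] := gonto (s (G y)).
  have [n yn] : exists n, y - a x = F n by apply: Gker; rewrite linearB /= cE gx cs subrr.
  by exists (x + f n); rewrite linearD /= aE -yn addrC subrK.
have G0 x : G x = 0.
  by have := sc (s (G x)); rewrite comp_lfunE cs => sG; rewrite -(cs (G x)) sG linear0.
case: nsF; have [||r rl rE] := @mono_lift _ _ E' N E' F \1%VF (conj Fl F0).
- exact: rlinear_id.
- by move=> x; rewrite id_lfunE FG memv_ker G0.
exists r => //; apply/lfunP=> x; rewrite comp_lfunE id_lfunE; apply: Finj.
by rewrite -rE id_lfunE.
Qed.

Lemma short_exact_riso L M E E' (t : 'Hom(E, E')) (u : 'Hom(L, E')) (v : 'Hom(E', M)) :
  riso t -> short_exact u v ->
  exists (u' : 'Hom(L, E)) (v' : 'Hom(E, M)), short_exact u' v'.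
Proof.
move=> tiso [[ul u0] [vl vf] uv]; have [t' t'iso [t't tt']] := riso_inverse tiso.
have [[tl _] [_ tf]] := tiso; have [[t'l _] _] := t'iso.
have uinj := lker_eq0 u0; have vonto : forall y, exists x, v x = y by apply/epiE.
exists (t' \o u)%VF, (v \o t)%VF; split; first 1 last.
- split; first exact: rlinear_comp.
  apply/epiE => y; have [x <-] := vonto y; exists (t' x).
  by rewrite comp_lfunE tt'.
- apply/vspaceP=> x; rewrite memv_ker comp_lfunE -memv_ker -uv.
  apply/memv_imgP/memv_imgP=> [[y _ ->]|[y _ xy]]; exists y; rewrite ?memvf //.
    by rewrite comp_lfunE tt'.
  by rewrite comp_lfunE -xy t't.
split; first exact: rlinear_comp.
apply/monoE=> x; rewrite comp_lfunE => /(congr1 t); rewrite tt' linear0.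
by rewrite -[0](linear0 u) => /uinj.
Qed.
End Comparison.

(** * Homotopies, and two-term complexes of projectives *)

Section Homotopy.
Variables (k : fieldType) (A : falgType k).
Implicit Types X Y Z : cplx A.

Lemma cfun_cd X Y (f : cmap X Y) i x : cd Y i (f i x) = f (nxt i) (cd X i x).
Proof. by rewrite -!comp_lfunE cfun_comm. Qed.

(** Pointwise equal maps of complexes may carry different proofs, so they are
    compared up to homotopy. *)
Lemma htp_eq X Y (f g : cmap X Y) : (forall i v, f i v = g i v) -> homotopic f g.
Proof.
move=> fg; exists (fun i => 0) => i; first exact: rlinear0.
apply/lfunP=> v; rewrite !(add_lfunE, opp_lfunE, comp_lfunE) fg subrr.
by rewrite !zero_lfunE linear0 addr0.
Qed.
Lemma htp_refl X Y (f : cmap X Y) : homotopic f f.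
Proof. exact: htp_eq. Qed.
Lemma htp_sym X Y (f g : cmap X Y) : homotopic f g -> homotopic g f.
Proof.
move=> [h hl hE]; exists (fun i => - h i) => i; first exact: rlinearN.
rewrite -opprB hE; apply/lfunP=> v.
by rewrite !(add_lfunE, opp_lfunE, comp_lfunE) linearN opprD.
Qed.
Lemma htp_trans X Y (f g e : cmap X Y) : homotopic f g -> homotopic g e -> homotopic f e.
Proof.
move=> [h hl hE] [h' hl' hE']; exists (fun i => h i + h' i) => i; first exact: rlinearD.
have -> : f (nxt i) - e (nxt i) = (f (nxt i) - g (nxt i)) + (g (nxt i) - e (nxt i)).
  by rewrite addrA subrK.
rewrite hE hE'; apply/lfunP=> v.
by rewrite !(add_lfunE, opp_lfunE, comp_lfunE) linearD addrACA.
Qed.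
Lemma htp_compr X Y Z (f g : cmap Y Z) (e : cmap X Y) :
  homotopic f g -> homotopic (ccomp f e) (ccomp g e).
Proof.
move=> [h hl hE]; exists (fun i => h i \o e (nxt i))%VF => i.
  by apply: rlinear_comp => //; apply: cfun_rlinear.
apply/lfunP=> v; have /lfunP/(_ (e (nxt i) v)) := hE i.
by rewrite /= !(add_lfunE, opp_lfunE, comp_lfunE) cfun_cd.
Qed.
Lemma htp_compl X Y Z (f g : cmap X Y) (e : cmap Y Z) :
  homotopic f g -> homotopic (ccomp e f) (ccomp e g).
Proof.
move=> [h hl hE]; exists (fun i => e i \o h i)%VF => i.
  by apply: rlinear_comp => //; apply: cfun_rlinear.
apply/lfunP=> v; have /lfunP/(_ v) := hE i.
rewrite /= !(add_lfunE, opp_lfunE, comp_lfunE) cfun_cd -linearD => <-.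
by rewrite linearB.
Qed.
Lemma htp_assoc X Y Z T (f : cmap Z T) (g : cmap Y Z) (h : cmap X Y) :
  homotopic (ccomp f (ccomp g h)) (ccomp (ccomp f g) h).
Proof. by apply: htp_eq => i v; rewrite /= !comp_lfunE. Qed.
Lemma htp_assoc' X Y Z T (f : cmap Z T) (g : cmap Y Z) (h : cmap X Y) :
  homotopic (ccomp (ccomp f g) h) (ccomp f (ccomp g h)).
Proof. exact/htp_sym/htp_assoc. Qed.
Lemma htp_idl X Y (f : cmap X Y) : homotopic (ccomp (cid Y) f) f.
Proof. by apply: htp_eq => i v; rewrite /= comp_lfunE id_lfunE. Qed.
Lemma htp_idr X Y (f : cmap X Y) : homotopic (ccomp f (cid X)) f.
Proof. by apply: htp_eq => i v; rewrite /= comp_lfunE id_lfunE. Qed.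

Lemma quasi_iso_htp X Y (f g : cmap X Y) : homotopic f g -> quasi_iso f -> quasi_iso g.
Proof.
move=> [h hl hE] qf i; have [inj surj] := qf i.
have fg x : cd X (nxt i) x = 0 -> f (nxt i) x = g (nxt i) x + cd Y i (h i x).
  move=> dx; have /lfunP/(_ x) := hE i.
  rewrite !(add_lfunE, opp_lfunE, comp_lfunE) dx linear0 addr0 => /eqP.
  by rewrite subr_eq addrC => /eqP.
split=> [x dx [y gx]|y dy].
  by apply: inj => //; exists (y + h i x); rewrite fg // gx linearD.
have [x dx [y' yx]] := surj y dy; exists x => //; exists (y' + h i x).
by rewrite linearD /= -yx fg // opprD addrA subrK.
Qed.

Lemma quasi_iso_comp X Y Z (g : cmap Y Z) (f : cmap X Y) :
  quasi_iso g -> quasi_iso f -> quasi_iso (ccomp g f).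
Proof.
move=> qg qf i; have [injg surjg] := qg i; have [injf surjf] := qf i.
split=> [x dx [z]|z dz].
  rewrite /= comp_lfunE => gfx; apply: injf => //; apply: injg; last by exists z.
  by rewrite cfun_cd dx linear0.
have [y dy [z' zy]] := surjg z dz; have [x dx [y' yx]] := surjf y dy.
exists x => //; exists (z' + g i y'); rewrite linearD /= cfun_cd -zy -yx.
by rewrite comp_lfunE linearB addrA subrK.
Qed.
End Homotopy.

Notation m1 := (Negz 0).
Notation m2 := (Negz 1).

(** The degree 0 is written [nxt m1], so that the differential
    [cd X m1] has exactly the right type. *)
Definition arrow_of (k : fieldType) (A : falgType k) (X : cplx A) : arrow A :=
  Arrow (@cd_rlinear k A X m1).

Section TwoTerm.
Variables (k : fieldType) (A : falgType k).
Implicit Types X Y Z : cplx A.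

Lemma from_zero (M : rmod A) (V : vectType k) (f g : 'Hom(M, V)) : is_zero M -> f = g.
Proof. by move=> M0; apply/lfunP=> v; rewrite (M0 v) !linear0. Qed.

Definition cpair X Y (f : cmap X Y) : hpair (arrow_of X) (arrow_of Y) := (f m1, f (nxt m1)).

Lemma cpair_chain X Y (f : cmap X Y) : chain (cpair f).
Proof.
split=> [||v]; [exact: cfun_rlinear|exact: cfun_rlinear|exact: cfun_cd].
Qed.
Lemma cpair_comp X Y Z (f : cmap Y Z) (g : cmap X Y) : cpair (ccomp f g) = hcomp (cpair f) (cpair g).
Proof. by []. Qed.
Lemma cpair_lin X Y c (f g : cmap X Y) : cpair (clin c f g) = c *: cpair f + cpair g.
Proof. by []. Qed.

Variable P : cplx A.
Hypothesis P_two_term : forall i : int, i <> -1 -> i <> 0 -> is_zero (P i).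

Lemma two_term_pos n : is_zero (P (nxt (Posz n))).
Proof. by apply: P_two_term => //; rewrite /nxt addrC. Qed.
Lemma two_term_neg n : is_zero (P (Negz n.+1)).
Proof. by apply: P_two_term. Qed.
Lemma two_term_neg' n : is_zero (P (nxt (Negz n.+2))).
Proof. exact: two_term_neg. Qed.

Lemma cmap_of_pair X (a : hpair (arrow_of P) (arrow_of X)) :
  chain a -> (forall v, cd X (nxt m1) (a.2 v) = 0) -> exists f : cmap P X, cpair f = a.
Proof.
case: a => [a1 a0] [/= a1l a0l ad] a0d.
pose f i : 'Hom(P i, X i) :=
  match i return 'Hom(P i, X i) with Posz 0 => a0 | Negz 0 => a1 | _ => 0 end.
have fl i : rlinear (f i).
  by case: i => [[|n]|[|n]] //=; apply: rlinear0.
have fc i : (cd X i \o f i)%VF = (f (nxt i) \o cd P i)%VF.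
  case: i => [[|n]|[|n]].
  - apply/lfunP=> v; rewrite !comp_lfunE (@two_term_pos 0 (cd P 0 v)) linear0; exact: a0d.
  - apply: from_zero; rewrite (_ : Posz n.+1 = nxt (Posz n)); first exact: two_term_pos.
    by rewrite /nxt -addn1 PoszD.
  - by apply/lfunP=> v; rewrite !comp_lfunE; apply: ad.
  - by apply: from_zero; apply: two_term_neg.
by exists (CMap fl fc).
Qed.

Lemma homotopic_of_pair X (f g : cmap P X)
    (h0 : 'Hom(P (nxt m1), X m1)) (h1 : 'Hom(P m1, X m2)) :
  rlinear h0 -> rlinear h1 ->
  (forall v, f (nxt m1) v - g (nxt m1) v = cd X m1 (h0 v)) ->
  (forall v, f m1 v - g m1 v = cd X m2 (h1 v) + h0 (cd P m1 v)) ->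
  homotopic f g.
Proof.
move=> h0l h1l E0 E1.
pose h i : 'Hom(P (nxt i), X i) :=
  match i return 'Hom(P (nxt i), X i) with Negz 0 => h0 | Negz 1 => h1 | _ => 0 end.
exists h.
  by case=> [n|[|[|n]]] //=; apply: rlinear0.
case=> [n|[|[|n]]].
- exact/from_zero/two_term_pos.
- apply/lfunP=> v; rewrite !(add_lfunE, opp_lfunE, comp_lfunE).
  rewrite (@two_term_pos 0 (cd P (nxt m1) v)) linear0 addr0; exact: E0.
- apply/lfunP=> v; rewrite !(add_lfunE, opp_lfunE, comp_lfunE); exact: E1.
exact/from_zero/two_term_neg'.
Qed.

Lemma pair_of_homotopic X (f g : cmap P X) : homotopic f g ->
  exists (h0 : 'Hom(P (nxt m1), X m1)) (h1 : 'Hom(P m1, X m2)),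
  [/\ rlinear h0, rlinear h1,
  (forall v, f (nxt m1) v - g (nxt m1) v = cd X m1 (h0 v)) &
  (forall v, f m1 v - g m1 v = cd X m2 (h1 v) + h0 (cd P m1 v))].
Proof.
move=> [h hl hE]; exists (h m1), (h m2); split.
- exact: (hl m1).
- exact: (hl m2).
- move=> v; have /lfunP/(_ v) := hE m1; rewrite !(add_lfunE, opp_lfunE, comp_lfunE).
  by rewrite (@two_term_pos 0 (cd P (nxt m1) v)) linear0 addr0.
move=> v; have /lfunP/(_ v) := hE m2; rewrite !(add_lfunE, opp_lfunE, comp_lfunE).
exact.
Qed.

Lemma homotopic_null X (f g : cmap P X) : is_zero (X m2) ->
  homotopic f g <-> null (cpair f - cpair g).
Proof.
move=> X2; split=> [/pair_of_homotopic[h0 [h1 [h0l h1l E0 E1]]]|[h hl [h1 h0]]].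
  exists h0 => //; split=> v; rewrite /= add_lfunE opp_lfunE ?E0 // E1.
  by rewrite (X2 (h1 v)) linear0 add0r.
apply: (@homotopic_of_pair X f g h 0) => //; first exact: rlinear0.
  by move=> v; have := h0 v; rewrite /= add_lfunE opp_lfunE.
by move=> v; have := h1 v; rewrite /= add_lfunE opp_lfunE zero_lfunE linear0 add0r.
Qed.

Hypotheses (proj1 : projective (P m1)) (proj0 : projective (P (nxt m1))).

Lemma quasi_iso_m1 Y Z (u : cmap Z Y) : quasi_iso u ->
    (forall x : Z m1, cd Z m1 x = 0 ->
       (exists y : Y m2, u m1 x = cd Y m2 y) -> exists x' : Z m2, x = cd Z m2 x') /\
    (forall y : Y m1, cd Y m1 y = 0 ->
       exists2 x : Z m1, cd Z m1 x = 0 & exists y' : Y m2, y - u m1 x = cd Y m2 y').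
Proof. by move=> qu; apply: (qu m2). Qed.

(** Write the difference of f and g as e and a null-homotopy of u e as H.
    The components k0 and k1 of a null-homotopy of e are found in this order, by
    lifting along surjections from P^0 and P^-1.  To make the second step
    possible, k0 has to be compatible with H up to a boundary l0. *)
Lemma quasi_iso_cancel Y Z (u : cmap Z Y) (f g : cmap P Z) :
  quasi_iso u -> homotopic (ccomp u f) (ccomp u g) -> homotopic f g.
Proof.
move=> qu /pair_of_homotopic[H0 [H1 [H0l H1l E0 E1]]].
have [inj0 surj0] := qu m1; have [inj1 surj1] := quasi_iso_m1 qu.
pose e1 := f m1 - g m1; pose e0 := f (nxt m1) - g (nxt m1).
have e1l : rlinear e1 by apply: rlinearB; apply: cfun_rlinear.
have e0l : rlinear e0 by apply: rlinearB; apply: cfun_rlinear.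
have ed v : cd Z m1 (e1 v) = e0 (cd P m1 v).
  by rewrite !add_lfunE !opp_lfunE linearB /= !cfun_cd.
have e0d v : cd Z (nxt m1) (e0 v) = 0.
  rewrite add_lfunE opp_lfunE linearB /= !cfun_cd (@two_term_pos 0 (cd P (nxt m1) v)).
  by rewrite !linear0 ?addr0.
have {}E0 v : u (nxt m1) (e0 v) = cd Y m1 (H0 v).
  by rewrite -E0 add_lfunE opp_lfunE linearB /= !comp_lfunE.
have {}E1 v : u m1 (e1 v) = cd Y m2 (H1 v) + H0 (cd P m1 v).
  by rewrite -E1 add_lfunE opp_lfunE linearB /= !comp_lfunE.
have [t1 t1l t1E] := copairing (M := Z m1) (N := Y m2) (@cd_rlinear _ _ Z m1)
  (@rlinear0 _ _ (Y m2) (Z (nxt m1))).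
have [t2 t2l t2E] := copairing (M := Z m1) (N := Y m2) (@cfun_rlinear _ _ _ _ u m1)
  (rlinearN (@cd_rlinear _ _ Y m2)).
have [t tl tE] := pairing t1l t2l.
have [el ell elE] := pairing e0l H0l.
have [|kl kll klE] := projective_lift proj0 tl ell.
  move=> v; have [z dz] : exists z, e0 v = cd Z m1 z.
    by apply: inj0; [exact: e0d|exists (H0 v)].
  have [|x dx [y yE]] := surj1 (u m1 z - H0 v).
    by rewrite linearB /= cfun_cd -dz E0 subrr.
  exists (z - x, y); rewrite tE elE t1E t2E /= zero_lfunE addr0 linearB /= dx subr0 -dz.
  congr (_, _); rewrite linearB /= opp_lfunE.
  have -> : cd Y m2 y = u m1 z - H0 v - u m1 x by rewrite -yE.
  by rewrite !opprB addrA subrK addrC subrK.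
pose k0 : 'Hom(P (nxt m1), Z m1) := (rfst _ _ \o kl)%VF.
pose l0 : 'Hom(P (nxt m1), Y m2) := (rsnd _ _ \o kl)%VF.
have k0l : rlinear k0 by apply: rlinear_comp => //; apply: rlinear_fst.
have k0E v : cd Z m1 (k0 v) = e0 v /\ u m1 (k0 v) = H0 v + cd Y m2 (l0 v).
  have := klE v; rewrite tE elE t1E t2E zero_lfunE addr0 opp_lfunE !comp_lfunE rfstE rsndE.
  by case=> -> /eqP; rewrite subr_eq => /eqP.
have [||k1 k1l k1E] := projective_lift (f := (e1 - (k0 \o cd P m1))%VF) proj1
    (@cd_rlinear _ _ Z m2 : rlinear (cd Z m2 : 'Hom(Z m2, Z m1))).
- by apply: rlinearB => //; apply: rlinear_comp => //; apply: cd_rlinear.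
- move=> v; rewrite add_lfunE opp_lfunE comp_lfunE.
  have [||x xE] := inj1 (e1 v - k0 (cd P m1 v)); last by exists x.
    by rewrite linearB /= ed (k0E _).1 subrr.
  exists (H1 v - l0 (cd P m1 v)).
  by rewrite !linearB /= E1 (k0E _).2 opprD addrA addrK.
apply: (@homotopic_of_pair Z f g k0 k1) => // v.
  by rewrite (k0E v).1 add_lfunE opp_lfunE.
have := k1E v; rewrite !add_lfunE !opp_lfunE comp_lfunE => ->.
by rewrite subrK.
Qed.

(** The components are lifted from P^0 and then from P^-1; y0 is the homotopy
    between u s and the identity. *)
Lemma quasi_iso_section Z (u : cmap Z P) : quasi_iso u ->
  exists s : cmap P Z, homotopic (ccomp u s) (cid P).
Proof.
move=> qu; have [inj0 surj0] := qu m1; have [inj1 surj1] := quasi_iso_m1 qu.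
have [t1 t1l t1E] := copairing (M := Z (nxt m1)) (N := P m1) (@cd_rlinear _ _ Z (nxt m1))
  (@rlinear0 _ _ (P m1) (Z (nxt (nxt m1)))).
have [t2 t2l t2E] := copairing (M := Z (nxt m1)) (N := P m1) (@cfun_rlinear _ _ _ _ u (nxt m1))
  (@cd_rlinear _ _ P m1).
have [t tl tE] := pairing t1l t2l.
have [el ell elE] := pairing (@rlinear0 _ _ (P (nxt m1)) (Z (nxt (nxt m1)))) (@rlinear_id _ _ (P (nxt m1))).
have [|kl kll klE] := projective_lift proj0 tl ell.
  move=> v; have [|x dx [y yE]] := surj0 v; first exact: (@two_term_pos 0).
  exists (x, y); rewrite tE elE t1E t2E /= !zero_lfunE id_lfunE dx addr0.
  by rewrite -yE addrC subrK.
pose s0 : 'Hom(P (nxt m1), Z (nxt m1)) := (rfst _ _ \o kl)%VF.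
pose y0 : 'Hom(P (nxt m1), P m1) := (rsnd _ _ \o kl)%VF.
have s0l : rlinear s0 by apply: rlinear_comp => //; apply: rlinear_fst.
have y0l : rlinear y0 by apply: rlinear_comp => //; apply: rlinear_snd.
have s0E v : cd Z (nxt m1) (s0 v) = 0 /\ u (nxt m1) (s0 v) + cd P m1 (y0 v) = v.
  have := klE v; rewrite tE elE t1E t2E !zero_lfunE addr0 id_lfunE !comp_lfunE rfstE rsndE.
  by case=> -> ->.
clearbody s0 y0.
have [t' t'l t'E] := pairing (@cd_rlinear _ _ Z m1) (@cfun_rlinear _ _ _ _ u m1).
have y0dl : rlinear (\1 - (y0 \o cd P m1))%VF.
  by apply: rlinearB; [apply: rlinear_id|apply: rlinear_comp => //; apply: cd_rlinear].
have [e' e'l e'E] := pairing (rlinear_comp s0l (@cd_rlinear _ _ P m1)) y0dl.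
have [|s1 s1l s1E] := projective_lift proj1 t'l e'l.
  move=> v; rewrite e'E; pose w := v - y0 (cd P m1 v).
  have dw : cd P m1 w = u (nxt m1) (s0 (cd P m1 v)).
    by rewrite linearB /= -{1}(s0E (cd P m1 v)).2 addrK.
  have [||z dz] := inj0 (s0 (cd P m1 v)).
  - exact: (s0E _).1.
  - by exists w.
  have [|x dx [y yE]] := surj1 (u m1 z - w).
    by rewrite linearB /= cfun_cd -dz dw subrr.
  exists (z - x); rewrite t'E linearB /= dx subr0 -dz comp_lfunE; congr (_, _).
  rewrite add_lfunE opp_lfunE id_lfunE comp_lfunE -/w linearB /=.
  move: yE; rewrite (@two_term_neg 0 y) linear0 => /eqP; rewrite subr_eq0 => /eqP <-.
  by rewrite opprB addrC subrK.
have [||s sE] := @cmap_of_pair Z (s1, s0).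
- split=> // v; have := s1E v; rewrite t'E e'E !comp_lfunE; by case.
- by move=> v; case: (s0E v).
have [s1E' s0E'] : s m1 = s1 /\ s (nxt m1) = s0 by case: sE.
exists s; apply: (@homotopic_of_pair P (ccomp u s) (cid P) (- y0) 0).
- exact: rlinearN.
- exact: rlinear0.
- move=> v; rewrite /= comp_lfunE s0E' id_lfunE opp_lfunE linearN -{2}(s0E v).2.
  by rewrite opprD addrA subrr add0r.
move=> v; rewrite /= comp_lfunE s1E' id_lfunE opp_lfunE zero_lfunE linear0 add0r.
have := s1E v; rewrite t'E e'E => -[_ ->].
by rewrite add_lfunE opp_lfunE id_lfunE comp_lfunE addrAC subrr add0r.
Qed.

End TwoTerm.

(** * Morphisms in the derived category as homotopy classes *)

Section Roofs.
Variables (k : fieldType) (A : falgType k) (P : cplx A).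
Hypothesis P_two_term : forall i : int, i <> -1 -> i <> 0 -> is_zero (P i).
Hypotheses (proj1 : projective (P m1)) (proj0 : projective (P (nxt m1))).
Variable bP : bounded P.
Implicit Types X Y Z : cplx A.

Definition id_roof X (f : cmap P X) : roof P X := Roof bP (@quasi_iso_cid k A P) f.

Lemma section_unique Z (u : cmap Z P) (s t : cmap P Z) : quasi_iso u ->
  homotopic (ccomp u s) (cid P) -> homotopic (ccomp u t) (cid P) -> homotopic s t.
Proof.
move=> qu us ut; apply: (quasi_iso_cancel P_two_term proj1 proj0 qu).
exact: htp_trans us (htp_sym ut).
Qed.

(** [f] is the map in the homotopy category that the roof represents. *)
Definition realizes X (r : roof P X) (f : cmap P X) : Prop :=
  exists2 s : cmap P (apex r), homotopic (ccomp (den r) s) (cid P) &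
    homotopic f (ccomp (num r) s).

Lemma realizes_exists X (r : roof P X) : exists f, realizes r f.
Proof.
have [s us] := quasi_iso_section P_two_term proj1 proj0 (@den_qiso _ _ _ _ r).
by exists (ccomp (num r) s), s => //; apply: htp_refl.
Qed.

Lemma realizes_id X (f : cmap P X) : realizes (id_roof f) f.
Proof.
exists (cid P); first exact: htp_idl.
exact: htp_sym (htp_idr _).
Qed.

Lemma realizes_equiv X (r r' : roof P X) f f' :
  realizes r f -> realizes r' f' -> roof_equiv r r' <-> homotopic f f'.
Proof.
move=> [s us fE] [s' us' fE']; split=> [[Z [u1 [u2 [bZ q den12 num12]]]]|ff'].
  have [t tE] := quasi_iso_section P_two_term proj1 proj0 q.
  have s1 : homotopic (ccomp u1 t) s.
    apply: section_unique us; first exact: den_qiso.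
    exact: htp_trans (htp_assoc _ _ _) tE.
  have s2 : homotopic (ccomp u2 t) s'.
    apply: section_unique us'; first exact: den_qiso.
    apply: htp_trans (htp_assoc _ _ _) (htp_trans _ tE).
    exact/htp_compr/htp_sym.
  apply: htp_trans fE _; apply: htp_trans (htp_sym (htp_compl _ s1)) _.
  apply: htp_trans (htp_assoc _ _ _) _; apply: htp_trans (htp_compr _ num12) _.
  apply: htp_trans (htp_assoc' _ _ _) _; apply: htp_trans (htp_compl _ s2) _.
  exact: htp_sym.
exists P, s, s'; split=> //.
- by apply: quasi_iso_htp (htp_sym us) _; apply: quasi_iso_cid.
- exact: htp_trans us (htp_sym us').
exact: htp_trans (htp_sym fE) (htp_trans ff' fE').
Qed.

Lemma realizes_lin X Z (bZ : bounded Z) (s : cmap Z P) (qs : quasi_iso s) c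
    (f g : cmap Z X) f' g' :
  realizes (Roof bZ qs f) f' -> realizes (Roof bZ qs g) g' ->
  exists t : cmap P Z, [/\ homotopic (ccomp s t) (cid P),
    homotopic f' (ccomp f t), homotopic g' (ccomp g t) &
    realizes (Roof bZ qs (clin c f g)) (clin c (ccomp f t) (ccomp g t))].
Proof.
move=> [t /= st fE] [t' /= st' gE]; exists t; split=> //.
  apply: htp_trans gE _; apply: htp_compl; exact: section_unique st' st.
exists t => //; apply: htp_eq => i v.
by rewrite /= !(add_lfunE, scale_lfunE, comp_lfunE).
Qed.

(** Both sides are composites of num g with sections over P, and sections of a
    quasi-isomorphism are unique up to homotopy. *)
Lemma realizes_comp X Y (g : roof P Y) (b : roof P P) (h : roof P Y) f_g f_b f_h :
  roof_comp g b h -> realizes g f_g -> realizes b f_b -> realizes h f_h ->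
  homotopic f_h (ccomp f_g f_b).
Proof.
move=> [Z [t [u [bZ qt tu [Z' [v1 [v2 [bZ' q den12 num12]]]]]]]] [sg sgE gE] [sb sbE bE] [sh shE hE].
have qbt : quasi_iso (ccomp (den b) t) by apply: quasi_iso_comp => //; apply: den_qiso.
have [tau tauE] := quasi_iso_section P_two_term proj1 proj0 qbt.
have [sig sigE] := quasi_iso_section P_two_term proj1 proj0 q.
have tb : homotopic (ccomp t tau) sb.
  apply: section_unique sbE; first exact: den_qiso.
  exact: htp_trans (htp_assoc _ _ _) tauE.
have gu : homotopic (ccomp sg f_b) (ccomp u tau).
  apply: (quasi_iso_cancel P_two_term proj1 proj0 (@den_qiso _ _ _ _ g)).
  apply: htp_trans (htp_assoc _ _ _) _; apply: htp_trans (htp_compr _ sgE) _.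
  apply: htp_trans (htp_idl _) _; apply: htp_trans bE _.
  apply: htp_trans (htp_compl _ (htp_sym tb)) _.
  apply: htp_trans (htp_assoc _ _ _) _; apply: htp_trans (htp_compr _ tu) _.
  exact: htp_assoc'.
have v1s : homotopic (ccomp v1 sig) sh.
  apply: section_unique shE; first exact: den_qiso.
  exact: htp_trans (htp_assoc _ _ _) sigE.
have v2s : homotopic (ccomp v2 sig) tau.
  apply: section_unique qbt _ tauE.
  apply: htp_trans (htp_assoc _ _ _) (htp_trans _ sigE).
  exact/htp_compr/htp_sym.
apply: htp_trans hE _; apply: htp_trans (htp_compl _ (htp_sym v1s)) _.
apply: htp_trans (htp_assoc _ _ _) _; apply: htp_trans (htp_compr _ num12) _.
apply: htp_trans (htp_assoc' _ _ _) _; apply: htp_trans (htp_compl _ v2s) _.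
apply: htp_trans (htp_assoc' _ _ _) _; apply: htp_trans (htp_compl _ (htp_sym gu)) _.
apply: htp_trans (htp_assoc _ _ _) _; apply: htp_compr; exact: htp_sym.
Qed.

Lemma roof_comp_id X (a : cmap P X) (b : cmap P P) :
  roof_comp (id_roof a) (id_roof b) (id_roof (ccomp a b)).
Proof.
exists P, (cid P), b; split=> //=.
- exact: quasi_iso_cid.
- exact: htp_trans (htp_idr _) (htp_sym (htp_idl _)).
exists P, (cid P), (cid P); split=> //.
- by apply: quasi_iso_comp; apply: quasi_iso_cid.
- by apply: htp_eq => i v; rewrite /= !comp_lfunE !id_lfunE.
exact: htp_refl.
Qed.

(** The complexes X such that a chain map from P to X is a pair of maps in
    degrees -1 and 0, up to a single homotopy component. *)
Definition narrow X : Prop :=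
  is_zero (X m2) /\ forall v, cd X (nxt m1) v = 0.

Lemma narrow_P : narrow P.
Proof. by split=> [|v]; [apply: P_two_term|exact: (@two_term_pos _ _ _ P_two_term 0)]. Qed.

Lemma is_Dhom_pairs X (V : vectType k) (c : roof P X -> V) :
  narrow X -> is_Dhom c ->
  exists kap : 'Hom(hpair (arrow_of P) (arrow_of X), V),
  [/\ forall f : cmap P X, kap (cpair f) = c (id_roof f),
      forall v, exists2 a, chain a & kap a = v &
      forall a, chain a -> (kap a = 0 <-> null a)].
Proof.
move=> [X2 Xd] dc.
have c_eq (f g : cmap P X) : c (id_roof f) = c (id_roof g) <-> homotopic f g.
  by rewrite (Dhom_eq dc); apply: realizes_equiv; apply: realizes_id.
have c_lin z (f g : cmap P X) : c (id_roof (clin z f g)) = z *: c (id_roof f) + c (id_roof g).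
  exact: (Dhom_lin dc).
have c0 : c (id_roof (czero P X)) = 0.
  have := c_lin (-1) (czero P X) (czero P X); rewrite scaleN1r addNr => <-.
  apply/c_eq/htp_eq => i v; rewrite /= add_lfunE scale_lfunE zero_lfunE.
  by rewrite scaler0 addr0.
have [||kap kapE] := @lfun_of_graph k (cmap P X) (hpair (arrow_of P) (arrow_of X)) V
    (@cpair k A P X) (fun f => c (id_roof f)) (czero P X).
- by move=> z f g; exists (clin z f g); rewrite c_lin.
- move=> f f0; rewrite -c0; apply/c_eq/(homotopic_null P_two_term) => //.
  by rewrite f0 sub0r -[- _]addr0 -scaleN1r; apply: null_lin; exact: null0.
have pair_map a : chain a -> exists f : cmap P X, cpair f = a.
  by move=> ac; apply: cmap_of_pair.
exists kap; split=> // [v|a /pair_map[f <-]].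
  have [r <-] := Dhom_surj dc v; have [f fr] := realizes_exists r.
  exists (cpair f); first exact: cpair_chain.
  rewrite kapE; apply/(Dhom_eq dc); apply/(realizes_equiv (realizes_id f) fr).
  exact: htp_refl.
rewrite kapE -c0 c_eq (homotopic_null P_two_term) //.
by have -> : cpair f - cpair (czero P X) = cpair f by rewrite -[RHS]subr0.
Qed.

Variables (B : falgType k) (cl : roof P P -> B).

Lemma Dend_endomorphisms : is_Dend cl ->
  exists beta : 'Hom(hpair (arrow_of P) (arrow_of P), B),
    endomorphisms beta /\ forall f : cmap P P, beta (cpair f) = cl (id_roof f).
Proof.
move=> [dcl cl1 clM]; have [beta [bE bsurj bnull]] := is_Dhom_pairs narrow_P dcl.
exists beta; split=> //; split=> //.
  have -> : (\1%VF, \1%VF) = cpair (cid P) by [].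
  by rewrite bE cl1.
have pm a : chain a -> exists f : cmap P P, cpair f = a.
  by move=> ac; apply: cmap_of_pair => // v; exact: (@two_term_pos _ _ _ P_two_term 0).
move=> a c /pm[f <-] /pm[g <-]; rewrite -cpair_comp !bE; apply: clM.
exact: roof_comp_id.
Qed.

Variable beta : 'Hom(hpair (arrow_of P) (arrow_of P), B).
Hypothesis dcl : is_Dhom cl.
Hypothesis betaE : forall f : cmap P P, beta (cpair f) = cl (id_roof f).

Lemma represents_of_Dhom_mod X (M : rmod B) : narrow X -> Dhom_mod cl X M ->
  exists kap : 'Hom(hpair (arrow_of P) (arrow_of X), M), represents beta kap.
Proof.
move=> nX [clX [dX actX]]; have [kap [kE ksurj knull]] := is_Dhom_pairs nX dX.
exists kap; split=> // a c ac cc.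
have [f <-] := cmap_of_pair P_two_term ac (fun v => nX.2 _).
have [g <-] := cmap_of_pair P_two_term cc (fun v => narrow_P.2 _).
rewrite -cpair_comp !kE betaE; apply: actX; exact: roof_comp_id.
Qed.

(** A roof is sent to the class of any map that realizes it. *)
Lemma Dhom_mod_of_represents X (M : rmod B) (kap : 'Hom(hpair (arrow_of P) (arrow_of X), M)) :
  narrow X -> represents beta kap -> Dhom_mod cl X M.
Proof.
move=> [X2 Xd] rep.
have [real realP] := choice_fun (@realizes_exists X).
have kap_htp (f g : cmap P X) : kap (cpair f) = kap (cpair g) <-> homotopic f g.
  by rewrite (rep_eq rep) ?(homotopic_null P_two_term) //; apply: cpair_chain.
exists (fun r => kap (cpair (real r))); split; first split.
- move=> v; have [a ac <-] := rep_surj rep v.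
  have [f <-] := cmap_of_pair P_two_term ac (fun v => Xd _).
  exists (id_roof f); apply/kap_htp.
  apply/(realizes_equiv (realP (id_roof f)) (realizes_id f)).
  exact/(realizes_equiv (realizes_id f) (realizes_id f))/htp_refl.
- by move=> r r'; rewrite kap_htp; split=> /(realizes_equiv (realP r) (realP r')).
- move=> Z bZ s qs c f g.
  have [t [st fE gE lE]] := realizes_lin c (realP (Roof bZ qs f)) (realP (Roof bZ qs g)).
  have /kap_htp -> := fE; have /kap_htp -> := gE.
  rewrite -linearP -cpair_lin; apply/kap_htp.
  apply/(realizes_equiv (realP (Roof bZ qs (clin c f g))) lE).
  exact/(realizes_equiv lE lE)/htp_refl.
move=> g b h ghb.
have [real' realP'] := realizes_exists b.
have -> : cl b = beta (cpair real').
  rewrite betaE; apply/(Dhom_eq dcl)/(realizes_equiv realP' (realizes_id real')).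
  exact: htp_refl.
rewrite -(rep_act rep); [|exact: cpair_chain|exact: cpair_chain].
rewrite -cpair_comp; apply/kap_htp.
exact: realizes_comp ghb (realP g) realP' (realP h).
Qed.

Lemma Dhom_zeroP X : (forall f : cmap P X, homotopic f (czero P X)) -> Dhom_zero P X.
Proof.
move=> X0 r; have [s us] := quasi_iso_section P_two_term proj1 proj0 (@den_qiso _ _ _ _ r).
exists P, s, s; split=> //.
- by apply: quasi_iso_htp (htp_sym us) _; apply: quasi_iso_cid.
- exact: htp_refl.
apply: htp_trans (X0 _) _; apply: htp_eq => i v.
by rewrite /= comp_lfunE !zero_lfunE.
Qed.
End Roofs.

(** * Objects of add P *)

Section Perfect.
Variables (k : fieldType) (A : falgType k).
Implicit Types X Y P : cplx A.

Lemma projective_rzero : projective (rzero A).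
Proof.
move=> X Y g f _ _; exists 0; first exact: rlinear0.
by rewrite [LHS]from_rzero [RHS]from_rzero.
Qed.

Lemma stalk_zero (M : rmod A) i : i <> 0 -> is_zero (stalk M i).
Proof.
rewrite /= /stalk_ob; case: eqP => // _ _ v; exact: thinmx0.
Qed.

Lemma perfect_stalk (M : rmod A) : projective M -> perfect (stalk M).
Proof.
move=> pM; split; first by exists 0%N => i i0; apply: stalk_zero; lia.
by move=> i; rewrite /= /stalk_ob; case: eqP => // _; apply: projective_rzero.
Qed.

Lemma perfect_shift X : perfect X -> perfect (shift X).
Proof.
move=> [[n nX] pX]; split=> [|i]; last exact: pX.
by exists n.+1 => i ni; apply: nX; rewrite /nxt; lia.
Qed.

Lemma rsum_zero (M N : rmod A) : is_zero M -> is_zero N -> is_zero (rsum M N).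
Proof. by move=> M0 N0 [x y]; rewrite (M0 x) (N0 y). Qed.

Lemma perfect_cone X Y (f : cmap X Y) : perfect X -> perfect Y -> perfect (cone f).
Proof.
move=> [[n nX] pX] [[m mY] pY]; split=> [|i]; last exact: projective_rsum.
exists (n + m).+1 => i ni; apply: rsum_zero; [apply: nX|apply: mY]; rewrite /nxt; lia.
Qed.

(** The complement of X in P is the cone of f.  The maps between the direct sum
    of X and the cone and P are (x, (x', p)) |-> f x + p - f g p and
    p |-> (g p, (0, p)). *)
Lemma in_add_retract X P (f : cmap X P) (g : cmap P X) :
  perfect X -> perfect P -> (forall i v, g i (f i v) = v) -> in_add P X.
Proof.
move=> pX pP gf; split=> //; exists 1%N, (cone f); split; first exact: perfect_cone.
pose S := csum X (cone f); pose T := cpow 1 P.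
have cS i x : cd S i x = (cd X i x.1, (- cd X (nxt i) x.2.1, f (nxt i) x.2.1 + cd P i x.2.2)).
  by rewrite [LHS]diag_lfunE; congr (_, _); rewrite [LHS]cone_dE.
have cT i x : cd T i x = (cd P i x.1, 0) by rewrite [LHS]diag_lfunE /= zero_lfunE.
have Phi_ex i : exists2 h : 'Hom(S i, T i), rlinear h &
    forall x, h x = (f i x.1 + (x.2.2 - f i (g i x.2.2)), 0).
  have [h1 h1l h1E] := copairing (@rlinear0 _ _ (X (nxt i)) (P i))
    (rlinearB (@rlinear_id _ _ (P i)) (rlinear_comp (@cfun_rlinear _ _ _ _ f i)
      (@cfun_rlinear _ _ _ _ g i))).
  have [h2 h2l h2E] := copairing (@cfun_rlinear _ _ _ _ f i) h1l.
  have [h hl hE] := pairing h2l (@rlinear0 _ _ (S i) (stalk (rzero A) i)).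
  exists h => // x; rewrite hE h2E h1E !zero_lfunE add0r.
  by rewrite add_lfunE opp_lfunE id_lfunE comp_lfunE.
have [Phi PhiL PhiE] := choice_fun2 Phi_ex.
have Psi_ex i : exists2 h : 'Hom(T i, S i), rlinear h &
    forall y, h y = (g i y.1, (0, y.1)).
  have [h1 h1l h1E] := pairing (@rlinear0 _ _ (P i) (X (nxt i))) (@rlinear_id _ _ (P i)).
  have [h2 h2l h2E] := pairing (@cfun_rlinear _ _ _ _ g i) h1l.
  have [h hl hE] := copairing h2l (@rlinear0 _ _ (stalk (rzero A) i) (S i)).
  by exists h => // y; rewrite hE h2E h1E !zero_lfunE id_lfunE addr0.
have [Psi PsiL PsiE] := choice_fun2 Psi_ex.
have Phi_c i : (cd T i \o Phi i)%VF = (Phi (nxt i) \o cd S i)%VF.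
  apply/lfunP=> x; rewrite !comp_lfunE cT !PhiE cS /=; congr (_, _).
  rewrite linearD /= linearB /= !cfun_cd [g _ (_ + _)]linearD /= gf.
  by rewrite [f _ (_ + _)]linearD /= opprD addrACA subrr add0r.
have Psi_c i : (cd S i \o Psi i)%VF = (Psi (nxt i) \o cd T i)%VF.
  apply/lfunP=> y; rewrite !comp_lfunE cS !PsiE cT /= cfun_cd.
  by rewrite !linear0 ?oppr0 ?add0r.
have H_ex i : exists2 h : 'Hom(S (nxt i), S i), rlinear h &
    forall x, h x = (0, (x.1 - g (nxt i) x.2.2, 0)).
  have [h1 h1l h1E] := copairing (@rlinear0 _ _ (X (nxt (nxt i))) (X (nxt i)))
    (rlinearN (@cfun_rlinear _ _ _ _ g (nxt i))).
  have [h2 h2l h2E] := copairing (@rlinear_id _ _ (X (nxt i))) h1l.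
  have [h3 h3l h3E] := pairing h2l (@rlinear0 _ _ (S (nxt i)) (P i)).
  have [h hl hE] := pairing (@rlinear0 _ _ (S (nxt i)) (X i)) h3l.
  exists h => // x; rewrite hE h3E h2E h1E !zero_lfunE add0r.
  by rewrite opp_lfunE id_lfunE.
have [H HL HE] := choice_fun2 H_ex.
exists (CMap PhiL Phi_c), (CMap PsiL Psi_c); split.
  exists H => // i; apply/lfunP=> x.
  rewrite !(add_lfunE, opp_lfunE, comp_lfunE) id_lfunE /= PsiE PhiE !HE !cS /=.
  case: x => x [x' p] /=.
  rewrite !linear0 linearB /= !cfun_cd linearD /= linearB /= linearD /= !gf.
  apply: pair_ext => /=; first by rewrite subrr addr0 subrr addr0.
  apply: pair_ext => /=; last by rewrite !addr0 linearB /= -addrA [_ - p]addrAC subrr sub0r.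
  rewrite sub0r [g _ (_ + _)]linearD /= gf opprK opprD addrACA addNr add0r.
  by rewrite addrCA subrr addr0.
apply: htp_eq => i y; rewrite /= comp_lfunE id_lfunE PhiE PsiE /=.
rewrite addrCA subrr addr0; case: y => y y0; congr (_, _).
rewrite -[LHS]/(0 : stalk (rzero A) i) [RHS](_ : y0 = 0) //.
move: y0; rewrite /= /stalk_ob; case: eqP => _ y0; exact: thinmx0.
Qed.
End Perfect.

Section NotInAdd.
Variables (k : fieldType) (A : falgType k) (P : cplx A).
Hypothesis sP : two_term_silting P.
Let tP := silting_two_term sP.
Variables (Q : rmod A) (projQ : projective Q).

Lemma in_add_stalk (a : 'Hom(P (nxt m1), Q)) (s : 'Hom(Q, P (nxt m1))) :
  rlinear a -> rlinear s -> (forall v, a (cd P m1 v) = 0) -> (forall v, a (s v) = v) ->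
  in_add P (stalk Q).
Proof.
move=> al sl ad as1.
have two : forall i : int, i <> -1 -> i <> 0 -> is_zero (stalk Q i).
  by move=> i _; apply: stalk_zero.
have [||f fE] := cmap_of_pair two (X := P)
  (a := ((0, s) : hpair (arrow_of (stalk Q)) (arrow_of P))).
- by split=> [||v]; [exact: rlinear0|exact: sl|rewrite /= !zero_lfunE !linear0].
- by move=> v; apply: (@two_term_pos _ _ _ tP 0).
have [||g gE] := cmap_of_pair tP (X := stalk Q)
  (a := ((0, a) : hpair (arrow_of P) (arrow_of (stalk Q)))).
- by split=> [||v]; [exact: rlinear0|exact: al|rewrite /= !zero_lfunE ad].
- by move=> v; rewrite /= zero_lfunE.
apply: (in_add_retract (f := f) (g := g)); [exact: perfect_stalk|exact: silting_perfect|].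
move=> i v; have [i0|i0] := eqVneq i 0; last first.
  by rewrite [LHS](stalk_zero (i := i)) ?[RHS](stalk_zero (i := i)) //; apply/eqP.
have f0 : f (nxt m1) = s by have := congr1 snd fE.
have g0 : g (nxt m1) = a by have := congr1 snd gE.
have i1 : i = nxt m1 by [].
by subst i; rewrite f0 g0; apply: as1.
Qed.

Lemma in_add_shift (a : 'Hom(P m1, Q)) (s : 'Hom(Q, P m1)) :
  rlinear a -> rlinear s -> (forall v, cd P m1 (s v) = 0) -> (forall v, a (s v) = v) ->
  in_add P (shift (stalk Q)).
Proof.
move=> al sl sd as1.
have zero i : i <> -1 -> is_zero (shift (stalk Q) i).
  by move=> i1; apply: stalk_zero => n0; apply: i1; rewrite -[i](addrK 1) -/(nxt i) n0 sub0r.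
have two : forall i : int, i <> -1 -> i <> 0 -> is_zero (shift (stalk Q) i).
  by move=> i i1 _; apply: zero.
have [||f fE] := cmap_of_pair two (X := P)
  (a := ((s, 0) : hpair (arrow_of (shift (stalk Q))) (arrow_of P))).
- by split=> [||v]; [exact: sl|exact: rlinear0|rewrite /= zero_lfunE sd].
- by move=> v; apply: (@two_term_pos _ _ _ tP 0).
have [||g gE] := cmap_of_pair tP (X := shift (stalk Q))
  (a := ((a, 0) : hpair (arrow_of P) (arrow_of (shift (stalk Q))))).
- by split=> [||v]; [exact: al|exact: rlinear0|rewrite /= opp_lfunE !zero_lfunE oppr0].
- by move=> v; rewrite /= zero_lfunE linear0.
apply: (in_add_retract (f := f) (g := g)).
- exact/perfect_shift/perfect_stalk.
- exact: silting_perfect.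
move=> i v; have [i0|i0] := eqVneq i (-1); last first.
  by rewrite [LHS](zero i) ?[RHS](zero i) //; apply/eqP.
have f0 : f m1 = s by have := congr1 fst fE.
have g0 : g m1 = a by have := congr1 fst gE.
have i1 : i = m1 by [].
by subst i; rewrite f0 g0; apply: as1.
Qed.
End NotInAdd.

(** * Generation and rigidity of a silting complex *)

Section Generation.
Variables (k : fieldType) (A : falgType k) (M : rmod A).
Implicit Types X Y : cplx A.

(** Exactness of Hom(X, M), i.e. the vanishing in the homotopy category of all
    maps from X to the shifts of M. *)
Definition hom_acyclic X : Prop := forall i (a : 'Hom(X (nxt i), M)), rlinear a ->
  (forall v, a (cd X i v) = 0) ->
  exists2 b : 'Hom(X (nxt (nxt i)), M), rlinear b & forall v, a v = b (cd X (nxt i) v).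

Lemma nxt_surj (i : int) : exists j, i = nxt j.
Proof. by exists (i - 1); rewrite /nxt subrK. Qed.

Lemma hom_acyclic_shift X : hom_acyclic X <-> hom_acyclic (shift X).
Proof.
split=> acX i a al ad.
  have [|b bl bE] := acX (nxt i) a al.
    by move=> v; have := ad v; rewrite /= opp_lfunE linearN => /eqP; rewrite oppr_eq0 => /eqP.
  exists (- b); first exact: rlinearN.
  by move=> v; rewrite /= !opp_lfunE linearN opprK.
have [j ij] := nxt_surj i; subst i.
have [|b bl bE] := acX j a al.
  by move=> v; rewrite /= opp_lfunE linearN /= ad oppr0.
exists (- b); first exact: rlinearN.
by move=> v; rewrite bE /= !opp_lfunE linearN.
Qed.

Lemma hom_acyclic_htp X Y : htp_iso X Y -> hom_acyclic X -> hom_acyclic Y.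
Proof.
move=> [f [g [_ [h hl hE]]]] acX i a al ad.
have [||b bl bE] := acX i (a \o f (nxt i))%VF.
- by apply: rlinear_comp => //; apply: cfun_rlinear.
- by move=> v; rewrite comp_lfunE -cfun_cd ad.
exists ((b \o g (nxt (nxt i))) - (a \o h (nxt i)))%VF.
  by apply: rlinearB; apply: rlinear_comp => //; apply: cfun_rlinear.
move=> v; have /lfunP/(_ v) := hE i.
rewrite !(add_lfunE, opp_lfunE, comp_lfunE) /= ?comp_lfunE ?id_lfunE => /(congr1 a).
rewrite linearB linearD /= ad add0r -cfun_cd -bE comp_lfunE => <-.
by rewrite opprB addrC subrK.
Qed.

Lemma hom_acyclic_cone X Y (f : cmap X Y) :
  hom_acyclic X -> hom_acyclic Y -> hom_acyclic (cone f).
Proof.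
move=> acX acY i a al ad.
have aC x y : a (cd (cone f) i (x, y)) = a (- cd X (nxt i) x, f (nxt i) x + cd Y i y).
  by rewrite [cd _ _ _]cone_dE.
have [i1 i1l i1E] := rinl_exists (X (nxt (nxt i))) (Y (nxt i)).
have [i2 i2l i2E] := rinr_exists (X (nxt (nxt i))) (Y (nxt i)).
pose a1 : 'Hom(X (nxt (nxt i)), M) := (a \o i1)%VF.
pose a2 : 'Hom(Y (nxt i), M) := (a \o i2)%VF.
have aE x y : a (x, y) = a1 x + a2 y.
  by rewrite !comp_lfunE i1E i2E -linearD; congr (a (_, _)); rewrite ?addr0 ?add0r.
have a1l : rlinear a1 by exact: rlinear_comp.
have a2l : rlinear a2 by exact: rlinear_comp.
clearbody a1 a2.
have [|b2 b2l b2E] := acY i a2 a2l.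
  by move=> y; have := ad (0, y); rewrite aC aE !linear0 ?oppr0 ?linear0 !add0r.
have [||b1 b1l b1E] := acX (nxt i) (a1 - (b2 \o f (nxt (nxt i))))%VF.
- by apply: rlinearB => //; apply: rlinear_comp => //; apply: cfun_rlinear.
- move=> x; have := ad (x, 0); rewrite aC aE !linear0 addr0 linearN /=.
  rewrite add_lfunE opp_lfunE comp_lfunE -cfun_cd -b2E => /eqP.
  by rewrite addrC subr_eq0 => /eqP ->; rewrite subrr.
have [b bl bE] := copairing (rlinearN b1l) b2l.
exists b => // -[x y]; rewrite aE [cd _ _ _]cone_dE bE /= opp_lfunE linearN opprK linearD /=.
by rewrite -b1E -b2E add_lfunE opp_lfunE comp_lfunE addrA subrK.
Qed.

Lemma hom_acyclic_summand X Y : hom_acyclic (csum X Y) -> hom_acyclic X.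
Proof.
move=> ac i a al ad.
have [a' a'l a'E] := copairing al (@rlinear0 _ _ (Y (nxt i)) M).
have [||b bl bE] := ac i a' => //.
  by move=> v; rewrite a'E zero_lfunE addr0 [cd _ _ _]diag_lfunE /= ad.
have [j jl jE] := rinl_exists (X (nxt (nxt i))) (Y (nxt (nxt i))).
exists (b \o j)%VF; first exact: rlinear_comp.
move=> v; have := bE (v, 0); rewrite a'E zero_lfunE addr0 /= => ->.
by rewrite comp_lfunE jE; congr (b _); rewrite [LHS]diag_lfunE /= linear0.
Qed.

Variable P : cplx A.
Hypothesis sP : two_term_silting P.

(** The perfect complexes X with Hom(X, M[j]) = 0 for all j form a thick
    subcategory.  It contains P, hence A, and Hom(A, M) = M. *)
Lemma silting_generates_modules :
  torsfree (arrow_of P) M -> tors (arrow_of P) M -> is_zero M.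
Proof.
move=> tf tt.
have acP : hom_acyclic P.
  (* The degree i + 1 is positive, 0, -1 and less than -1, respectively. *)
  move=> i; case: i => [n|[|[|n]]] a al ad.
  - exists 0; [exact: rlinear0|move=> v].
    by rewrite (@two_term_pos _ _ _ (silting_two_term sP) n v) !linear0.
  - exists 0; [exact: rlinear0|move=> v].
    by rewrite zero_lfunE; apply: tf.
  - by have [b bl bE] := tt a al; exists b.
  exists 0; [exact: rlinear0|move=> v].
  by rewrite (@two_term_neg' _ _ _ (silting_two_term sP) n v) !linear0.
have thick : thick_subcat (fun X => perfect X /\ hom_acyclic X).
  split.
  - by move=> X [].
  - by move=> X Y pY XY [_ acX]; split=> //; apply: hom_acyclic_htp XY acX.
  - move=> X pX; split=> [[_ acX]|[_ acX]].
    by split; [apply: perfect_shift|exact: (hom_acyclic_shift X).1].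
    by split=> //; apply/hom_acyclic_shift.
  - move=> X Y f [pX acX] [pY acY].
    by split; [apply: perfect_cone|apply: hom_acyclic_cone].
  - by move=> X Y pX pY [_ ac]; split=> //; apply: hom_acyclic_summand ac.
have [|_ acA] := silting_generates sP thick _ (perfect_stalk (@projective_regular _ _)).
  by split=> //; apply: silting_perfect.
move=> m; have [|h hE] := @lfun_of_linear k (regular A) M (fun a : A => ract M a m).
  by move=> c a b; rewrite ract_lin_comb.
have hl : rlinear h by move=> a v; rewrite !hE lfunE /= ractM comp_lfunE.
have [|b bl bE] := acA m1 h hl.
  by move=> v; rewrite /= zero_lfunE linear0.
have := bE (1 : A); rewrite hE ract1 id_lfunE => ->.
by rewrite /= zero_lfunE linear0.
Qed.

Lemma silting_rigid_arrow : rigid (arrow_of P).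
Proof.
move=> e el.
have [||f fE] := @cmap_of_pair _ _ _ (silting_two_term sP) (shift P)
   ((e, 0) : hpair (arrow_of P) (arrow_of (shift P))).
- split=> // [|v]; first exact: rlinear0.
  by rewrite /= zero_lfunE; apply: (@two_term_pos _ _ _ (silting_two_term sP) 0).
- by move=> v; rewrite /= zero_lfunE linear0.
have [h0 [h1 [h0l h1l _ E1]]] := pair_of_homotopic (silting_two_term sP) (silting_rigid sP f).
exists (- h1); first exact: rlinearN.
exists h0 => // t; have := E1 t; rewrite zero_lfunE subr0.
have -> : f m1 = e by have := congr1 fst fE.
by move=> ->; rewrite /= !opp_lfunE linearN.
Qed.

End Generation.

(** * The modules of morphisms from a silting complex *)

Section Assembly.
Variables (k : fieldType) (A : falgType k) (P : cplx A).
Hypothesis sP : two_term_silting P.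

Let tP := silting_two_term sP.
Let bP : bounded P := (silting_perfect sP).1.
Let proj1 : projective (P m1) := (silting_perfect sP).2 m1.
Let proj0 : projective (P (nxt m1)) := (silting_perfect sP).2 (nxt m1).

Variables (B : falgType k) (cl : roof P P -> B).
Hypothesis cl_end : is_Dend cl.
Variable beta : 'Hom(hpair (arrow_of P) (arrow_of P), B).
Hypothesis end_p : endomorphisms beta.
Hypothesis betaE : forall f : cmap P P, beta (cpair f) = cl (id_roof bP f).
Implicit Types M Y : rmod A.

Lemma represents_arrow M (N : rmod A) (d d' : 'Hom(M, N)) (dl : rlinear d) (d'l : rlinear d')
    (L : rmod B) (kap : 'Hom(hpair (arrow_of P) (Arrow dl), L)) :
  d = d' -> represents beta kap ->
  represents (x := Arrow d'l) beta (kap : 'Hom(hpair (arrow_of P) (Arrow d'l), L)).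
Proof. by move=> E; subst d'; case=> s n a; split. Qed.

Lemma narrow_stalk M : narrow (stalk M).
Proof. by split=> [v|v]; [exact: thinmx0|rewrite /= zero_lfunE]. Qed.
Lemma narrow_shift M : narrow (shift (stalk M)).
Proof. by split=> [v|v]; [exact: thinmx0|rewrite /= opp_lfunE zero_lfunE oppr0]. Qed.

Lemma Dhom_mod_deg0 M (L : rmod B) : Dhom_mod cl (stalk M) L <->
  exists kap : 'Hom(hpair (arrow_of P) (deg0 M), L), represents beta kap.
Proof.
split=> [|[kap rep]].
  move/(represents_of_Dhom_mod tP proj1 proj0 betaE (@narrow_stalk M)) => [kap rep].
  exists kap; exact: represents_arrow rep.
apply: (Dhom_mod_of_represents tP proj1 proj0 (Dend_hom cl_end) betaE (@narrow_stalk M)).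
exact: represents_arrow rep.
Qed.

Lemma Dhom_mod_deg1 M (L : rmod B) : Dhom_mod cl (shift (stalk M)) L <->
  exists kap : 'Hom(hpair (arrow_of P) (deg1 M), L), represents beta kap.
Proof.
split=> [|[kap rep]].
  move/(represents_of_Dhom_mod tP proj1 proj0 betaE (@narrow_shift M)) => [kap rep].
  exists kap; apply: represents_arrow rep; exact: oppr0.
apply: (Dhom_mod_of_represents tP proj1 proj0 (Dend_hom cl_end) betaE (@narrow_shift M)).
apply: represents_arrow rep; exact/esym/oppr0.
Qed.

Lemma torF_torsfree Y : torsfree (arrow_of P) Y -> torF P Y.
Proof.
move=> tf; apply: (Dhom_zeroP tP proj1 proj0 bP) => f.
apply/(homotopic_null tP); first exact: (@narrow_stalk Y).1.
have fc := cpair_chain f.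
apply: (@null_deg0 _ _ Y (arrow_of P) (cpair f - cpair (czero P (stalk Y)))).2 => v.
rewrite /= add_lfunE opp_lfunE zero_lfunE subr0.
have [_ fl fd] := fc; apply: (tf _ fl) => u.
by have := fd u; rewrite /= zero_lfunE => <-.
Qed.

Lemma torT_tors Y : tors (arrow_of P) Y -> torT P Y.
Proof.
move=> tt; apply: (Dhom_zeroP tP proj1 proj0 bP) => f.
apply/(homotopic_null tP); first exact: (@narrow_shift Y).1.
have [fl _ _] := cpair_chain f; have [h hl hE] := tt _ fl.
exists h => //; split=> v; last by rewrite [LHS]thinmx0 [RHS]thinmx0.
by rewrite /= add_lfunE opp_lfunE zero_lfunE subr0; apply: hE.
Qed.

Let rig : rigid (arrow_of P) := silting_rigid_arrow sP.

(** If Q is the torsion-free quotient of M then Hom(P, M[1]) = Hom(P, Q[1]),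
    since the torsion part S satisfies Hom(P, S[1]) = 0 and Hom(P, S[2]) = 0. *)
Lemma torX_deg1 M (L : rmod B) (kap : 'Hom(hpair (arrow_of P) (deg1 M), L)) :
  represents beta kap -> torX cl L.
Proof.
move=> rep; have [S [Q [i [q [[[il i0] [ql qf] iq] tS tQ]]]]] :=
  torsion_sequence (p := arrow_of P) proj1 proj0 rig M.
exists Q; first exact: torF_torsfree.
apply/Dhom_mod_deg1.
have qonto : forall y, exists x, q x = y by apply/epiE.
pose f : hpair (deg1 M) (deg1 Q) := (q, 0).
apply: (rep_transport (f := f) rep); first exact: chain_deg1.
- move=> b [bl _ _].
  have [a al aE] := projective_lift (P := P m1) proj1 ql bl (fun v => qonto _).
  exists (a, 0); first exact: chain_deg1.
  apply/null_deg1; exists 0; first exact: rlinear0.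
  by move=> v; rewrite /= add_lfunE opp_lfunE comp_lfunE aE subrr zero_lfunE.
move=> a [al _ _] /null_deg1[h hl hE]; apply/null_deg1.
have [h' h'l h'E] := projective_lift (P := P (nxt m1)) proj0 ql hl (fun v => qonto _).
have [||t tl tE] := @mono_lift _ _ _ _ _ i (a.1 - (h' \o amap (arrow_of P)))%VF (conj il i0).
- by apply: rlinearB => //; apply: rlinear_comp => //; apply: amap_rlinear.
- move=> v; rewrite iq memv_ker add_lfunE opp_lfunE comp_lfunE linearB /= h'E -hE.
  by rewrite /= comp_lfunE subrr.
have [t' t'l t'E] := tS t tl.
exists (h' + (i \o t'))%VF; first by apply: rlinearD => //; apply: rlinear_comp.
move=> v; rewrite add_lfunE comp_lfunE -t'E -tE add_lfunE opp_lfunE comp_lfunE.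
by rewrite addrC subrK.
Qed.

(** If S is the torsion part of M then Hom(P, S) = Hom(P, M), since the
    torsion-free quotient Q satisfies Hom(P, Q) = 0 and Hom(P, Q[-1]) = 0. *)
Lemma torY_deg0 M : exists (L : rmod B) (kap : 'Hom(hpair (arrow_of P) (deg0 M), L)),
  represents beta kap /\ torY cl L.
Proof.
have [S [Q [i [q [[[il i0] [ql qf] iq] tS tQ]]]]] :=
  torsion_sequence (p := arrow_of P) proj1 proj0 rig M.
have [L [kS rS]] := representation_exists end_p (deg0 S).
pose f : hpair (deg0 S) (deg0 M) := (0, i).
have iinj := lker_eq0 i0.
have [|||kM rM] := rep_transport (f := f) rS.
- by split=> [||v]; [exact: rlinear0|exact: il|rewrite /= !zero_lfunE linear0].
- move=> b bc; have [_ bl _] := bc.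
  have [||a al aE] := @mono_lift _ _ _ _ _ i b.2 (conj il i0) => //.
    move=> v; rewrite iq memv_ker; apply/eqP; rewrite -comp_lfunE.
    apply: tQ => [|u]; first exact: rlinear_comp.
    by rewrite comp_lfunE (chain_deg0_eq0 u bc) linear0.
  exists (0, a).
    apply: chain_deg0 => // v; apply: iinj.
    by rewrite /= -aE (chain_deg0_eq0 v bc) linear0.
  by apply/null_deg0 => v; rewrite /= add_lfunE opp_lfunE comp_lfunE -aE subrr.
- move=> a ac /null_deg0 a0; apply/null_deg0 => v; apply: iinj.
  by have := a0 v; rewrite /= comp_lfunE linear0.
exists L, kM; split=> //; exists S; first exact: torT_tors.
by apply/Dhom_mod_deg0; exists kS.
Qed.

End Assembly.

(** * The canonical sequence *)

Theorem corollary5p3 (k : fieldType) (A : falgType k)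
    (P : cplx A) (P_silting : two_term_silting P)
    (* B = End_{D^b(A)}(P) *)
    (B : falgType k) (cl : roof P P -> B) (cl_end : is_Dend cl)
    (Pi : rmod A) (Pi_proj : projective Pi) (Pi_indec : indecomposable Pi)
    (Pi_add : ~ in_add P (stalk Pi)) (Pi1_add : ~ in_add P (shift (stalk Pi)))
    (* radPi = rad P_i and Si = P_i / rad P_i *)
    (radPi Si : rmod A) (inc : 'Hom(radPi, Pi)) (top : 'Hom(Pi, Si))
    (rad_top : short_exact inc top) (rad_inc : is_radical (limg inc))
    (* S_i is the socle of nu P_i, and Qi = nu P_i / S_i *)
    (Qi : rmod A) (soc : 'Hom(Si, nu Pi)) (quo : 'Hom(nu Pi, Qi))
    (soc_quo : short_exact soc quo) (soc_socle : is_socle (limg soc))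
    (* the almost split sequence starting at N = Hom_{D^b(A)}(P, nu P_i) *)
    (N E C : rmod B) (N_hom : Dhom_mod cl (stalk (nu Pi)) N)
    (f : 'Hom(N, E)) (g : 'Hom(E, C)) (fg_ass : almost_split_sequence f g) :
  exists (L M : rmod B) (u : 'Hom(L, E)) (v : 'Hom(E, M)),
    [/\ Dhom_mod cl (shift (stalk radPi)) L,
        Dhom_mod cl (stalk Qi) M &
        canonical_sequence cl u v].
Proof.
have two := silting_two_term P_silting; have [_ projP] := silting_perfect P_silting.
have proj1 : projective (asrc (arrow_of P)) := projP m1.
have proj0 : projective (atgt (arrow_of P)) := projP (nxt m1).
have [beta [end_p betaE]] :=
  Dend_endomorphisms two proj1 proj0 (silting_perfect P_silting).1 cl_end.
have rig := silting_rigid_arrow P_silting.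
have gen M := @silting_generates_modules _ _ M _ P_silting.
have [inc_mono [topl topf] inc_top] := rad_top.
have [[socl soc0] quo_epi soc_ker] := soc_quo.
pose w : 'Hom(Pi, nu Pi) := (soc \o top)%VF.
have wl : rlinear w by exact: rlinear_comp.
have inc_w : limg inc = lker w.
  rewrite inc_top; apply/vspaceP=> x; rewrite !memv_ker comp_lfunE.
  by apply/eqP/eqP => [->|]; [rewrite linear0|move/monoE: soc0; apply].
have w_quo : limg w = lker quo by rewrite /w limg_comp topf soc_ker.
clearbody w.
have I_inj := nu_injective Pi_proj.
have w_local : detects_split_epis w.
  move=> X h x hl whx; apply: (indec_projective_local (x := x) Pi_proj Pi_indec rad_inc hl).
  by rewrite inc_w memv_ker; apply/eqP.
have w0 : exists v, w v <> 0.
  have [v] := radical_proper Pi_indec.1 rad_inc; rewrite inc_w memv_ker => /eqP.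
  by exists v.
have nadd0 (a : 'Hom(atgt (arrow_of P), Pi)) (s : 'Hom(Pi, atgt (arrow_of P))) :
    rlinear a -> rlinear s -> (forall v, a (amap (arrow_of P) v) = 0) ->
    ~ (forall v, a (s v) = v).
  by move=> al sl ad as1; apply: Pi_add; apply: in_add_stalk al sl ad as1.
have nadd1 (a : 'Hom(asrc (arrow_of P), Pi)) (s : 'Hom(Pi, asrc (arrow_of P))) :
    rlinear a -> rlinear s -> (forall v, amap (arrow_of P) (s v) = 0) ->
    ~ (forall v, a (s v) = v).
  by move=> al sl sd as1; apply: Pi1_add; apply: in_add_shift al sl sd as1.
have /(Dhom_mod_deg0 cl_end betaE)[kN rN] := N_hom.
have [L [kL rL]] := representation_exists end_p (deg1 radPi).
have [M [kM [rM tM]]] := torY_deg0 cl_end end_p betaE Qi.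
have [E' [kE rE]] := representation_exists end_p (Arrow wl).
have [C' [kC rC]] := representation_exists end_p (deg1 Pi).
have [u [v uv]] := cohomology_sequence end_p proj1 proj0 inc_mono quo_epi inc_w w_quo rL rE rM.
have [F [G [FG FE GE]]] := connecting_sequence end_p rE I_inj w_local nadd0 nadd1 rN rC.
have nsF : ~ split_mono F.
  have [n0 n00] : exists n : N, n <> 0.
    apply: NNPP => no; have [_ [_ nsf _] _] := fg_ass; apply: nsf.
    exists 0; first exact: rlinear0.
    apply/lfunP=> n; apply: NNPP => ne; apply: no; exists n => n0; apply: ne.
    by rewrite n0 !linear0.
  apply: (connecting_not_split end_p proj1 proj0 rig gen w0 Pi_proj I_inj _ w_local rN rE FE n00).
  by move=> X a x; apply: nu_cogenerated.
have [|t tiso] := ass_unique fg_ass FG nsF.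
  have [_ [Gl _] _] := FG.
  move=> X h; exact: (lift_nonsplit end_p rig I_inj w_local rE rC Gl GE).
have [u' [v' u'v']] := short_exact_riso tiso uv.
exists L, M, u', v'; split.
- by apply/(Dhom_mod_deg1 cl_end betaE); exists kL.
- by apply/(Dhom_mod_deg0 cl_end betaE); exists kM.
split=> //; exact: (torX_deg1 cl_end betaE rL).
Qed.
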